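(* For any $y_1,y_2\in\mathbb{C}$ such that either $0<|y_i|<1$ for $i=1,2$, or $|y_i|=1$ for $i=1,2$, the $C^*$-algebra $\mathcal{E}(-1,y_1)$ is isomorphic to $\mathcal{E}(-1,y_2)$. The $C^*$-algebra $\mathcal{E}(-1,0)$ is not isomorphic to $\mathcal{E}(-1,y)$ for any $y\ne0$, $|y|\le1$.
   Context: For $y\in\mathbb{C}$, $|y|\le 1$, $\mathcal{E}(-1,y)$ is the universal (enveloping) $C^*$-algebra generated by $a_1,a_2$ with relations $a_i^*a_i+a_ia_i^*=1$ ($i=1,2$), $a_1^*a_2=-a_2a_1^*$, $a_1a_2+a_2a_1=y1$. *)

(* Defs.v *)
From HB Require Import structures.
From mathcomp Require Import all_boot all_order all_algebra.
From mathcomp Require Import boolp classical_sets reals topology normedtype.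
From mathcomp Require Import complex.

Set Implicit Arguments.
Unset Strict Implicit.
Unset Printing Implicit Defensive.

Import Order.TTheory GRing.Theory Num.Theory.
Import numFieldNormedType.Exports.

Local Open Scope classical_set_scope.
Local Open Scope ring_scope.

Definition norm_cvg (R : realType) (A : zmodType) (N : A -> R)
    (u : nat -> A) (l : A) : Prop :=
  (fun n => N (u n - l)) @ \oo --> (0 : R).

Definition norm_cauchy (R : realType) (A : zmodType) (N : A -> R)
    (u : nat -> A) : Prop :=
  forall e : R, 0 < e ->
    exists k, forall m n, (k <= m)%N -> (k <= n)%N -> N (u m - u n) < e.

(* Unital C*-algebras over the complex numbers [R[i]]; [ComplexField.Normc.normc]
   is the modulus with values in [R].
   The norm is a field of the mixin, and completeness is spelled out with sequences,
   because [normedModType] and [algType] cannot be joined: both are ancestors of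
   [numDomainType], and no common substructure was declared above it.
   [algType] entails [1 != 0], so the zero algebra is left out. *)
HB.mixin Record isCStarAlgebra (R : realType) A of GRing.Algebra R[i] A := {
  star : A -> A ;
  starK : involutive star ;
  starD : forall x y : A, star (x + y) = star x + star y ;
  starZ : forall (c : R[i]) (x : A), star (c *: x) = c^* *: star x ;
  starM : forall x y : A, star (x * y) = star y * star x ;
  cnorm : A -> R ;
  cnorm_eq0 : forall x : A, cnorm x = 0 -> x = 0 ;
  cnormD : forall x y : A, cnorm (x + y) <= cnorm x + cnorm y ;
  cnormZ : forall (c : R[i]) (x : A),
    cnorm (c *: x) = ComplexField.Normc.normc c * cnorm x ;
  cnormM : forall x y : A, cnorm (x * y) <= cnorm x * cnorm y ;
  cnorm_star : forall x : A, cnorm (star x * x) = cnorm x ^+ 2 ;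
  cnorm_complete : forall u : nat -> A,
    norm_cauchy cnorm u -> exists l : A, norm_cvg cnorm u l
}.

#[short(type="cstarAlgType")]
HB.structure Definition CStarAlgebra (R : realType) :=
  {A of isCStarAlgebra R A & GRing.Algebra R[i] A}.

Definition star_hom (R : realType) (A B : cstarAlgType R)
    (f : {lrmorphism A -> B}) : Prop :=
  forall x : A, f (star x) = star (f x).

Definition cstar_isomorphic (R : realType) (A B : cstarAlgType R) : Prop :=
  exists f : {lrmorphism A -> B}, star_hom f /\ bijective f.

Definition norm_closed (R : realType) (A : cstarAlgType R) (S : set A) : Prop :=
  forall (u : nat -> A) (l : A), (forall n, S (u n)) -> norm_cvg cnorm u l -> S l.

Definition cstar_subalgebra (R : realType) (A : cstarAlgType R) (S : set A) : Prop :=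
  [/\ norm_closed S,
      S 1,
      (forall (c : R[i]) (x y : A), S x -> S y -> S (c *: x + y)),
      (forall x y : A, S x -> S y -> S (x * y)) &
      (forall x : A, S x -> S (star x))].

Definition cstar_generated_by2 (R : realType) (A : cstarAlgType R) (a1 a2 : A) : Prop :=
  forall S : set A, cstar_subalgebra S -> S a1 -> S a2 -> S = setT.

Definition E_relations (R : realType) (y : R[i]) (A : cstarAlgType R) (a1 a2 : A) : Prop :=
  [/\ star a1 * a1 + a1 * star a1 = 1,
      star a2 * a2 + a2 * star a2 = 1,
      star a1 * a2 = - (a2 * star a1) &
      a1 * a2 + a2 * a1 = y%:A].

(* [is_E y E]: [E] is (a model of) the universal C*-algebra E(-1, y). The universal
   property determines [E] up to isomorphism; the morphism [f] below is unique,
   since [a1] and [a2] generate [E]. *)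
Definition is_E (R : realType) (y : R[i]) (E : cstarAlgType R) : Prop :=
  exists a1 a2 : E,
    [/\ E_relations y a1 a2,
        cstar_generated_by2 a1 a2 &
        forall (B : cstarAlgType R) (b1 b2 : B), E_relations y b1 b2 ->
          exists f : {lrmorphism E -> B}, [/\ star_hom f, f a1 = b1 & f a2 = b2]].

(* Main.v *)
(** The elements [a1 ^ 2] and [a2 ^ 2] are central, so that E(-1, y) is a field of
    Clifford algebras over its central characters, degenerate on the boundary.

    If [0 < |y| < 1], a linear change of generators turns the relations into those of
    [c], [d] with [c ^ 2 = lam d ^ 2]. Rotating [c] by a central half angle gives [e]
    with [e ^ 2 = 0]; once [d] is made to anticommute with [e] and its adjoint, a
    central normal [g] and an [f] with [f^* f + f f^* = 1 - g^* g] remain. These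
    relations no longer involve [y], and the change of generators is a natural
    bijection between solutions in every C*-algebra. If [|y| = 1], then
    [a2 = y a1^*] and the algebra is generated by matrix units.

    Two-dimensional representations tell E(-1, 0) apart. For [0 < |y| < 1] they are
    the points of the sphere [|g| ^ 2 + 2 |s| ^ 2 = 1]; [(g, s)] and [(g, - s)] have
    the same central character but are inequivalent if [s <> 0]. For [y = 0], at least
    one of [2 a1 ^ 2], [2 a2 ^ 2] has modulus one, and the representation is determined
    by these numbers if both have. Given an isomorphism, a path on the sphere with
    [s <> 0] from a representation with moduli [(1, 0)] to one with moduli [(0, 1)]
    meets, by the intermediate value theorem, a point where both are one: there
    [(g, s)] and [(g, - s)] would be equivalent. For [|y| = 1] there is only one
    two-dimensional representation. *)

Require Import Defs.
From HB Require Import structures.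
From mathcomp Require Import all_boot all_order all_algebra.
From mathcomp Require Import boolp classical_sets reals topology normedtype sequences.
From mathcomp Require Import realfun complex ring lra.

Set Implicit Arguments.
Unset Strict Implicit.
Unset Printing Implicit Defensive.

Import Order.TTheory GRing.Theory Num.Theory.
Import numFieldNormedType.Exports.

Local Open Scope classical_set_scope.
Local Open Scope ring_scope.

Local Notation normc := ComplexField.Normc.normc.

(** * Rewriting in noncommutative rings *)

(** No spectral theory or continuous functional calculus is used. Square roots of [1 - x] and
    inverses of [1 - w] are fixed points of contractions: they are available under strict norm
    bounds, and star homomorphisms preserve them because they are unique. This shapes the
    construction. The half angle needs the norm of [2 c ^ 2] to be below one; here
    [lam = (1 - |y|) / (1 + |y|)], and [0 < |y|] is what makes [lam < 1], while at [y = 0] the bound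
    degenerates. On the way back, the same strict bound has to be derived from the relations of [e],
    [g], [f] alone; this is the hardest inequality, settled by a sum of squares. The centre of E(-1,
    y) is never computed. That the points with [s] and [- s] agree on it follows by deforming their
    direct sum, inside dimension four, into representations whose commutant is trivial. Only the
    centrality of [a1 ^ 2] and [a2 ^ 2] is then carried through an isomorphism. *)

Inductive ncexpr : Type :=
| NCvar of nat | NC0 | NC1
| NCadd of ncexpr & ncexpr | NCopp of ncexpr | NCmul of ncexpr & ncexpr.

Definition ncword := seq nat.
(** The boolean is a minus sign and integer coefficients are repetitions, so that the only
    arithmetic is the cancellation of a word against its opposite. Complex scalars are atoms, moved
    by commutation rules given as hypotheses. *)
Definition ncpoly := seq (bool * ncword).

Section NCNormalForm.

Variables (A : pzRingType) (env : seq A).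

Fixpoint nc_eval (t : ncexpr) : A :=
  match t with
  | NCvar i => nth 0 env i
  | NC0 => 0
  | NC1 => 1
  | NCadd a b => nc_eval a + nc_eval b
  | NCopp a => - nc_eval a
  | NCmul a b => nc_eval a * nc_eval b
  end.

Fixpoint word_eval (w : ncword) : A :=
  if w is i :: w' then nth 0 env i * word_eval w' else 1.

Definition term_eval (t : bool * ncword) : A :=
  if t.1 then - word_eval t.2 else word_eval t.2.

Definition poly_eval (p : ncpoly) : A := foldr (fun t s => term_eval t + s) 0 p.

Definition term_mul (t u : bool * ncword) := (t.1 (+) u.1, t.2 ++ u.2).

Fixpoint poly_cancel1 (t : bool * ncword) (p : ncpoly) : ncpoly :=
  if p is u :: p' then
    if (u.1 != t.1) && (u.2 == t.2) then p' else u :: poly_cancel1 t p'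
  else [:: t].

Definition poly_cancel (p : ncpoly) : ncpoly := foldr poly_cancel1 [::] p.

Fixpoint poly_of (t : ncexpr) : ncpoly :=
  match t with
  | NCvar i => [:: (false, [:: i])]
  | NC0 => [::]
  | NC1 => [:: (false, [::])]
  | NCadd a b => poly_of a ++ poly_of b
  | NCopp a => map (term_mul (true, [::])) (poly_of a)
  | NCmul a b => let q := poly_of b in
                 flatten [seq map (term_mul u) q | u <- poly_of a]
  end.

Definition rules := seq (ncword * ncpoly).

Fixpoint rules_valid (rs : rules) : Prop :=
  if rs is r :: rs' then word_eval r.1 = poly_eval r.2 /\ rules_valid rs'
  else True.

Fixpoint rewrite_head (rs : rules) (w : ncword) : option ncpoly :=
  if rs is r :: rs' then
    if take (size r.1) w == r.1
    then Some [seq (t.1, t.2 ++ drop (size r.1) w) | t <- r.2]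
    else rewrite_head rs' w
  else None.

Fixpoint rewrite_word (rs : rules) (w : ncword) : option ncpoly :=
  match rewrite_head rs w with
  | Some p => Some p
  | None => if w is i :: w' then
              omap (map (fun t => (t.1, i :: t.2))) (rewrite_word rs w')
            else None
  end.

Definition rewrite_poly (rs : rules) (p : ncpoly) : ncpoly :=
  poly_cancel (flatten [seq (if rewrite_word rs t.2 is Some q
                then map (term_mul (t.1, [::])) q else [:: t]) | t <- p]).

Lemma word_eval_cat w1 w2 : word_eval (w1 ++ w2) = word_eval w1 * word_eval w2.
Proof. by elim: w1 => [|i w IH] /=; rewrite ?mul1r ?IH ?mulrA. Qed.

Lemma term_eval_mul t u : term_eval (term_mul t u) = term_eval t * term_eval u.
Proof.
case: t u => [[] w1] [[] w2] /=; rewrite /term_eval /= word_eval_cat.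
- by rewrite mulrNN.
- by rewrite mulNr.
- by rewrite mulrN.
- by [].
Qed.

Lemma poly_eval_cat p q : poly_eval (p ++ q) = poly_eval p + poly_eval q.
Proof. by elim: p => [|t p IH] /=; rewrite ?add0r ?IH ?addrA. Qed.

Lemma poly_eval_mull t q :
  poly_eval (map (term_mul t) q) = term_eval t * poly_eval q.
Proof.
by elim: q => [|u q IH] /=; rewrite ?mulr0 ?IH ?term_eval_mul ?mulrDr.
Qed.

Lemma poly_ofE t : poly_eval (poly_of t) = nc_eval t.
Proof.
elim: t => [i|||a IHa b IHb|a IHa|a IHa b IHb] /=.
- by rewrite /term_eval /= mulr1 addr0.
- by [].
- by rewrite /term_eval /= addr0.
- by rewrite poly_eval_cat IHa IHb.
- by rewrite poly_eval_mull IHa /term_eval /= mulN1r.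
- rewrite -IHa -IHb; elim: (poly_of a) => [|u p IH] /=; first by rewrite mul0r.
  by rewrite poly_eval_cat poly_eval_mull IH mulrDl.
Qed.

Lemma poly_cancel1E t p : poly_eval (poly_cancel1 t p) = term_eval t + poly_eval p.
Proof.
elim: p => [|u p IH] //=; case: ifP => [/andP[+ /eqP e]|_] /=.
  case: u t e {IH} => [b w] [b' w'] /= -> ne; rewrite addrA -[LHS]add0r.
  by congr (_ + _); case: b b' ne => [] [] //= _; rewrite /term_eval /= ?addNr ?addrN.
by rewrite IH addrCA.
Qed.

Lemma poly_cancelE p : poly_eval (poly_cancel p) = poly_eval p.
Proof. by elim: p => [|t p IH] //=; rewrite poly_cancel1E IH. Qed.

Lemma rewrite_headE rs w q : rules_valid rs ->
  rewrite_head rs w = Some q -> poly_eval q = word_eval w.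
Proof.
elim: rs => [|[l r] rs IH] //= [lr /IH{}IH]; case: ifP => [/eqP e [<-]|_ //].
rewrite -[in RHS](cat_take_drop (size l) w) e word_eval_cat lr.
elim: r {lr} => [|[b w'] r IHr] /=; first by rewrite mul0r.
by rewrite IHr mulrDl /term_eval /=; case: b; rewrite word_eval_cat ?mulNr.
Qed.

Lemma rewrite_wordE rs w q : rules_valid rs ->
  rewrite_word rs w = Some q -> poly_eval q = word_eval w.
Proof.
move=> rsP; elim: w q => [|i w IH] q /=; case E: rewrite_head => [p|] //.
- by case=> <-; apply: (rewrite_headE rsP E).
- by case=> <-; apply: (rewrite_headE rsP E).
case: (rewrite_word rs w) IH => [p|] //= /(_ _ erefl) <- [<-].
elim: p => [|[b w'] p IHp] /=; first by rewrite mulr0.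
by rewrite IHp mulrDr /term_eval /=; case: b; rewrite ?mulrN.
Qed.

Lemma rewrite_polyE rs p : rules_valid rs ->
  poly_eval (rewrite_poly rs p) = poly_eval p.
Proof.
move=> rsP; rewrite poly_cancelE; elim: p => [|[b w] p IH] //=.
rewrite poly_eval_cat IH; congr (_ + _); case E: rewrite_word => [q|] /=.
  rewrite poly_eval_mull (rewrite_wordE rsP E) /term_eval /=.
  by case: b; rewrite ?mulN1r ?mul1r.
by rewrite addr0.
Qed.

Fixpoint nc_hyps (hs : seq (ncexpr * ncexpr)) : Prop :=
  if hs is h :: hs' then nc_eval h.1 = nc_eval h.2 /\ nc_hyps hs' else True.

Fixpoint rules_of (hs : seq (ncexpr * ncexpr)) : rules :=
  if hs is h :: hs' then
    if poly_of h.1 is [:: (false, w)]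
    then (w, poly_cancel (poly_of h.2)) :: rules_of hs' else rules_of hs'
  else [::].

Lemma rules_ofP hs : nc_hyps hs -> rules_valid (rules_of hs).
Proof.
elim: hs => [|[l r] hs IH] //= [lr /IH{}IH].
case E: (poly_of l) => [|[[] w] [|? ?]] //=; split=> //.
by rewrite poly_cancelE poly_ofE -lr -poly_ofE E /= /term_eval /= addr0.
Qed.

(** Soundness rests on each pass preserving the value, whatever the rules; [fuel] cuts off rules
    that do not terminate. *)
Definition nc_check fuel hs l r : bool :=
  nilp (iter fuel (rewrite_poly (rules_of hs))
         (poly_cancel (poly_of (NCadd l (NCopp r))))).

(* Each hypothesis serves as a rewrite rule, oriented from left to right; its
   left-hand side must be a monomial. *)
Lemma nc_checkP fuel hs l r : nc_hyps hs -> nc_check fuel hs l r ->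
  nc_eval l = nc_eval r.
Proof.
move=> /rules_ofP hsP; rewrite /nc_check => /nilP e.
apply/eqP; rewrite -subr_eq0; apply/eqP.
transitivity (nc_eval (NCadd l (NCopp r))) => //; rewrite -poly_ofE -poly_cancelE.
move: e; elim: fuel (poly_cancel _) => [p /= -> //|n IH p].
by rewrite iterSr => /IH; rewrite rewrite_polyE.
Qed.

End NCNormalForm.

(* Scalars may be elaborated through different structure instances. *)
Ltac nc_same x y :=
  first [constr_eq x y
        | lazymatch x with @GRing.scale _ _ _ _ =>
            lazymatch y with @GRing.scale _ _ _ _ => unify x y end end].

Ltac nc_mem x xs :=
  lazymatch xs with
  | nil => constr:(false)
  | cons ?y ?ys => let b := match constr:(Set) with
                            | _ => let _ := match constr:(Set) with _ => nc_same x y end in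
                              constr:(true)
                            | _ => nc_mem x ys end in b
  end.

Ltac nc_atoms t xs :=
  lazymatch t with
  | @GRing.add _ ?a ?b => let ys := nc_atoms a xs in nc_atoms b ys
  | @GRing.mul _ ?a ?b => let ys := nc_atoms a xs in nc_atoms b ys
  | @GRing.opp _ ?a => nc_atoms a xs
  | @GRing.one _ => xs
  | @GRing.zero _ => xs
  | _ => let b := nc_mem t xs in
         lazymatch b with true => xs | false => constr:(cons t xs) end
  end.

Ltac nc_index x xs :=
  lazymatch xs with
  | cons ?y ?ys => match constr:(Set) with
                   | _ => let _ := match constr:(Set) with _ => nc_same x y end in constr:(O)
                   | _ => let n := nc_index x ys in constr:(S n) end
  end.

Ltac nc_reify t xs :=
  lazymatch t with
  | @GRing.add _ ?a ?b =>
      let a' := nc_reify a xs in let b' := nc_reify b xs in constr:(NCadd a' b')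
  | @GRing.mul _ ?a ?b =>
      let a' := nc_reify a xs in let b' := nc_reify b xs in constr:(NCmul a' b')
  | @GRing.opp _ ?a => let a' := nc_reify a xs in constr:(NCopp a')
  | @GRing.one _ => constr:(NC1)
  | @GRing.zero _ => constr:(NC0)
  | _ => let n := nc_index t xs in constr:(NCvar n)
  end.

Ltac nc_hyp_atoms h xs :=
  lazymatch h with
  | (?h1, ?h2) => let ys := nc_hyp_atoms h1 xs in nc_hyp_atoms h2 ys
  | tt => xs
  | _ => lazymatch type of h with
         | ?l = ?r => let ys := nc_atoms l xs in nc_atoms r ys end
  end.

Ltac nc_hyp_list h xs acc :=
  lazymatch h with
  | (?h1, ?h2) => let acc' := nc_hyp_list h2 xs acc in nc_hyp_list h1 xs acc'
  | tt => acc
  | _ => lazymatch type of h with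
         | ?l = ?r => let l' := nc_reify l xs in let r' := nc_reify r xs in
                      constr:(cons (l', r') acc) end
  end.

Ltac nc_hyp_proof h acc :=
  lazymatch h with
  | (?h1, ?h2) => let acc' := nc_hyp_proof h2 acc in nc_hyp_proof h1 acc'
  | tt => acc
  | _ => constr:(conj h acc)
  end.

(* [nc (h1, .., hn)] proves an identity in a noncommutative ring by rewriting
   with the equations [hi]. *)
Ltac nc hs :=
  lazymatch goal with
  | |- @eq ?T ?l ?r =>
      let xs0 := nc_atoms l (@nil T) in
      let xs1 := nc_atoms r xs0 in
      let xs := nc_hyp_atoms hs xs1 in
      let l' := nc_reify l xs in
      let r' := nc_reify r xs in
      let hl := nc_hyp_list hs xs (@nil (ncexpr * ncexpr)) in
      let hp := nc_hyp_proof hs I in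
      refine (@nc_checkP _ xs 100 hl l' r' hp _); vm_compute; reflexivity
  end.

(** * Norms, subalgebras and positivity in C*-algebras *)

Section ComplexScalars.
Variable R : realType.
Implicit Types (r s : R) (c : R[i]).

Lemma conjC_real r : (r%:C)%C^* = (r%:C)%C :> R[i].
Proof. by rewrite /Num.conj /= oppr0. Qed.

Lemma normc_real r : normc (r%:C)%C = `|r|.
Proof. by rewrite /= expr0n addr0 sqrtr_sqr. Qed.

Lemma normc_i : normc ('i%C : R[i]) = 1.
Proof. by rewrite /= expr0n add0r expr1n sqrtr1. Qed.

Lemma conjc_i : ('i%C : R[i])^* = - 'i%C.
Proof. by rewrite /Num.conj /=; apply/eqP; rewrite eq_complex /= oppr0 !eqxx. Qed.

Lemma mul_ii : ('i%C : R[i]) * 'i%C = -1.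
Proof. by rewrite -expr2 sqr_i. Qed.

Lemma normrCE c : `|c| = ((normc c)%:C)%C.
Proof. by case: c. Qed.

End ComplexScalars.

Section CStarBasics.
Variables (R : realType) (A : cstarAlgType R).
Implicit Types (x y : A) (r s : R) (c : R[i]).

Lemma cnorm0 : cnorm (0 : A) = 0.
Proof. by rewrite -(scale0r (0 : A)) cnormZ ComplexField.Normc.normc0 mul0r. Qed.

Lemma cnormZr r x : cnorm ((r%:C)%C *: x) = `|r| * cnorm x.
Proof. by rewrite cnormZ normc_real. Qed.

Lemma cnormN x : cnorm (- x) = cnorm x.
Proof.
have -> : - x = ((-1 : R)%:C)%C *: x by rewrite rmorphN rmorph1 scaleN1r.
by rewrite cnormZr normrN normr1 mul1r.
Qed.

Lemma cnormB x y : cnorm (x - y) <= cnorm x + cnorm y.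
Proof. by rewrite -(cnormN y) cnormD. Qed.

Lemma cdistC x y : cnorm (x - y) = cnorm (y - x).
Proof. by rewrite -cnormN opprB. Qed.

Lemma cnorm_ge0 x : 0 <= cnorm x.
Proof.
have := cnormB x x; rewrite subrr cnorm0 -mulr2n -mulr_natl.
by rewrite pmulr_rge0 ?ltr0n.
Qed.

Lemma cdist_triangle x y z : cnorm (x - z) <= cnorm (x - y) + cnorm (y - z).
Proof. by have := cnormD (x - y) (y - z); rewrite addrA subrK. Qed.

Lemma star0 : star (0 : A) = 0.
Proof. by have := starD 0 (0 : A); rewrite addr0 -{1}[star 0]addr0 => /addrI. Qed.

Lemma starN x : star (- x) = - star x.
Proof. by apply/eqP; rewrite -addr_eq0 -starD addNr star0. Qed.

Lemma starB x y : star (x - y) = star x - star y.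
Proof. by rewrite starD starN. Qed.

Lemma star1 : star (1 : A) = 1.
Proof. by rewrite -[LHS]mul1r -{1}(starK 1) -starM mul1r starK. Qed.

Lemma starZr r x : star ((r%:C)%C *: x) = (r%:C)%C *: star x.
Proof. by rewrite starZ conjC_real. Qed.

Lemma cnorm1 : cnorm (1 : A) = 1.
Proof.
have := cnorm_star (1 : A); rewrite star1 mul1r expr2.
move=> /(congr1 (fun t => t - cnorm (1 : A) * 1)) /eqP.
rewrite mulr1 subrr -[X in _ - X]mulr1 -mulrBr eq_sym mulf_eq0.
case/orP => [/eqP/cnorm_eq0/eqP|]; first by rewrite oner_eq0.
by rewrite subr_eq0 => /eqP.
Qed.

Lemma cnorm_alg c : cnorm (c%:A : A) = normc c.
Proof. by rewrite cnormZ cnorm1 mulr1. Qed.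

Lemma cnorm_starE x : cnorm (star x) = cnorm x.
Proof.
have le y : cnorm y <= cnorm (star y).
  have [->|/eqP y0] := eqVneq y 0; first by rewrite star0.
  have y_gt0 : 0 < cnorm y.
    by rewrite lt_neqAle cnorm_ge0 andbT eq_sym; apply/eqP => /cnorm_eq0.
  by rewrite -(ler_pM2r y_gt0) -expr2 -cnorm_star cnormM.
by apply/eqP; rewrite eq_le le -{2}(starK x) le.
Qed.

Lemma norm_cvgP (u : nat -> A) l : norm_cvg cnorm u l <->
  forall e : R, 0 < e -> exists k, forall n, (k <= n)%N -> cnorm (u n - l) < e.
Proof.
rewrite /norm_cvg; split=> [/cvgrPdist_lt ul e e0|ul].
  have [k _ kP] := ul e e0; exists k => n kn; have := kP n kn.
  by rewrite /= sub0r normrN ger0_norm ?cnorm_ge0.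
apply/cvgrPdist_lt => e e0; have [k kP] := ul e e0.
by exists k => // n /= kn; rewrite sub0r normrN ger0_norm ?cnorm_ge0// kP.
Qed.

Lemma norm_closedP (S : set A) :
  (forall l, (forall e : R, 0 < e -> exists2 x, S x & cnorm (x - l) < e) -> S l) ->
  norm_closed S.
Proof.
move=> H u l Su /norm_cvgP ul; apply: H => e /ul[k kP].
by exists (u k) => //; apply: kP.
Qed.

Lemma norm_closedI (S T : set A) :
  norm_closed S -> norm_closed T -> norm_closed (S `&` T).
Proof.
by move=> cS cT u l STu ul; split; [apply: cS ul|apply: cT ul] => n; case: (STu n).
Qed.

Lemma norm_closed_ball r : norm_closed [set x : A | cnorm x <= r].
Proof.
apply: norm_closedP => l H /=; rewrite leNgt; apply/negP => rl.
have [] := H (cnorm l - r); first by rewrite subr_gt0.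
move=> x /= xr; rewrite cdistC => xl; have := cnormD (l - x) x; rewrite subrK.
lra.
Qed.

Lemma geometric_cauchy (q C : R) (u : nat -> A) : 0 <= q < 1 ->
  (forall n, cnorm (u n.+1 - u n) <= C * q ^+ n) -> norm_cauchy cnorm u.
Proof.
move=> /andP[q0 q1] uC.
have C0 : 0 <= C by have := uC 0%N; rewrite expr0 mulr1; apply: le_trans; apply: cnorm_ge0.
(* The factor [1 - q] replaces a closed form of the geometric sum: with [d = C * q ^ k], the
   induction step is [q * d + (1 - q) * d = d]. *)
have tail k m : (1 - q) * cnorm (u (k + m)%N - u k) <= C * q ^+ k.
  elim: m k => [|m IH] k.
    by rewrite addn0 subrr cnorm0 mulr0 mulr_ge0 ?exprn_ge0.
  have := IH k.+1; have := uC k; rewrite addSnnS exprS (mulrCA C).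
  have := cdist_triangle (u (k + m.+1)%N) (u k.+1) (u k).
  move: (C * q ^+ k) (mulr_ge0 C0 (exprn_ge0 k q0)) => d d0.
  move=> d1 d2 d3; apply: le_trans (_ : (1 - q) * (cnorm (u (k + m.+1)%N - u k.+1) + cnorm (u
    k.+1 - u k)) <= _).
    by rewrite ler_wpM2l// subr_ge0 ltW.
  have : (1 - q) * cnorm (u k.+1 - u k) <= (1 - q) * d by rewrite ler_wpM2l// subr_ge0 ltW.
  lra.
move=> e e0; have [] : exists k, C * q ^+ k < e * (1 - q) / 2.
  have : (fun n => C * q ^+ n) @ \oo --> (0 : R).
    rewrite -[X in _ --> X](mulr0 C); apply: cvgMr; apply: cvg_expr.
    by rewrite ger0_norm.
  move=> /cvgrPdist_lt /(_ (e * (1 - q) / 2)) []; first by rewrite divr_gt0// mulr_gt0// subr_gt0.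
  move=> k _ /(_ k (leqnn k)) /=; rewrite sub0r normrN => H; exists k.
  exact: le_lt_trans (ler_norm _) H.
move=> k kP; exists k => m n km kn.
apply: le_lt_trans (cdist_triangle _ (u k) _) _.
have := tail k (m - k)%N; have := tail k (n - k)%N; rewrite !subnKC// [cnorm (u k - _)]cdistC.
nra.
Qed.

(** The source of all square roots and inverses below. The closed invariant set [S] serves to place
    the fixed point in a given C*-subalgebra, in a ball or in a commutant. *)
Lemma contraction_fixpoint (q : R) (T : A -> A) (S : set A) (x0 : A) :
  0 <= q < 1 -> norm_closed S -> S x0 -> (forall x, S x -> S (T x)) ->
  (forall x y, S x -> S y -> cnorm (T x - T y) <= q * cnorm (x - y)) ->
  exists2 x, S x & T x = x.
Proof.
move=> /andP[q0 q1] cS Sx0 ST Tq; pose u n := iter n T x0.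
have Su n : S (u n) by elim: n => //= n; apply: ST.
have uq n : cnorm (u n.+1 - u n) <= cnorm (T x0 - x0) * q ^+ n.
  elim: n => [|n IH]; first by rewrite expr0 mulr1.
  apply: (@le_trans _ _ (q * cnorm (u n.+1 - u n))); first exact: Tq (Su n.+1) (Su n).
  by rewrite exprS mulrCA ler_wpM2l.
have [|l ul] := @cnorm_complete _ _ u.
  by apply: (geometric_cauchy _ uq); rewrite q0.
have Sl := cS u l Su ul; exists l => //.
apply/eqP; rewrite -subr_eq0; apply/eqP/cnorm_eq0/eqP; rewrite eq_le cnorm_ge0 andbT.
apply/ler_addgt0Pr => e e0; rewrite add0r.
move/norm_cvgP: ul => /(_ (e / 2)) []; first by rewrite divr_gt0.
move=> k kP; apply: le_trans (cdist_triangle _ (u k.+1) _) _.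
have h1 : cnorm (T l - u k.+1) <= q * cnorm (u k - l).
  by rewrite (cdistC (u k)); apply: Tq Sl (Su k).
have := kP _ (leqnn k); have := kP k.+1 (leqnSn k).
by have := cnorm_ge0 (u k - l); nra.
Qed.

End CStarBasics.

Section Subalgebras.
Variables (R : realType) (A : cstarAlgType R) (S : set A).
Hypothesis SP : cstar_subalgebra S.

Lemma subalg1 : S 1. Proof. by case: SP. Qed.
Lemma subalgM x y : S x -> S y -> S (x * y). Proof. by case: SP => _ _ _ + _; apply. Qed.
Lemma subalgS x : S x -> S (star x). Proof. by case: SP => _ _ _ _; apply. Qed.
Lemma subalg0 : S 0.
Proof.
have S1 := subalg1; case: SP => _ _ /(_ (-1) 1 1 S1 S1) + _ _.
by rewrite scaleN1r addNr.
Qed.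
Lemma subalgD x y : S x -> S y -> S (x + y).
Proof. by move=> Sx Sy; case: SP => _ _ /(_ 1 x y Sx Sy) + _ _; rewrite scale1r. Qed.
Lemma subalgZ c x : S x -> S (c *: x).
Proof. by move=> Sx; case: SP => _ _ /(_ c x 0 Sx subalg0) + _ _; rewrite addr0. Qed.
Lemma subalgN x : S x -> S (- x).
Proof. by move=> Sx; rewrite -scaleN1r; apply: subalgZ. Qed.
Lemma subalgB x y : S x -> S y -> S (x - y).
Proof. by move=> Sx Sy; apply: subalgD => //; apply: subalgN. Qed.
Lemma subalg_alg c : S c%:A. Proof. exact/subalgZ/subalg1. Qed.

End Subalgebras.

Lemma norm_closed_eq (R : realType) (A B : cstarAlgType R) (f g : A -> B) (C : R) :
  (forall x y : A, cnorm (f x - f y) <= C * cnorm (x - y)) ->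
  (forall x y : A, cnorm (g x - g y) <= C * cnorm (x - y)) ->
  norm_closed [set x | f x = g x].
Proof.
move=> fC gC; apply: norm_closedP => l H.
rewrite /=.
apply/eqP; rewrite -subr_eq0; apply/eqP/cnorm_eq0/eqP; rewrite eq_le cnorm_ge0 andbT.
apply/ler_addgt0Pr => e e0; rewrite add0r.
have C0 : 0 <= `|C| by [].
have [|x /= fgx xl] := H (e / (2 * (`|C| + 1))).
  by rewrite divr_gt0// mulr_gt0//; lra.
apply: (le_trans (cdist_triangle _ (f x) _)); rewrite fgx.
have := fC l x; have := gC x l; rewrite [cnorm (l - x)]cdistC fgx.
move: xl; rewrite ltr_pdivlMr; last by rewrite mulr_gt0//; lra.
have := cnorm_ge0 (x - l); have := ler_norm C; set n := cnorm (x - l) => CC n0.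
have : C * n <= `|C| * n by rewrite ler_wpM2r.
nra.
Qed.

Section Continuity.
Variables (R : realType) (A : cstarAlgType R).

Lemma norm_closed_mulC (b : A) : norm_closed [set x : A | x * b = b * x].
Proof.
apply: (@norm_closed_eq _ _ _ (fun x => x * b) (fun x => b * x) (cnorm b)) => x y.
  by rewrite -mulrBl mulrC cnormM.
by rewrite -mulrBr cnormM.
Qed.

(** Turns membership into commutation: an element that lies in every C*-subalgebra containing [x]
    commutes with whatever commutes with [x] and is stable under adjoints. *)
Lemma cstar_subalgebra_commutant (B : set A) : (forall b, B b -> B (star b)) ->
  cstar_subalgebra [set x | forall b, B b -> x * b = b * x].
Proof.
move=> sB; split => /=.
- move=> u l Su ul b Bb; apply: (norm_closed_mulC (u := u)) ul => n /=.
  exact: Su.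
- by move=> b _; rewrite mul1r mulr1.
- move=> c x y Sx Sy b Bb.
  by rewrite mulrDl mulrDr -scalerAl -scalerAr Sx// Sy.
- by move=> x y Sx Sy b Bb; rewrite -mulrA Sy// !mulrA Sx.
- by move=> x Sx b Bb; rewrite -[b]starK -!starM Sx//; apply: sB.
Qed.

End Continuity.

(** * Square roots and inverses from contractions *)

Section SquareRoot.
Variables (R : realType) (A : cstarAlgType R).
Implicit Types (x w : A).

(* [1 - sqrt_defect x] is the principal square root of [1 - x] when [`|x| < 1]. *)
Definition sqrt_defect x : A :=
  xget 0 [set w | w = (2^-1 : R)%:C%C *: (x + w * w) /\ cnorm w < 1].

(** The difference [d] satisfies [|d| <= (|w| + |w'|) |d| / 2], whether or not [w] and [w'] commute.
    Uniqueness in the open unit ball is what makes the root selfadjoint, natural, and a member of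
    every C*-subalgebra containing [x]. *)
Lemma sqrt_defect_unique x w w' :
  w = (2^-1 : R)%:C%C *: (x + w * w) -> cnorm w < 1 ->
  w' = (2^-1 : R)%:C%C *: (x + w' * w') -> cnorm w' < 1 -> w = w'.
Proof.
move=> wE w1 w'E w'1; apply/eqP; rewrite -subr_eq0; apply/eqP/cnorm_eq0.
have dE : w - w' = (2^-1 : R)%:C%C *: (w * (w - w') + (w - w') * w').
  rewrite {1}wE {1}w'E -scalerBr; congr (_ *: _).
  by rewrite opprD addrACA subrr add0r mulrBr mulrBl addrA subrK.
have := cnorm_ge0 (w - w'); set d := w - w' in dE *.
have := cnormD (w * d) (d * w'); have := cnormM w d; have := cnormM d w'.
have := cnormZr (2^-1 : R) (w * d + d * w'); rewrite -dE ger0_norm ?invr_ge0//.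
move=> -> h1 h2 h3; rewrite le_eqVlt => /predU1P[//|]; nra.
Qed.

Lemma sqrt_defect_exists (S : set A) x : cstar_subalgebra S -> S x -> cnorm x < 1 ->
  exists w, [/\ w = (2^-1 : R)%:C%C *: (x + w * w), cnorm w < 1 & S w].
Proof.
(* [W] solves the same equation with the number [cnorm x] in place of [x]; it is both the radius of
   an invariant ball and a contraction ratio on it. *)
move=> SP Sx x1; set W := 1 - Num.sqrt (1 - cnorm x).
have x0 := cnorm_ge0 x.
have s0 : 0 < Num.sqrt (1 - cnorm x) by rewrite sqrtr_gt0 subr_gt0.
have s2 : Num.sqrt (1 - cnorm x) * Num.sqrt (1 - cnorm x) = 1 - cnorm x.
  by rewrite -expr2 sqr_sqrtr// subr_ge0 ltW.
have W0 : 0 <= W.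
  by rewrite subr_ge0 -[leRHS]sqrtr1 ler_wsqrtr// lerBlDr lerDl.
have WE : W = 2^-1 * (cnorm x + W * W) by rewrite /W; lra.
have W1 : W < 1 by rewrite /W; lra.
have h0 : 0 <= (2^-1 : R) by rewrite invr_ge0.
have [|||w [Sw wE]||w [Sw wW] wE] := @contraction_fixpoint _ _ W
    (fun w => (2^-1 : R)%:C%C *: (x + w * w)) (S `&` [set w | cnorm w <= W]) 0.
- by rewrite W0.
- by apply: norm_closedI; [case: SP|apply: norm_closed_ball].
- by split => /=; [apply: subalg0|rewrite cnorm0].
- split => /=; first by apply/(subalgZ SP)/(subalgD SP)=> //; apply: subalgM.
  rewrite cnormZr ger0_norm// WE ler_wpM2l//.
  apply: le_trans (cnormD _ _) _; rewrite lerD2l; apply: le_trans (cnormM _ _) _.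
  by rewrite ler_pM// cnorm_ge0.
- move=> u v [_ /= uW] [_ /= vW]; rewrite -scalerBr cnormZr ger0_norm//.
  have -> : x + u * u - (x + v * v) = u * (u - v) + (u - v) * v.
    by rewrite opprD addrACA subrr add0r mulrBr mulrBl addrA subrK.
  have := cnormD (u * (u - v)) ((u - v) * v).
  have := cnormM u (u - v); have := cnormM (u - v) v; have := cnorm_ge0 (u - v).
  nra.
by exists w; split => //; apply: le_lt_trans W1.
Qed.

Lemma sqrt_defectP x : cnorm x < 1 ->
  sqrt_defect x = (2^-1 : R)%:C%C *: (x + sqrt_defect x * sqrt_defect x) /\
  cnorm (sqrt_defect x) < 1.
Proof.
move=> x1; rewrite /sqrt_defect; case: xgetP => [w _ []//|] H.
have TP : cstar_subalgebra [set: A] by split.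
by have [w [wE w1 _]] := sqrt_defect_exists TP I x1; have := H w; case.
Qed.

Lemma sqrt_defect_lt1 x : cnorm x < 1 -> cnorm (sqrt_defect x) < 1.
Proof. by move=> /sqrt_defectP[]. Qed.

Lemma sqrt_defect_mem (S : set A) x : cstar_subalgebra S -> S x -> cnorm x < 1 ->
  S (sqrt_defect x).
Proof.
move=> SP Sx x1; have [w [wE w1 Sw]] := sqrt_defect_exists SP Sx x1.
by have [vE v1] := sqrt_defectP x1; rewrite (sqrt_defect_unique vE v1 wE w1).
Qed.

Lemma sqrt_defect_star x : cnorm x < 1 -> star x = x ->
  star (sqrt_defect x) = sqrt_defect x.
Proof.
move=> x1 xs; have [vE v1] := sqrt_defectP x1.
apply: (@sqrt_defect_unique x) => //; last by rewrite cnorm_starE.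
by rewrite {1}vE starZr starD starM xs.
Qed.

Lemma sqrt_defect_sqr x : cnorm x < 1 ->
  (1 - sqrt_defect x) * (1 - sqrt_defect x) = 1 - x.
Proof.
move=> /sqrt_defectP[+ _]; set w := sqrt_defect x => wE.
have e : w + w = x + w * w.
  rewrite {1 2}wE -scalerDl -rmorphD.
  by rewrite (_ : 2^-1 + 2^-1 = 1 :> R) ?rmorph1 ?scale1r//; lra.
have -> : x = w + w - w * w by rewrite e addrK.
by nc tt.
Qed.

End SquareRoot.

Section Inverse.
Variables (R : realType) (A : cstarAlgType R).
Implicit Types (x w : A).

Definition cinv x : A := xget 0 [set v | v * x = 1 /\ x * v = 1].

Lemma cinv_unique x v v' : v * x = 1 -> x * v' = 1 -> v = v'.
Proof. by move=> vx xv'; rewrite -[v]mulr1 -xv' mulrA vx mul1r. Qed.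

Lemma cinvE x v : v * x = 1 -> x * v = 1 -> cinv x = v.
Proof.
move=> vx xv; rewrite /cinv; case: xgetP => [u _ [ux xu]|/(_ v)[]//].
exact: cinv_unique xv.
Qed.

Lemma cinv1B_exists (S : set A) w : cstar_subalgebra S -> S w -> cnorm w < 1 ->
  exists v, [/\ v * (1 - w) = 1, (1 - w) * v = 1 & S v].
Proof.
move=> SP Sw w1; have w0 := cnorm_ge0 w.
(* A fixed point of [v |-> 1 + w * v] is only a right inverse of [1 - w]; iterating inside the
   commutant of [w] makes it two-sided. *)
have cS : norm_closed (S `&` [set v | v * w = w * v]).
  by apply: norm_closedI; [case: SP|apply: norm_closed_mulC].
have [||||v [Sv /= vw] vE] := @contraction_fixpoint _ _ (cnorm w)
    (fun v => 1 + w * v) _ 0 _ cS.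
- by rewrite w0.
- by split => /=; [apply: subalg0|rewrite mul0r mulr0].
- move=> v [Sv /= vw]; split => /=.
    by apply: (subalgD SP); [apply: subalg1|apply: subalgM].
  by nc vw.
- by move=> u v _ _; rewrite opprD addrACA subrr add0r -mulrBr cnormM.
exists v; rewrite mulrBr mulrBl mulr1 mul1r vw -{1 3}vE !addrK.
by [].
Qed.

Lemma cinv1BP w : cnorm w < 1 -> cinv (1 - w) * (1 - w) = 1 /\ (1 - w) * cinv (1 - w) = 1.
Proof.
move=> w1; have TP : cstar_subalgebra [set: A] by split.
by have [v [v1 v2 _]] := cinv1B_exists TP I w1; rewrite (cinvE v1 v2).
Qed.

Lemma cinv1B_mem (S : set A) w : cstar_subalgebra S -> S w -> cnorm w < 1 ->
  S (cinv (1 - w)).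
Proof.
by move=> SP Sw w1; have [v [v1 v2 Sv]] := cinv1B_exists SP Sw w1; rewrite (cinvE v1 v2).
Qed.

Lemma cinv_star x : cinv x * x = 1 -> x * cinv x = 1 -> star x = x ->
  star (cinv x) = cinv x.
Proof.
move=> vx xv xs; apply/esym/cinvE.
  by have := congr1 star xv; rewrite starM xs star1.
by have := congr1 star vx; rewrite starM xs star1.
Qed.

End Inverse.

(** * Positivity expressed by norms *)

Section Positivity.
Variables (R : realType) (A : cstarAlgType R).
Implicit Types (x h : A) (r s : R) (c : R[i]).

Lemma alg_comm c x : x * c%:A = c%:A * x.
Proof. by rewrite mulr_algr mulr_algl. Qed.

Lemma alg_mul c c' : c%:A * c'%:A = (c * c')%:A :> A.
Proof. by rewrite mulr_algl scalerA. Qed.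

Lemma alg_add c c' : c%:A + c'%:A = (c + c')%:A :> A.
Proof. by rewrite scalerDl. Qed.

Lemma alg_realD r s : ((r + s)%:C)%C%:A = (r%:C)%C%:A + (s%:C)%C%:A :> A.
Proof. by rewrite rmorphD scalerDl. Qed.

Lemma scale_half_add x : ((2^-1 : R)%:C)%C *: (x + x) = x.
Proof.
rewrite scalerDr -scalerDl -rmorphD (_ : 2^-1 + 2^-1 = 1 :> R) ?rmorph1 ?scale1r//.
lra.
Qed.

Lemma star_alg c : star (c%:A : A) = (c^*)%:A.
Proof. by rewrite starZ star1. Qed.

Lemma star_algr r : star ((r%:C)%C%:A : A) = (r%:C)%C%:A.
Proof. by rewrite starZr star1. Qed.

(* [x + i q] is normal, and a multiple of a unitary. *)
Lemma cnorm_pythagoras x q r : 0 <= r -> star x = x -> star q = q -> x * q = q * x ->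
  x * x + q * q = (r%:C)%C%:A -> cnorm x ^+ 2 <= r.
Proof.
move=> r0 xs qs xq xqr; pose I : A := 'i%C%:A; pose u := x + I * q.
have II : I * I = -1 by rewrite alg_mul mul_ii scaleN1r.
have xI : x * I = I * x by rewrite alg_comm.
have qI : q * I = I * q by rewrite alg_comm.
have us : star u = x - I * q.
  by rewrite /u starD starM xs qs star_alg conjc_i scaleNr mulrN qI.
have u2 : cnorm u ^+ 2 = r.
  rewrite -cnorm_star us (_ : _ * u = x * x + q * q).
    by rewrite xqr cnorm_alg normc_real ger0_norm.
  have II' y : I * (I * y) = - y by rewrite mulrA II mulN1r.
  by rewrite /u; nc (xI, (qI, (xq, II))).
have xx : x + x = u + star u by rewrite us /u; nc tt.
have : cnorm x <= cnorm u.
  have := cnormD u (star u); rewrite cnorm_starE -xx.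
  rewrite -mulr2n -scaler_nat (_ : 2%:R = ((2 : R)%:C)%C); last by rewrite rmorph_nat.
  by rewrite cnormZr ger0_norm//; lra.
by move=> xu; rewrite -u2 ler_pXn2r// nnegrE cnorm_ge0.
Qed.

Definition csqrt1B x : A := 1 - sqrt_defect x.

Lemma csqrt1B_sa x : cnorm x < 1 -> star x = x -> star (csqrt1B x) = csqrt1B x.
Proof. by move=> x1 xs; rewrite starB star1 sqrt_defect_star. Qed.

Lemma csqrt1B_sqr x : cnorm x < 1 -> csqrt1B x * csqrt1B x = 1 - x.
Proof. exact: sqrt_defect_sqr. Qed.

Lemma csqrt1B_mem (S : set A) x : cstar_subalgebra S -> S x -> cnorm x < 1 ->
  S (csqrt1B x).
Proof.
by move=> SP Sx x1; apply: (subalgB SP); [apply: subalg1|apply: sqrt_defect_mem].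
Qed.

Lemma csqrt1B_comm x b : cnorm x < 1 -> x * b = b * x -> x * star b = star b * x ->
  csqrt1B x * b = b * csqrt1B x.
Proof.
move=> x1 xb xbs.
have SP : cstar_subalgebra [set z | forall b', [set b; star b] b' -> z * b' = b' * z].
  by apply: cstar_subalgebra_commutant => c [] ->; [right|left; rewrite starK].
apply: (csqrt1B_mem SP) => //=; last by left.
by move=> c [] ->.
Qed.

(* A selfadjoint element is positive iff this holds. *)
Definition cpos h : Prop := star h = h /\
  exists2 s0 : R, 0 <= s0 & forall s, s0 <= s -> cnorm ((s%:C)%C%:A - h) <= s.

(** In this form of positivity, stability under sums is the triangle inequality. *)
Lemma cposD h h' : cpos h -> cpos h' -> cpos (h + h').
Proof.
move=> [hs [s0 s00 H]] [hs' [s1 s10 H']]; split; first by rewrite starD hs hs'.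
exists (s0 + s1); first by rewrite addr_ge0.
move=> s ss; have := H (s - s1); have := H' s1 (lexx _).
have -> : (s%:C)%C%:A - (h + h') = (((s - s1)%:C)%C%:A - h) + ((s1%:C)%C%:A - h') :> A.
  by rewrite addrACA -opprD alg_add -rmorphD subrK.
move=> h1 h2; apply: le_trans (cnormD _ _) _; have := h2; lra.
Qed.

Lemma cposZ r h : 0 <= r -> cpos h -> cpos ((r%:C)%C *: h).
Proof.
rewrite le_eqVlt => /predU1P[<- _|r0 [hs [s0 s00 H]]].
  rewrite rmorph0 scale0r; split; first by rewrite star0.
  by exists 0 => // s s0; rewrite subr0 cnorm_alg normc_real ger0_norm.
split; first by rewrite starZr hs.
exists (r * s0); first by rewrite mulr_ge0// ltW.
move=> s ss; have -> : (s%:C)%C%:A - (r%:C)%C *: h = (r%:C)%C *: (((s / r)%:C)%C%:A - h).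
  by rewrite scalerBr scalerA -rmorphM mulrCA divff ?mulr1 ?gt_eqF.
rewrite cnormZr gtr0_norm// mulrC -ler_pdivlMr//; apply: H.
by rewrite ler_pdivlMr// mulrC.
Qed.

(** For [s] above [|x| ^ 2], the element [s - x ^ 2] has a selfadjoint root commuting with [x].
    [cnorm_pythagoras], with the roles of [x] and the root exchanged, bounds that root by the root
    of [s]. *)
Lemma cpos_sqr x : star x = x -> cpos (x * x).
Proof.
move=> xs; split; first by rewrite starM xs.
exists (cnorm x ^+ 2 + 1); first by rewrite addr_ge0// exprn_ge0// cnorm_ge0.
move=> s ss; have x0 := cnorm_ge0 x.
have s0 : 0 < s by apply: lt_le_trans ss; rewrite ltr_wpDl// exprn_ge0.
set z := (s^-1 : R)%:C%C *: (x * x).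
have z1 : cnorm z < 1.
  rewrite cnormZr gtr0_norm ?invr_gt0// mulrC ltr_pdivrMr// mul1r.
  apply: le_lt_trans (cnormM _ _) _; rewrite -expr2; apply: lt_le_trans ss; lra.
have zs : star z = z by rewrite starZr starM xs.
have zx : z * x = x * z by rewrite -scalerAl -scalerAr mulrA.
pose q := csqrt1B z.
have qs : star q = q by rewrite csqrt1B_sa.
have qx : q * x = x * q by apply: csqrt1B_comm => //; rewrite xs.
have q2 : q * q = 1 - z by rewrite csqrt1B_sqr.
pose t := Num.sqrt s.
have tt' : t * t = s by rewrite -expr2 sqr_sqrtr// ltW.
have tq2 : ((t%:C)%C *: q) * ((t%:C)%C *: q) = (s%:C)%C%:A - x * x.
  rewrite -scalerAl -scalerAr scalerA -rmorphM tt' q2 scalerBr scalerA -rmorphM.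
  by rewrite divff ?gt_eqF// rmorph1 scale1r.
rewrite -tq2; apply: le_trans (cnormM _ _) _; rewrite -expr2.
apply: (@cnorm_pythagoras _ x) => //; first exact: ltW.
- by rewrite starZr qs.
- by rewrite -scalerAl -scalerAr qx.
- by rewrite tq2 subrK.
Qed.

(** Half the sum of the squares of the selfadjoint elements [x + star x] and [i (x - star x)].
    Working with symmetrized products, and with normal elements as a special case, avoids the deeper
    fact that [star x * x] is positive for every [x]. *)
Lemma cpos_anticomm x : cpos (star x * x + x * star x).
Proof.
pose I : A := 'i%C%:A.
have II : I * I = -1 by rewrite alg_mul mul_ii scaleN1r.
have Is : star I = - I by rewrite star_alg conjc_i scaleNr.
have xI y : y * I = I * y by rewrite alg_comm.
pose p := x + star x; pose q := I * (x - star x).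
have ps : star p = p by rewrite starD starK addrC.
have qs : star q = q by rewrite /q starM starB starK Is; nc (xI x, xI (star x)).
have pq : p * p + q * q = (star x * x + x * star x) + (star x * x + x * star x).
  by rewrite /p /q; nc (xI x, (xI (star x), II)).
have -> : star x * x + x * star x = ((2^-1 : R)%:C)%C *: (p * p + q * q).
  by rewrite pq scale_half_add.
by apply: cposZ; [rewrite invr_ge0|apply: cposD; apply: cpos_sqr].
Qed.

Lemma cpos_normal x : star x * x = x * star x -> cpos (star x * x).
Proof.
move=> xn; have -> : star x * x = ((2^-1 : R)%:C)%C *: (star x * x + x * star x).
  by rewrite -xn scale_half_add.
by apply: cposZ; [rewrite invr_ge0|apply: cpos_anticomm].
Qed.

(** Positivity yields a root of [r + e - x ^ 2] commuting with [x], and [cnorm_pythagoras] applies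
    to it. The shift by [e] brings the argument of the root strictly inside the unit ball. *)
Lemma cnorm_sa_le x r : 0 <= r -> star x = x -> cpos ((r%:C)%C%:A - x * x) ->
  cnorm x ^+ 2 <= r.
Proof.
move=> r0 xs [_ [s0 s00 H]]; apply/ler_addgt0Pr => e e0.
have := H (s0 + r); rewrite lerDl => /(_ r0); set s := s0 + r => Hs.
have sr : r <= s by rewrite lerDr.
clearbody s; clear H.
have se : 0 < s + e by lra.
pose h := (s%:C)%C%:A - ((r%:C)%C%:A - x * x) : A.
pose z := ((s + e)^-1 : R)%:C%C *: h.
have hs : star h = h by rewrite !starB !star_algr starM xs.
have hx : h * x = x * h.
  by rewrite /h !mulrBl !mulrBr !alg_comm mulrA.
have zs : star z = z by rewrite starZr hs.
have z1 : cnorm z < 1.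
  rewrite cnormZr gtr0_norm ?invr_gt0// mulrC ltr_pdivrMr// mul1r.
  by apply: le_lt_trans Hs _; rewrite ltrDl.
have zx : z * x = x * z by rewrite -scalerAl -scalerAr hx.
pose q := csqrt1B z.
have qs : star q = q by rewrite csqrt1B_sa.
have qx : q * x = x * q by apply: csqrt1B_comm => //; rewrite xs.
have q2 : q * q = 1 - z by rewrite csqrt1B_sqr.
pose t := Num.sqrt (s + e).
have tt' : t * t = s + e by rewrite -expr2 sqr_sqrtr// ltW.
apply: (@cnorm_pythagoras _ ((t%:C)%C *: q)) => //; first lra.
- by rewrite starZr qs.
- by rewrite -scalerAl -scalerAr qx.
rewrite -scalerAl -scalerAr scalerA -rmorphM tt' q2 scalerBr scalerA -rmorphM.
rewrite divff ?gt_eqF// rmorph1 scale1r /h !alg_realD.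
by nc tt.
Qed.

(** Reduces to the previous bound: [h + e] is the square of a selfadjoint [k], and
    [r + e - k ^ 2 = r - h]. *)
Lemma cpos_le h r : 0 <= r -> cpos h -> cpos ((r%:C)%C%:A - h) -> cnorm h <= r.
Proof.
move=> r0 [hs [s s0 H]] rh; apply/ler_addgt0Pr => e' e'0.
pose e := e' / 2; have e0 : 0 < e by rewrite divr_gt0.
have Hs := H s (lexx _).
have se : 0 < s + e by lra.
pose h' := (s%:C)%C%:A - h : A.
pose z := ((s + e)^-1 : R)%:C%C *: h'.
have zs : star z = z by rewrite starZr starB hs star_algr.
have z1 : cnorm z < 1.
  rewrite cnormZr gtr0_norm ?invr_gt0// mulrC ltr_pdivrMr// mul1r.
  by apply: le_lt_trans Hs _; rewrite ltrDl.
pose t := Num.sqrt (s + e).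
have tt' : t * t = s + e by rewrite -expr2 sqr_sqrtr// ltW.
pose k := (t%:C)%C *: csqrt1B z.
have ks : star k = k by rewrite starZr csqrt1B_sa.
have k2 : k * k = h + (e%:C)%C%:A.
  rewrite -scalerAl -scalerAr scalerA -rmorphM tt' csqrt1B_sqr// scalerBr scalerA -rmorphM.
  rewrite divff ?gt_eqF// rmorph1 scale1r /h' !alg_realD.
  by nc tt.
have kr : cnorm k ^+ 2 <= r + e.
  apply: cnorm_sa_le => //; first lra.
  by rewrite k2 alg_realD opprD addrACA subrr addr0.
have -> : h = k * k - (e%:C)%C%:A by rewrite k2 addrK.
apply: le_trans (cnormB _ _) _; rewrite cnorm_alg normc_real gtr0_norm//.
have := cnormM k k; rewrite -expr2 /e in kr *; lra.
Qed.

Lemma cnorm_normal_le x r : 0 <= r -> star x * x = x * star x ->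
  cpos ((r%:C)%C%:A - star x * x) -> cnorm x ^+ 2 <= r.
Proof.
by move=> r0 xn xr; rewrite -cnorm_star; apply: cpos_le => //; apply: cpos_normal.
Qed.

(** Twice the real and imaginary parts of [x] have squares [p * p] and [q * q] with sum zero, so
    each is the opposite of a positive element and [cnorm_sa_le] applies with bound zero. *)
Lemma anticomm_eq0 x : star x * x + x * star x = 0 -> x = 0.
Proof.
move=> x0; apply: cnorm_eq0; apply/eqP.
pose I : A := 'i%C%:A.
have II : I * I = -1 by rewrite alg_mul mul_ii scaleN1r.
have Is : star I = - I by rewrite star_alg conjc_i scaleNr.
have xI y : y * I = I * y by rewrite alg_comm.
have sa0 (p q : A) : star p = p -> star q = q -> p * p + q * q = 0 -> p = 0.
  move=> ps qs pq; apply: cnorm_eq0; apply/eqP.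
  suff : cnorm p ^+ 2 <= 0 by rewrite le_eqVlt ltNge sqr_ge0 orbF sqrf_eq0.
  apply: cnorm_sa_le => //; rewrite rmorph0 scale0r sub0r.
  have -> : - (p * p) = q * q by apply/eqP; rewrite eq_sym -addr_eq0 addrC pq.
  exact: cpos_sqr.
pose p := x + star x; pose q := I * (x - star x).
have ps : star p = p by rewrite starD starK addrC.
have qs : star q = q by rewrite /q starM starB starK Is; nc (xI x, xI (star x)).
have pq : p * p + q * q = 0.
  have : p * p + q * q = (star x * x + x * star x) + (star x * x + x * star x).
    by rewrite /p /q; nc (xI x, (xI (star x), II)).
  by rewrite x0 addr0.
have p0 : p = 0 by apply: (sa0 _ q).
have q0 : q = 0 by apply: (sa0 _ p) => //; rewrite addrC.
have : p - I * q = x + x by rewrite /p /q; nc (xI x, (xI (star x), II)).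
by rewrite p0 q0 mulr0 subr0 -[X in cnorm X]scale_half_add => <-; rewrite scaler0 cnorm0.
Qed.

End Positivity.

(** * Star homomorphisms and universal algebras *)

(** For selfadjoint [y] and [r] above its norm, [y ^ 2 + q ^ 2 = r ^ 2] with [q] selfadjoint and
    commuting with [y]. The image of this equation bounds [f y] by [cnorm_pythagoras]; the
    C*-identity reduces the general case to [star x * x]. *)
Lemma star_hom_contract (R : realType) (A B : cstarAlgType R)
  (f : {lrmorphism A -> B}) : star_hom f -> forall x : A, cnorm (f x) <= cnorm x.
Proof.
move=> fs x; have sa y : star y = y -> cnorm (f y) <= cnorm y.
  move=> ys; apply/ler_addgt0Pr => e e0.
  have y0 := cnorm_ge0 y; set r := cnorm y + e.
  have r0 : 0 < r by rewrite /r; lra.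
  pose z := ((r * r)^-1 : R)%:C%C *: (y * y).
  have rr0 : 0 < r * r by rewrite mulr_gt0.
  have z1 : cnorm z < 1.
    rewrite cnormZr gtr0_norm ?invr_gt0// mulrC ltr_pdivrMr// mul1r.
    apply: le_lt_trans (cnormM _ _) _; rewrite /r; nra.
  have zs : star z = z by rewrite starZr starM ys.
  have zy : z * y = y * z by rewrite -scalerAl -scalerAr mulrA.
  pose q := (r%:C)%C *: csqrt1B z.
  have qs : star q = q by rewrite starZr csqrt1B_sa.
  have qy : y * q = q * y.
    by rewrite -scalerAl -scalerAr; congr (_ *: _); rewrite csqrt1B_comm// ys.
  have yq : y * y + q * q = ((r * r)%:C)%C%:A.
    rewrite -!scalerAl -scalerAr scalerA -rmorphM csqrt1B_sqr// scalerBr scalerA -rmorphM.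
    by rewrite divff ?gt_eqF// rmorph1 scale1r addrC subrK.
  have := @cnorm_pythagoras _ _ (f y) (f q) (r * r) (ltW rr0).
  rewrite -!fs ys qs -!rmorphM qy => /(_ erefl erefl erefl).
  rewrite -rmorphD yq /= rmorph_alg => /(_ erefl).
  by move=> fyr; rewrite -(@ler_pXn2r _ 2) ?nnegrE ?cnorm_ge0 ?(ltW r0)// [r ^+ 2]expr2.
rewrite -(@ler_pXn2r _ 2) ?nnegrE ?cnorm_ge0// -!cnorm_star -fs -rmorphM.
by apply: sa; rewrite starM starK.
Qed.

Section StarHom.
Variables (R : realType) (A B : cstarAlgType R) (f : {lrmorphism A -> B}).
Hypothesis fs : star_hom f.
Implicit Types (x : A) (r : R).

Lemma star_hom_sqrt_defect x : cnorm x < 1 -> f (sqrt_defect x) = sqrt_defect (f x).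
Proof.
move=> x1; have [wE w1] := sqrt_defectP x1.
have fx1 : cnorm (f x) < 1 by apply: le_lt_trans x1; apply: star_hom_contract.
have [vE v1] := sqrt_defectP fx1.
apply: (@sqrt_defect_unique _ _ (f x)) => //; last exact: le_lt_trans (star_hom_contract fs _) w1.
by rewrite {1}wE linearZ rmorphD rmorphM.
Qed.

Lemma star_hom_csqrt1B x : cnorm x < 1 -> f (csqrt1B x) = csqrt1B (f x).
Proof. by move=> x1; rewrite rmorphB rmorph1 /= star_hom_sqrt_defect. Qed.

Lemma star_hom_cinv x : cinv x * x = 1 -> x * cinv x = 1 -> f (cinv x) = cinv (f x).
Proof. by move=> vx xv; apply/esym/cinvE; rewrite -rmorphM ?vx ?xv rmorph1. Qed.

(** The clause on [star x] makes the set stable under adjoints: the adjoint of the first clause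
    would speak of [star T] instead of [T]. *)
Lemma cstar_subalgebra_intertwine (g : {lrmorphism A -> B}) (T : B) : star_hom g ->
  cstar_subalgebra [set x | T * f x = g x * T /\ T * f (star x) = g (star x) * T].
Proof.
move=> gs; split => /=.
- have lip1 (h : {lrmorphism A -> B}) : star_hom h ->
      forall x y, cnorm (T * h x - T * h y) <= cnorm T * cnorm (x - y).
    move=> hs x y; rewrite -mulrBr -rmorphB; apply: le_trans (cnormM _ _) _.
    by rewrite ler_wpM2l ?cnorm_ge0// star_hom_contract.
  have lip2 (h : {lrmorphism A -> B}) : star_hom h ->
      forall x y, cnorm (h x * T - h y * T) <= cnorm T * cnorm (x - y).
    move=> hs x y; rewrite -mulrBl -rmorphB mulrC; apply: le_trans (cnormM _ _) _.
    by rewrite ler_wpM2r ?cnorm_ge0// star_hom_contract.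
  apply: norm_closedI; first exact: (norm_closed_eq (lip1 f fs) (lip2 g gs)).
  apply: (@norm_closed_eq _ _ _ (fun x => T * f (star x)) (fun x => g (star x) * T)
    (cnorm T)) => x y; rewrite -(cnorm_starE (x - y)) starB.
    exact: (lip1 f fs).
  exact: (lip2 g gs).
- by rewrite star1 !rmorph1 mulr1 mul1r.
- move=> c x y [x1 x2] [y1 y2]; rewrite starD starZ !rmorphD /= !linearZ /=.
  by rewrite !mulrDr !mulrDl -!scalerAr -!scalerAl x1 x2 y1 y2.
- move=> x y [x1 x2] [y1 y2]; rewrite starM !rmorphM.
  by rewrite !mulrA x1 y2 -!mulrA y1 x2.
- by move=> x [x1 x2]; rewrite starK.
Qed.

End StarHom.

Lemma lrmorph_inverse (R : realType) (A B : cstarAlgType R) (f : {lrmorphism A -> B})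
  (g : B -> A) : cancel f g -> cancel g f ->
  exists h : {lrmorphism B -> A}, forall x, h x = g x.
Proof.
move=> fg gf; have fI := can_inj fg.
have gD : semilinear g.
  split=> [c x|x y]; apply: fI; first by rewrite gf linearZ /= gf.
  by rewrite gf linearD /= !gf.
have gM : monoid_morphism g.
  split=> [|x y]; apply: fI; first by rewrite gf rmorph1.
  by rewrite gf rmorphM /= !gf.
pose m1 := GRing.isSemilinear.Build R[i] B A _ g gD.
pose m2 := GRing.isMonoidMorphism.Build B A g gM.
pose h : {lrmorphism B -> A} := HB.pack g m1 m2.
by exists h.
Qed.

Lemma star_hom_inverse (R : realType) (A B : cstarAlgType R) (f : {lrmorphism A -> B}) :
  star_hom f -> bijective f ->
  exists g : {lrmorphism B -> A}, [/\ star_hom g, cancel f g & cancel g f].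
Proof.
move=> fs [g fg gf]; have [h hg] := lrmorph_inverse fg gf.
exists h; split.
- by move=> x; rewrite !hg; apply: (can_inj fg); rewrite fs !gf.
- by move=> x; rewrite hg.
- by move=> x; rewrite hg.
Qed.

Section Universal.
Variable R : realType.

Definition relations (I : Type) : Type := forall B : cstarAlgType R, (I -> B) -> Prop.

Definition generated_by (I : Type) (A : cstarAlgType R) (a : I -> A) : Prop :=
  forall S : set A, cstar_subalgebra S -> (forall i, S (a i)) -> S = setT.

Definition universal_for (I : Type) (P : relations I) (E : cstarAlgType R) : Prop :=
  exists a : I -> E, [/\ P E a, generated_by a &
    forall (B : cstarAlgType R) (b : I -> B), P B b ->
      exists f : {lrmorphism E -> B}, star_hom f /\ forall i, f (a i) = b i].

Lemma intertwine_generated (I : Type) (A B : cstarAlgType R) (a : I -> A)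
    (f g : {lrmorphism A -> B}) (T : B) : generated_by a -> star_hom f -> star_hom g ->
    (forall i, T * f (a i) = g (a i) * T) ->
    (forall i, T * star (f (a i)) = star (g (a i)) * T) ->
  forall x, T * f x = g x * T.
Proof.
move=> ga fs gs H1 H2 x; have ST := ga _ (cstar_subalgebra_intertwine fs T gs).
suff : setT x by rewrite -ST; [case|move=> i /=; rewrite fs gs H1 H2].
by [].
Qed.

Lemma star_hom_ext (I : Type) (A B : cstarAlgType R) (a : I -> A)
    (f g : {lrmorphism A -> B}) : generated_by a -> star_hom f -> star_hom g ->
    (forall i, f (a i) = g (a i)) -> forall x, f x = g x.
Proof.
move=> ga fs gs H x.
by have := @intertwine_generated _ _ _ _ f g 1 ga fs gs; rewrite -[f x]mul1r => ->;
  rewrite ?mulr1// => i; rewrite !mul1r !mulr1 H.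
Qed.

Lemma universal_iso (I : Type) (P : relations I) (E1 E2 : cstarAlgType R) :
  universal_for P E1 -> universal_for P E2 -> cstar_isomorphic E1 E2.
Proof.
move=> [a [Pa ga ua]] [b [Pb gb ub]].
have [f [fs fa]] := ua _ _ Pb; have [g [gs gb']] := ub _ _ Pa.
have comp (A B C : cstarAlgType R) (h : {lrmorphism A -> B}) (k : {lrmorphism B -> C}) :
  star_hom h -> star_hom k -> star_hom (k \o h : {lrmorphism A -> C}).
  by move=> hs ks x /=; rewrite hs ks.
exists f; split => //; exists g => x.
  have := @star_hom_ext _ _ _ _ (g \o f : {lrmorphism E1 -> E1}) idfun ga (comp _ _ _ _ _ fs gs).
  by move=> H; apply: (H _ _ x) => // i /=; rewrite fa gb'.
have := @star_hom_ext _ _ _ _ (f \o g : {lrmorphism E2 -> E2}) idfun gb (comp _ _ _ _ _ gs fs).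
by move=> H; apply: (H _ _ x) => // i /=; rewrite gb' fa.
Qed.

(* A natural bijection between the solutions of two systems of relations, whose
   inverse stays in the generated C*-subalgebra, identifies the universal algebras. *)
Lemma universal_transfer (I J : Type) (P : relations I) (Q : relations J)
    (F : forall B : cstarAlgType R, (I -> B) -> J -> B)
    (G : forall B : cstarAlgType R, (J -> B) -> I -> B) (E : cstarAlgType R) :
    (forall B b, P B b -> Q B (F B b)) -> (forall B c, Q B c -> P B (G B c)) ->
    (forall B b, P B b -> forall i, G B (F B b) i = b i) ->
    (forall B c, Q B c -> forall j, F B (G B c) j = c j) ->
    (forall (A B : cstarAlgType R) (f : {lrmorphism A -> B}) a, star_hom f -> P A a ->
       forall j, f (F A a j) = F B (fun i => f (a i)) j) ->
    (forall (B : cstarAlgType R) c (S : set B), Q B c -> cstar_subalgebra S ->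
       (forall j, S (c j)) -> forall i, S (G B c i)) ->
  universal_for P E -> universal_for Q E.
Proof.
move=> PQ QP GF FG nat mem [a [Pa ga ua]]; exists (F E a); split; first exact: PQ.
  move=> S SP Sa; apply: ga => // i; rewrite -(GF _ _ Pa).
  by apply: mem => //; apply: PQ.
move=> B c Qc; have [f [fs fa]] := ua _ _ (QP _ _ Qc); exists f; split => // j.
rewrite nat// (_ : (fun i => f (a i)) = G B c) ?FG//.
by apply/funext => i; rewrite fa.
Qed.

Definition bool_gen (A : Type) (a1 a2 : A) (i : bool) : A := if i then a1 else a2.

Definition E_rel (y : R[i]) : relations bool :=
  fun B b => E_relations y (b true) (b false).

Lemma is_E_universal (y : R[i]) (E : cstarAlgType R) : is_E y E -> universal_for (E_rel y) E.
Proof.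
move=> [a1 [a2 [r12 g12 u12]]]; exists (bool_gen a1 a2); split => //.
  by move=> S SP Sa; apply: g12 => //; [apply: (Sa true)|apply: (Sa false)].
move=> B b rb; have [f [fs f1 f2]] := u12 _ _ _ rb.
by exists f; split => // -[].
Qed.

End Universal.

(** * Elimination of the parameter *)

Section Commutants.
Variables (R : realType) (A : cstarAlgType R).
Implicit Types (W S : set A).

Definition commutant W : set A := [set x | forall b, W b -> x * b = b * x].

Definition star_closed W := forall x, W x -> W (star x).

Lemma commutant_star W : star_closed W -> star_closed (commutant W).
Proof. by move=> sW; case: (cstar_subalgebra_commutant sW). Qed.

(** The centre of the bicommutant of [W]. Being a C*-subalgebra for star-closed [W], it contains the
    roots and inverses built from its elements, and these commute with every word in the
    generators. *)
Definition relative_center W : set A := commutant W `&` commutant (commutant W).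

Lemma bicommutant_subalgebra W : star_closed W ->
  cstar_subalgebra (commutant (commutant W)).
Proof. by move=> sW; apply/cstar_subalgebra_commutant/commutant_star. Qed.

Lemma relative_center_subalgebra W : star_closed W ->
  cstar_subalgebra (relative_center W).
Proof.
move=> sW; have [c1 u1 l1 m1 s1] := cstar_subalgebra_commutant sW.
have [c2 u2 l2 m2 s2] := bicommutant_subalgebra sW; split.
- exact: norm_closedI.
- by split.
- by move=> c x y [? ?] [? ?]; split; [apply: l1|apply: l2].
- by move=> x y [? ?] [? ?]; split; [apply: m1|apply: m2].
- by move=> x [? ?]; split; [apply: s1|apply: s2].
Qed.

Lemma bicommutant_gen W x : W x -> commutant (commutant W) x.
Proof. by move=> Wx b /(_ _ Wx). Qed.

Lemma relative_center_comm W z x : relative_center W z -> commutant (commutant W) x ->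
  x * z = z * x.
Proof. by move=> [cz _]; apply. Qed.

Lemma relative_center_comm2 W z z' : relative_center W z -> relative_center W z' ->
  z' * z = z * z'.
Proof. by move=> zW [_ z'W]; apply: relative_center_comm zW z'W. Qed.

Definition star_gens (I : Type) (a : I -> A) : set A :=
  [set x | exists i, x = a i \/ x = star (a i)].

Lemma star_gens_closed (I : Type) (a : I -> A) : star_closed (star_gens a).
Proof. by move=> x [i [->|->]]; exists i; [right|left; rewrite starK]. Qed.

End Commutants.

(* [zs] and [xs] are tuples, ending with [tt], of proofs of membership in a
   relative center and in the bicommutant it belongs to. *)
Ltac comm_rules_x z xs acc :=
  lazymatch xs with
  | (?x, ?xs') => let acc' := comm_rules_x z xs' acc in
                  constr:((relative_center_comm z x, acc'))
  | tt => acc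
  end.

Ltac comm_rules_z z zs acc :=
  lazymatch zs with
  | (?z', ?zs') => let acc' := comm_rules_z z zs' acc in
                   constr:((relative_center_comm2 z z', acc'))
  | tt => acc
  end.

Ltac comm_rules zs xs acc :=
  lazymatch zs with
  | (?z, ?zs') => let acc1 := comm_rules zs' xs acc in
                  let acc2 := comm_rules_x z xs acc1 in
                  comm_rules_z z zs' acc2
  | tt => acc
  end.

Ltac ncz zs xs hs := let hs' := comm_rules zs xs hs in nc hs'.

(** * Half angles of normal elements *)

Section HalfAngle.
Variables (R : realType) (A : cstarAlgType R).
Implicit Types (v : A).

(* [half_sin2 v], [half_cos v], [half_sin v] are [sin^2], [cos] and [sin] (with the
   phase of [v]) of half the angle whose sine is [2 v]. *)
Definition four_sqr v : A := star (v + v) * (v + v).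
Definition half_sin2 v : A := (2^-1 : R)%:C%C *: sqrt_defect (four_sqr v).
Definition half_cos v : A := csqrt1B (half_sin2 v).
Definition half_sin v : A := cinv (half_cos v) * v.
Definition full_sec v : A := cinv (csqrt1B (four_sqr v)).

Lemma four_sqr_lt1 v : cnorm (v + v) < 1 -> cnorm (four_sqr v) < 1.
Proof.
move=> v1; rewrite /four_sqr cnorm_star expr2.
by have := cnorm_ge0 (v + v); nra.
Qed.

Lemma half_sin2_lt1 v : cnorm (v + v) < 1 -> cnorm (half_sin2 v) < 1.
Proof.
move=> /four_sqr_lt1 /sqrt_defect_lt1 H.
rewrite cnormZr ger0_norm ?invr_ge0//; have := cnorm_ge0 (sqrt_defect (four_sqr v)); lra.
Qed.

Lemma half_cos_defect_lt1 v : cnorm (v + v) < 1 -> cnorm (sqrt_defect (half_sin2 v)) < 1.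
Proof. by move=> /half_sin2_lt1/sqrt_defect_lt1. Qed.

Section Mem.
Variables (S : set A) (v : A).
Hypotheses (SP : cstar_subalgebra S) (Sv : S v) (v1 : cnorm (v + v) < 1).

Lemma four_sqr_mem : S (four_sqr v).
Proof. by apply: subalgM => //; [apply: subalgS => //|]; apply: subalgD. Qed.

Lemma half_sin2_mem : S (half_sin2 v).
Proof.
apply: subalgZ => //; apply: sqrt_defect_mem => //; [exact: four_sqr_mem|exact: four_sqr_lt1].
Qed.

Lemma half_cos_mem : S (half_cos v).
Proof. by apply: csqrt1B_mem => //; [apply: half_sin2_mem|apply: half_sin2_lt1]. Qed.

Lemma half_sin_mem : S (half_sin v).
Proof.
apply: subalgM => //; apply: cinv1B_mem => //; last exact: half_cos_defect_lt1.
by apply: sqrt_defect_mem => //; [apply: half_sin2_mem|apply: half_sin2_lt1].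
Qed.

Lemma full_sec_mem : S (full_sec v).
Proof.
apply: cinv1B_mem => //; last exact/sqrt_defect_lt1/four_sqr_lt1.
by apply: sqrt_defect_mem => //; [apply: four_sqr_mem|apply: four_sqr_lt1].
Qed.

End Mem.

Lemma star_four_sqr v : star (four_sqr v) = four_sqr v.
Proof. by rewrite starM starK. Qed.

Lemma star_half_sin2 v : cnorm (v + v) < 1 -> star (half_sin2 v) = half_sin2 v.
Proof.
by move=> v1; rewrite starZr sqrt_defect_star ?star_four_sqr//; apply: four_sqr_lt1.
Qed.

Lemma star_half_cos v : cnorm (v + v) < 1 -> star (half_cos v) = half_cos v.
Proof.
by move=> v1; apply: csqrt1B_sa; [apply: half_sin2_lt1|apply: star_half_sin2].
Qed.

Lemma half_cos_inv v : cnorm (v + v) < 1 ->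
  cinv (half_cos v) * half_cos v = 1 /\ half_cos v * cinv (half_cos v) = 1.
Proof. by move=> v1; apply: cinv1BP; apply: half_cos_defect_lt1. Qed.

Lemma full_sec_inv v : cnorm (v + v) < 1 ->
  full_sec v * csqrt1B (four_sqr v) = 1 /\ csqrt1B (four_sqr v) * full_sec v = 1.
Proof. by move=> v1; apply: cinv1BP; apply/sqrt_defect_lt1/four_sqr_lt1. Qed.

Lemma star_full_sec v : cnorm (v + v) < 1 -> star (full_sec v) = full_sec v.
Proof.
move=> v1; have [r1 r2] := full_sec_inv v1; apply: cinv_star => //.
by apply: csqrt1B_sa; [apply: four_sqr_lt1|apply: star_four_sqr].
Qed.

Lemma half_sin2E v : cnorm (v + v) < 1 ->
  csqrt1B (four_sqr v) = 1 - half_sin2 v - half_sin2 v /\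
  half_sin2 v - half_sin2 v * half_sin2 v = star v * v.
Proof.
move=> v1; have x1 := four_sqr_lt1 v1.
have w2 : sqrt_defect (four_sqr v) = half_sin2 v + half_sin2 v.
  by rewrite -scalerDr scale_half_add.
split; first by rewrite /csqrt1B w2 opprD addrA.
have := sqrt_defect_sqr x1; rewrite w2 /four_sqr starD.
set p := half_sin2 v => e.
(* The rewriting tactic has no division: the identity is proved four times over and then halved
   twice. *)
have : (p - p * p) + (p - p * p) + ((p - p * p) + (p - p * p)) =
       (star v * v + star v * v) + (star v * v + star v * v).
  apply: (@addIr _ (- 1)); apply: oppr_inj; move/esym: e => e.
  transitivity (1 - (star v + star v) * (v + v)); first by rewrite e; nc tt.
  by nc tt.
move=> /(congr1 (fun x => ((2^-1 : R)%:C)%C *: (((2^-1 : R)%:C)%C *: x))).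
by rewrite !scale_half_add.
Qed.

Lemma half_angleP v : star v * v = v * star v -> cnorm (v + v) < 1 ->
  [/\ star (half_cos v) = half_cos v,
      half_cos v * half_sin v = v,
      half_cos v * half_cos v = 1 - star (half_sin v) * half_sin v,
      star (half_sin v) * half_sin v = half_sin v * star (half_sin v) &
      full_sec v * (half_cos v * half_cos v - star (half_sin v) * half_sin v) = 1 ].
Proof.
move=> vn v1; have ks := star_half_cos v1; have [k1 k2] := half_cos_inv v1.
have kis : star (cinv (half_cos v)) = cinv (half_cos v) by apply: cinv_star.
have [RE pE] := half_sin2E v1; have [r1 r2] := full_sec_inv v1.
have kk : half_cos v * half_cos v = 1 - half_sin2 v.
  by apply: csqrt1B_sqr; apply: half_sin2_lt1.
(* A normal [v] lies in the commutant of itself and its adjoint, so it is in the relative center of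
   what it generates, together with all the elements computed from it. *)
pose W := star_gens (fun _ : unit => v).
have sW : star_closed W := star_gens_closed (a:=_).
have vW' : commutant W v by move=> b [i [->|->]].
have vW : relative_center W v.
  by split => //; apply: bicommutant_gen; exists tt; left.
have ZP := relative_center_subalgebra sW.
have v'W := subalgS ZP vW.
have kW := half_cos_mem ZP vW v1; have pW := half_sin2_mem ZP vW v1.
have kiW : relative_center W (cinv (half_cos v)).
  apply: cinv1B_mem => //; last exact: half_cos_defect_lt1.
  by apply: sqrt_defect_mem => //; apply: half_sin2_lt1.
have bs : star (half_sin v) = star v * cinv (half_cos v) by rewrite starM kis.
have bb : star (half_sin v) * half_sin v = half_sin2 v.
  rewrite bs /half_sin.
  set k := half_cos v in k1 k2 kk kW kiW *; set ki := cinv k in k1 k2 kiW *.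
  set p := half_sin2 v in pE kk pW *.
  transitivity (ki * (ki * (star v * v))).
    by ncz (kiW, (vW, (v'W, tt))) tt tt.
  rewrite -pE; transitivity (ki * (ki * (p * (1 - p)))); first by nc tt.
  by rewrite -kk; ncz (kiW, (kW, (pW, tt))) tt (k1, (k2, tt)).
split => //.
- by rewrite /half_sin mulrA k2 mul1r.
- by rewrite bb.
- by rewrite bs /half_sin; ncz (kiW, (vW, (v'W, tt))) tt tt.
- by rewrite bb kk -RE.
Qed.

End HalfAngle.

Section HalfAngleHom.
Variables (R : realType) (A B : cstarAlgType R) (f : {lrmorphism A -> B}).
Hypothesis fs : star_hom f.
Implicit Types (v : A).

Lemma star_hom_four_sqr v : f (four_sqr v) = four_sqr (f v).
Proof. by rewrite rmorphM /= fs rmorphD. Qed.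

Lemma star_hom_half_sin2 v : cnorm (v + v) < 1 -> f (half_sin2 v) = half_sin2 (f v).
Proof.
move=> v1; rewrite linearZ /= star_hom_sqrt_defect ?star_hom_four_sqr//.
exact: four_sqr_lt1.
Qed.

Lemma star_hom_half_cos v : cnorm (v + v) < 1 -> f (half_cos v) = half_cos (f v).
Proof.
move=> v1; rewrite star_hom_csqrt1B ?star_hom_half_sin2//; exact: half_sin2_lt1.
Qed.

Lemma star_hom_half_sin v : cnorm (v + v) < 1 -> f (half_sin v) = half_sin (f v).
Proof.
move=> v1; have [k1 k2] := half_cos_inv v1.
by rewrite rmorphM /= star_hom_cinv// star_hom_half_cos.
Qed.

Lemma star_hom_full_sec v : cnorm (v + v) < 1 -> f (full_sec v) = full_sec (f v).
Proof.
move=> v1; have [r1 r2] := full_sec_inv v1.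
by rewrite star_hom_cinv// star_hom_csqrt1B ?star_hom_four_sqr//; apply: four_sqr_lt1.
Qed.

End HalfAngleHom.

(** * From [c], [d] to [e], [g], [f] *)

Record L_relations (R : realType) (lam : R) (A : cstarAlgType R) (c d : A) : Prop := {
  L_c : star c * c = 1 - c * star c;
  L_d : star d * d = 1 - d * star d;
  L_cd : d * star c = - (star c * d);
  L_sqr : c * c = ((lam%:C)%C%:A) * (d * d) }.

(** [e] generates 2 by 2 matrix units and [g] is central; [f] commutes with [e] once multiplied by
    the sign [e * star e - star e * e]. The equations are oriented as rewrite rules for [nc]. *)
Record F_relations (R : realType) (A : cstarAlgType R) (e g f : A) : Prop := {
  F_e : e * e = 0;
  F_eS : star e * e = 1 - e * star e;
  F_fe : f * e = - (e * f);
  F_feS : f * star e = - (star e * f);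
  F_f : star f * f = 1 - g * star g - f * star f;
  F_eg : e * g = g * e;
  F_egS : e * star g = star g * e;
  F_fg : f * g = g * f;
  F_fgS : f * star g = star g * f;
  F_g : star g * g = g * star g }.

Section LtoFAlgebra.
Variables (R : realType) (A : cstarAlgType R) (W : set A).
Variables (c d k b r g e f : A).
Hypothesis sW : star_closed W.
Let ZP := relative_center_subalgebra sW.
Let BP := bicommutant_subalgebra sW.
Hypotheses (cW : commutant (commutant W) c) (dW : commutant (commutant W) d).
Hypotheses (kW : relative_center W k) (bW : relative_center W b).
Hypotheses (rW : relative_center W r) (gW : relative_center W g).
Hypotheses (Lc : star c * c = 1 - c * star c) (Ld : star d * d = 1 - d * star d).
Hypotheses (Lcd : d * star c = - (star c * d)).
Hypotheses (ks : star k = k) (rs : star r = r) (vE : c * c = k * b).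
Hypotheses (kk : k * k = 1 - star b * b) (rk : r * (k * k - star b * b) = 1).
Hypothesis eE : e = r * (k * c - b * star c).
Hypothesis gE : g = r * (c * d + d * c).
Hypothesis fE : f = d + star b * g * e - k * g * star e.

Let csW := subalgS BP cW.
Let dsW := subalgS BP dW.
Let bsW := subalgS ZP bW.
Let gsW := subalgS ZP gW.

Let vsE : star c * star c = k * star b.
Proof. by rewrite -starM vE starM ks; apply: relative_center_comm2 kW bsW. Qed.

Lemma LF_star_e : star e = r * (k * star c - star b * c).
Proof.
rewrite eE starM starB !starM ks rs starK.
by ncz (rW, (kW, (bsW, tt))) (cW, (csW, tt)) tt.
Qed.
Let esE := LF_star_e.

Let eW : commutant (commutant W) e.
Proof.
have [[_ kW2] [_ bW2]] := (kW, bW); have [_ rW2] := rW.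
rewrite eE; apply: (subalgM BP) => //; apply: (subalgB BP); exact: (subalgM BP).
Qed.
Let esW := subalgS BP eW.

Let ee : e * e = 0.
Proof.
rewrite eE; ncz (rW, (kW, (bW, (bsW, tt)))) (cW, (csW, tt)) (vE, (vsE, (Lc, (kk, tt)))).
Qed.

Let eses : star e * star e = 0.
Proof. by rewrite -starM ee star0. Qed.

Let ees : star e * e = 1 - e * star e.
Proof.
pose E1 := k * c - b * star c; pose E2 := k * star c - star b * c.
have E12 : E2 * E1 + E1 * E2 = (k * k - star b * b) * (k * k - star b * b).
  rewrite /E1 /E2; ncz (kW, (bW, (bsW, tt))) (cW, (csW, tt)) (vE, (vsE, (Lc, (kk, tt)))).
have -> : star e * e = r * (r * (E2 * E1 + E1 * E2)) - e * star e.
  by rewrite esE eE /E1 /E2; ncz (rW, (kW, (bW, (bsW, tt)))) (cW, (csW, tt)) tt.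
rewrite E12; congr (_ - _).
transitivity ((r * (k * k - star b * b)) * (r * (k * k - star b * b))).
  by ncz (rW, (kW, (bW, (bsW, tt)))) tt tt.
by rewrite rk mulr1.
Qed.

Let de : d * e = k * g - e * d.
Proof.
rewrite eE gE; ncz (rW, (kW, (bW, tt))) (cW, (csW, (dW, tt))) (Lcd, tt).
Qed.

Let des : d * star e = - (star b * g) - star e * d.
Proof.
rewrite esE gE; ncz (rW, (kW, (bsW, tt))) (cW, (csW, (dW, tt))) (Lcd, tt).
Qed.

Let dse : star d * e = - (b * star g) - e * star d.
Proof.
have := congr1 star des; rewrite starM starB starN !starM !starK => h.
have -> : star d * e = - (star g * b) - e * star d by apply: (@addIr _ (e * star d)); nc (h, tt).
by ncz (bW, (gsW, tt)) (eW, (dsW, tt)) tt.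
Qed.

Let dses : star d * star e = k * star g - star e * star d.
Proof.
have := congr1 star de; rewrite starM starB !starM ks => h.
have -> : star d * star e = star g * k - star e * star d.
  by apply: (@addIr _ (star e * star d)); nc (h, tt).
by ncz (kW, (gsW, tt)) (esW, (dsW, tt)) tt.
Qed.

Let fsE : star f = star d + star g * b * star e - k * star g * e.
Proof.
rewrite fE starB starD !starM !starK ks.
by ncz (kW, (bW, (gsW, tt))) (eW, (esW, tt)) tt.
Qed.

Let fW : commutant (commutant W) f.
Proof.
have [[_ kW2] [_ bsW2]] := (kW, bsW); have [_ gW2] := gW.
by rewrite fE; apply: (subalgB BP); [apply: (subalgD BP) => //|];
  apply: (subalgM BP) => //; apply: (subalgM BP).
Qed.

(** The anticommutators of [d] with [e] and [star e] are [k * g] and [- (star b * g)]. As [e] and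
    [star e] have square zero and anticommutator one, removing [k * g * star e - star b * g * e]
    from [d] leaves an [f] anticommuting with both. The price is that the anticommutator of [f] with
    its adjoint drops from [1] by [(k * k + star b * b) * g * star g], which is [g * star g]. *)
Lemma LF_relations : F_relations e g f.
Proof.
split.
- exact: ee.
- exact: ees.
- rewrite fE.
  ncz (kW, (bsW, (gW, tt))) (eW, (esW, (dW, tt))) (de, (des, (ee, (eses, (ees, tt))))).
- rewrite fE.
  ncz (kW, (bsW, (gW, tt))) (eW, (esW, (dW, tt))) (de, (des, (ee, (eses, (ees, tt))))).
- rewrite fsE fE.
  ncz (kW, (bW, (bsW, (gW, (gsW, tt))))) (eW, (esW, (dW, (dsW, tt))))
    (de, (des, (dse, (dses, (ee, (eses, (ees, (Ld, (kk, tt))))))))).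
- exact: relative_center_comm gW eW.
- exact: relative_center_comm gsW eW.
- exact: relative_center_comm gW fW.
- exact: relative_center_comm gsW fW.
- exact: relative_center_comm2 gW gsW.
Qed.

Lemma LF_ff : f * f = d * d + k * star b * g * g.
Proof.
rewrite fE.
ncz (kW, (bsW, (gW, tt))) (eW, (esW, (dW, tt))) (de, (des, (ee, (eses, (ees, (kk, tt)))))).
Qed.

Lemma LF_c : c = k * e + b * star e.
Proof.
transitivity ((r * (k * k - star b * b)) * c); first by rewrite rk mul1r.
by rewrite esE eE; ncz (rW, (kW, (bW, (bsW, tt)))) (cW, (csW, tt)) tt.
Qed.

Lemma LF_d : d = f - star b * g * e + k * g * star e.
Proof. by rewrite fE; nc tt. Qed.

End LtoFAlgebra.

Section LtoF.
Variables (R : realType) (A : cstarAlgType R) (c d : A).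

(** Inverts [c = k * e + b * star e], a rotation mixing [e] with its adjoint. The determinant
    [k * k - star b * b] is the cosine of the full angle, whence the factor [full_sec]. *)
Definition LF_e : A :=
  full_sec (c * c) * (half_cos (c * c) * c - half_sin (c * c) * star c).
Definition LF_g : A := full_sec (c * c) * (c * d + d * c).
Definition LF_f : A :=
  d + star (half_sin (c * c)) * LF_g * LF_e - half_cos (c * c) * LF_g * star LF_e.

End LtoF.

Section LRelations.
Variables (R : realType) (A : cstarAlgType R) (lam : R) (c d : A).
Hypothesis lam01 : 0 < lam < 1.
Hypothesis cdP : L_relations lam c d.

Let W : set A := star_gens (bool_gen c d).
Let v : A := c * c.
Let del : A := c * d + d * c.
Let l : A := (lam%:C)%C%:A.

Let lam0 : 0 < lam. Proof. by case/andP: lam01. Qed.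

Let sW : star_closed W. Proof. exact: star_gens_closed. Qed.
Let ZP := relative_center_subalgebra sW.
Let BP := bicommutant_subalgebra sW.
Let cW : commutant (commutant W) c. Proof. by apply: bicommutant_gen; exists true; left. Qed.
Let dW : commutant (commutant W) d. Proof. by apply: bicommutant_gen; exists false; left. Qed.
Let csW := subalgS BP cW.
Let dsW := subalgS BP dW.
Let lW : relative_center W l. Proof. exact: subalg_alg. Qed.

Let Lc := L_c cdP.
Let Ld := L_d cdP.
Let Lcd := L_cd cdP.
Let Lsq : c * c = l * (d * d) := L_sqr cdP.
Let Ldc : star d * c = - (c * star d).
Proof.
by have := congr1 star Lcd; rewrite starM starK starN starM starK => ->; rewrite opprK.
Qed.

Lemma L_commutantP x : x * c = c * x -> x * d = d * x ->
  x * star c = star c * x -> x * star d = star d * x -> commutant W x.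
Proof. by move=> xc xd xcs xds b [[] [->|->]]. Qed.

Let il : A := ((lam^-1)%:C)%C%:A.
Let ill : il * l = 1.
Proof. by rewrite /il /l alg_mul -rmorphM mulVf ?gt_eqF// rmorph1 scale1r. Qed.
Let ilW : relative_center W il. Proof. exact: subalg_alg. Qed.
Let Lsq' : d * d = il * (c * c). Proof. by rewrite Lsq mulrA ill mul1r. Qed.

Lemma L_dd_center : relative_center W (d * d).
Proof.
split; last exact: (subalgM BP).
apply: L_commutantP.
- by ncz (ilW, tt) (cW, tt) (Lsq', tt).
- by nc tt.
- by nc Lcd.
- by nc Ld.
Qed.
Let ddW := L_dd_center.

Lemma L_v_center : relative_center W v.
Proof. by rewrite /v Lsq; apply: (subalgM ZP). Qed.
Let vW := L_v_center.

(** [del] commutes with [c] and [d] because their squares are central, and with the adjoints because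
    [star c] and [star d] have scalar anticommutators with both [c] and [d]. *)
Lemma L_del_center : relative_center W del.
Proof.
have cdd : c * (d * d) = d * d * c by ncz (ilW, tt) (cW, tt) (Lsq', tt).
have cc'd : star d * (c * c) = c * c * star d.
  by rewrite Lsq; ncz (lW, tt) (dsW, tt) Ld.
split; last by apply: (subalgD BP); apply: (subalgM BP).
have cdd' : c * d * d = d * d * c by rewrite -mulrA.
apply: L_commutantP; rewrite /del.
- have -> : (c * d + d * c) * c = c * d * c + d * v by rewrite /v; nc tt.
  have -> : c * (c * d + d * c) = v * d + c * d * c by rewrite /v; nc tt.
  by rewrite (relative_center_comm vW dW) addrC.
- by nc cdd'.
- have Lc' : c * star c = 1 - star c * c by rewrite Lc; nc tt.
  by nc (Lcd, Lc').
- have Ld' : d * star d = 1 - star d * d by rewrite Ld; nc tt.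
  have Ldc' : c * star d = - (star d * c) by rewrite Ldc opprK.
  by nc (Ldc', Ld').
Qed.
Let delW := L_del_center.

(** With [t = 2 d ^ 2], the element [1 - star t * t] is the square of the selfadjoint
    [star d * d - d * star d], so [t] has norm at most one. Then [2 v = lam t], and [lam < 1] gives
    strictness. *)
Lemma L_v_lt1 : cnorm (v + v) < 1.
Proof.
have [l0 l1] := andP lam01.
pose t := d * d + d * d.
have tW : relative_center W t by apply: (subalgD ZP).
have tn : star t * t = t * star t by apply: relative_center_comm2 tW (subalgS ZP tW).
have kk : 1 - star t * t = (star d * d - d * star d) * (star d * d - d * star d).
  by rewrite /t starD starM; nc Ld.
have ks : star (star d * d - d * star d) = star d * d - d * star d.
  by rewrite starB !starM starK.
have t1 : cnorm t ^+ 2 <= 1.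
  by apply: cnorm_normal_le => //; rewrite rmorph1 scale1r kk; apply: cpos_sqr.
have -> : v + v = (lam%:C)%C *: t by rewrite /v Lsq /l mulr_algl -scalerDr.
rewrite cnormZr gtr0_norm//; have : cnorm t <= 1.
  by rewrite -(@ler_pXn2r _ 2) ?nnegrE ?cnorm_ge0// expr1n.
have := cnorm_ge0 t; nra.
Qed.
Let v1 := L_v_lt1.



Let vn : star v * v = v * star v.
Proof. exact: relative_center_comm2 vW (subalgS ZP vW). Qed.
Let kW : relative_center W (half_cos v). Proof. exact: half_cos_mem. Qed.
Let bW : relative_center W (half_sin v). Proof. exact: half_sin_mem. Qed.
Let rW : relative_center W (full_sec v). Proof. exact: full_sec_mem. Qed.
Let gW : relative_center W (LF_g c d). Proof. exact: (subalgM ZP). Qed.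
Let ks : star (half_cos v) = half_cos v. Proof. exact: star_half_cos. Qed.
Let rs : star (full_sec v) = full_sec v. Proof. exact: star_full_sec. Qed.
Let vE : c * c = half_cos v * half_sin v. Proof. by have [_ ->] := half_angleP vn v1. Qed.
Let kk : half_cos v * half_cos v = 1 - star (half_sin v) * half_sin v.
Proof. by have [_ _ ->] := half_angleP vn v1. Qed.
Let rk : full_sec v * (half_cos v * half_cos v - star (half_sin v) * half_sin v) = 1.
Proof. by have [_ _ _ _] := half_angleP vn v1. Qed.

Lemma L_F_relations : F_relations (LF_e c) (LF_g c d) (LF_f c d).
Proof. exact: (LF_relations sW cW dW kW bW rW gW Lc Ld Lcd ks rs vE kk rk). Qed.

(** Combined with [v = lam d ^ 2], this is the equation [v = lam (f ^ 2 - star v g ^ 2)], from which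
    [v] is recovered once [c] and [d] are forgotten. *)
Lemma L_FfE : LF_f c d * LF_f c d = d * d + star v * (LF_g c d * LF_g c d).
Proof.
have vs : star v = half_cos v * star (half_sin v).
  transitivity (star (half_cos v * half_sin v)); first by rewrite -vE.
  by rewrite starM ks; apply: relative_center_comm2 kW (subalgS ZP bW).
rewrite vs (LF_ff sW cW dW kW bW rW gW Lc Lcd ks rs vE kk rk erefl erefl erefl).
by congr (_ + _); move: (LF_g c d) => z; nc tt.
Qed.

Lemma L_FcE : c = half_cos v * LF_e c + half_sin v * star (LF_e c).
Proof. exact: (LF_c sW cW kW bW rW ks rs rk erefl). Qed.

End LRelations.

(** * From [e], [g], [f] back to [c], [d] *)

Section FtoL.
Variables (R : realType) (A : cstarAlgType R) (lam : R) (e g f : A).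

Definition FL_den : A := (lam%:C)%C%:A * (lam%:C)%C%:A * (g * g) * star (g * g).
(* The solution [v] of [v = lam (f ^ 2 - v^* g ^ 2)], an equation which its adjoint
   makes linear in [v]. *)
Definition FL_v : A :=
  cinv (1 - FL_den) *
    ((lam%:C)%C%:A * (f * f - (lam%:C)%C%:A * (g * g) * star (f * f))).
Definition FL_c : A := half_cos FL_v * e + half_sin FL_v * star e.
Definition FL_d : A := f - star (half_sin FL_v) * g * e + half_cos FL_v * g * star e.

End FtoL.

Definition F_gen (A : Type) (e g f : A) (i : option bool) : A :=
  if i is Some i then if i then e else f else g.

Section FtoLAlgebra.
Variables (R : realType) (A : cstarAlgType R) (W : set A).
Variables (e g f k b c d : A).
Hypothesis sW : star_closed W.
Let ZP := relative_center_subalgebra sW.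
Let BP := bicommutant_subalgebra sW.
Hypotheses (eW : commutant (commutant W) e) (fW : commutant (commutant W) f).
Hypotheses (kW : relative_center W k) (bW : relative_center W b).
Hypotheses (gW : relative_center W g).
Hypotheses (efP : F_relations e g f).
Hypotheses (ks : star k = k) (kk : k * k = 1 - star b * b).
Hypothesis cE : c = k * e + b * star e.
Hypothesis dE : d = f - star b * g * e + k * g * star e.

Let esW := subalgS BP eW.
Let fsW := subalgS BP fW.
Let bsW := subalgS ZP bW.
Let gsW := subalgS ZP gW.
Let ee := F_e efP.
Let ees := F_eS efP.
Let fe := F_fe efP.
Let fes := F_feS efP.
Let ff := F_f efP.
Let eses : star e * star e = 0.
Proof. by rewrite -starM ee star0. Qed.
Let fse : star f * e = - (e * star f).
Proof.
by have := congr1 star fes; rewrite starM starK starN starM starK => ->; rewrite opprK.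
Qed.
Let fses : star f * star e = - (star e * star f).
Proof. by have := congr1 star fe; rewrite starM starN starM => ->; rewrite opprK. Qed.
Let csE : star c = k * star e + star b * e.
Proof. by rewrite cE starD !starM starK ks; ncz (kW, (bsW, tt)) (eW, (esW, tt)) tt. Qed.
Let dsE : star d = star f - star g * b * star e + k * star g * e.
Proof.
rewrite dE starD starB !starM !starK ks.
by ncz (kW, (bW, (gsW, tt))) (eW, (esW, tt)) tt.
Qed.

Lemma FL_cc : c * c = k * b.
Proof.
rewrite cE; ncz (kW, (bW, tt)) (eW, (esW, tt)) (ee, (eses, (ees, (kk, tt)))).
Qed.

Lemma FL_dd : d * d = f * f - star b * k * (g * g).
Proof.
rewrite dE; ncz (kW, (bsW, (gW, tt))) (eW, (esW, (fW, tt)))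
  (fe, (fes, (ee, (eses, (ees, (kk, tt)))))).
Qed.

(** Any half angle yields the first three relations; [lam] enters only through the value of [k * b],
    which is [c ^ 2]. *)
Lemma FL_relations lam : k * b = (lam%:C)%C%:A * (d * d) -> L_relations lam c d.
Proof.
move=> kb; split.
- rewrite csE cE; ncz (kW, (bW, (bsW, tt))) (eW, (esW, tt)) (ee, (eses, (ees, (kk, tt)))).
- rewrite dsE dE; ncz (kW, (bW, (bsW, (gW, (gsW, tt))))) (eW, (esW, (fW, (fsW, tt))))
    (fe, (fes, (fse, (fses, (ee, (eses, (ees, (ff, (kk, tt))))))))).
- rewrite csE dE; ncz (kW, (bW, (bsW, (gW, (gsW, tt))))) (eW, (esW, (fW, tt)))
    (fe, (fes, (ee, (eses, (ees, (kk, tt)))))).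
- by rewrite FL_cc kb.
Qed.

Variable r : A.
Hypotheses (rW : relative_center W r) (rk : r * (k * k - star b * b) = 1).

Lemma FL_e : e = r * (k * c - b * star c).
Proof.
transitivity (r * (k * k - star b * b) * e); first by rewrite rk mul1r.
by rewrite csE cE; ncz (rW, (kW, (bW, (bsW, tt)))) (eW, (esW, tt)) tt.
Qed.

Lemma FL_g : g = r * (c * d + d * c).
Proof.
transitivity (r * (k * k - star b * b) * g); first by rewrite rk mul1r.
rewrite cE dE; ncz (rW, (kW, (bW, (bsW, (gW, tt))))) (eW, (esW, (fW, tt)))
    (fe, (fes, (ee, (eses, (ees, tt))))).
Qed.

Lemma FL_f : f = d + star b * g * e - k * g * star e.
Proof. by rewrite dE; nc tt. Qed.

End FtoLAlgebra.

Section FBound.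
Variables (R : realType) (A : cstarAlgType R) (lam : R) (W : set A) (g f di : A).
Hypothesis lam01 : 0 < lam < 1.
Hypothesis sW : star_closed W.
Let ZP := relative_center_subalgebra sW.
Let BP := bicommutant_subalgebra sW.
Let l : A := (lam%:C)%C%:A.
Hypotheses (fW : commutant (commutant W) f) (gW : relative_center W g).
Hypotheses (diW : relative_center W di) (qW : relative_center W (f * f)).
Hypothesis ff : star f * f = 1 - g * star g - f * star f.
Hypothesis dis : star di = di.
Hypothesis diD : di * (1 - l * l * (g * g) * (star g * star g)) = 1.

Let lW : relative_center W l. Proof. exact: subalg_alg. Qed.
Let ls : star l = l. Proof. exact: star_algr. Qed.
Let fsW := subalgS BP fW.
Let gsW := subalgS ZP gW.

(* Cauchy-Schwarz in disguise: the difference is an explicit sum of squares. *)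
Lemma F_bound (y : A) : y = di * (f * f - l * (g * g) * star (f * f)) ->
  cnorm (y + y) <= 1.
Proof.
move=> yE; have [lam0 lam1] := andP lam01.
have yW : relative_center W (y + y).
  rewrite yE; apply: (subalgD ZP); apply: (subalgM ZP) => //; apply: (subalgB ZP) => //;
    (apply: (subalgM ZP); [apply: (subalgM ZP) => //;
      apply: (subalgM ZP) => //|exact: (subalgS ZP)]).
rewrite -(@ler_pXn2r _ 2) ?nnegrE ?cnorm_ge0// expr1n.
apply: cnorm_normal_le => //; first exact: relative_center_comm2 yW (subalgS ZP yW).
rewrite rmorph1 scale1r.
(* [m] is the inverse of [1 - l * g * star g], since the denominator factors as [(1 - l * g * star
   g) * (1 + l * g * star g)]. *)
have [m mE] : exists m, m = di * (1 + l * g * star g) by exists (di * (1 + l * g * star g)).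
pose X := m * (star f * f - f * star f).
pose Y := m * g.
pose Z := m * g * f.
pose U := di * (g * (star f * star f) + star g * (f * f)).
have mW : relative_center W m.
  by rewrite mE; apply: (subalgM ZP) => //; apply: (subalgD ZP); [apply: (subalg1 ZP)|
    apply: (subalgM ZP) => //; apply: (subalgM ZP)].
have ms : star m = m.
  by rewrite mE starM starD star1 !starM starK ls dis; ncz (diW, (lW, (gW, (gsW, tt)))) tt tt.
have Xs : star X = X.
  by rewrite /X starM starB !starM !starK ms; ncz (mW, tt) (fW, (fsW, tt)) tt.
have Us : star U = U.
  by rewrite /U starM starD !starM !starK dis; ncz (diW, (gW, (gsW, tt))) (fW, (fsW, tt)) tt.
have Yn : star Y * Y = Y * star Y.
  by rewrite /Y starM ms; ncz (mW, (gW, (gsW, tt))) tt tt.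
have -> : 1 - star (y + y) * (y + y) =
    X * X + (((1 - lam) * (1 - lam))%:C)%C *: (star Y * Y) +
    (((1 - lam) * (1 + lam))%:C)%C *: (star Z * Z + Z * star Z) +
    ((4 * lam)%:C)%C *: (U * U).
  rewrite -![_ *: (_ + _)]mulr_algl -![_ *: (_ * _)]mulr_algl.
  have -> : (((1 - lam) * (1 - lam))%:C)%C%:A = (1 - l) * (1 - l) :> A.
    by rewrite rmorphM -alg_mul rmorphB rmorph1 scalerBl scale1r.
  have -> : (((1 - lam) * (1 + lam))%:C)%C%:A = (1 - l) * (1 + l) :> A.
    by rewrite rmorphM -alg_mul rmorphB rmorphD rmorph1 scalerBl scalerDl scale1r.
  have -> : ((4 * lam)%:C)%C%:A = l + l + l + l :> A.
    by rewrite (_ : 4 * lam = lam + lam + lam + lam) ?alg_realD//; lra.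
  have ys : star y = di * (star f * star f - l * (star g * star g) * (f * f)).
    rewrite yE starM starB !starM !starK ls dis.
    by ncz (diW, (lW, (gsW, tt))) (fW, (fsW, tt)) tt.
  have Zs : star Z = star f * (star g * m) by rewrite /Z !starM ms.
  have Ys : star Y = star g * m by rewrite /Y starM ms.
  rewrite starD ys yE Zs Ys /X /Y /Z /U mE starM.
  (* Writing [1] as [(di * D) * (di * D)] gives every term the factor [di * di]; what remains is a
     polynomial identity modulo the relation of [f]. *)
  pose D := 1 - l * l * (g * g) * (star g * star g).
  transitivity (di * D * (di * D) - di * di *
     (star f * star f - l * (star g * star g) * (f * f) +
      (star f * star f - l * (star g * star g) * (f * f))) *
     (f * f - l * (g * g) * (star f * star f) + (f * f - l * (g * g) * (star f * star f)))).
    by rewrite diD; ncz (diW, (lW, (gW, (gsW, tt)))) (fW, (fsW, tt)) tt.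
  by rewrite /D; ncz (diW, (lW, (gW, (gsW, tt)))) (fW, (fsW, tt)) (ff, tt).
by do ?apply: cposD; do ?apply: cposZ; rewrite ?mulr_ge0 ?subr_ge0 ?addr_ge0 ?ltW//;
  [apply: cpos_sqr|apply: cpos_normal|apply: cpos_anticomm|apply: cpos_sqr].
Qed.
End FBound.

Section FRelations.
Variables (R : realType) (A : cstarAlgType R) (lam : R) (e g f : A).
Hypothesis lam01 : 0 < lam < 1.
Hypothesis efP : F_relations e g f.

Let W : set A := star_gens (F_gen e g f).
Let l : A := (lam%:C)%C%:A.
Let lam0 : 0 < lam. Proof. by case/andP: lam01. Qed.
Let lam1 : lam < 1. Proof. by case/andP: lam01. Qed.

Let sW : star_closed W. Proof. exact: star_gens_closed. Qed.
Let ZP := relative_center_subalgebra sW.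
Let BP := bicommutant_subalgebra sW.
Let eW : commutant (commutant W) e. Proof. by apply: bicommutant_gen; exists (Some true);
  left. Qed.
Let fW : commutant (commutant W) f. Proof. by apply: bicommutant_gen; exists (Some false);
  left. Qed.
Let gW2 : commutant (commutant W) g. Proof. by apply: bicommutant_gen; exists None; left. Qed.
Let esW := subalgS BP eW.
Let fsW := subalgS BP fW.
Let lW : relative_center W l. Proof. exact: subalg_alg. Qed.
Let ls : star l = l. Proof. exact: star_algr. Qed.

Lemma F_commutantP x : e * x = x * e -> star e * x = x * star e ->
  f * x = x * f -> star f * x = x * star f -> g * x = x * g -> star g * x = x * star g ->
  commutant W x.
Proof. by move=> ? ? ? ? ? ? b [[[]|] /= [->|->]]. Qed.

Lemma F_g_center : relative_center W g.
Proof.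
split => //; apply: F_commutantP => //.
- exact: (F_eg efP).
- by have := congr1 star (F_egS efP); rewrite !starM !starK => ->.
- exact: (F_fg efP).
- by have := congr1 star (F_fgS efP); rewrite !starM !starK => ->.
- exact: (F_g efP).
Qed.
Let gW := F_g_center.
Let gsW := subalgS ZP gW.

Let ff := F_f efP.
Let fe := F_fe efP.
Let fes := F_feS efP.

Lemma F_ff_center : relative_center W (f * f).
Proof.
split; last exact: (subalgM BP).
apply: F_commutantP.
- by apply/esym; nc (fe, tt).
- by apply/esym; nc (fes, tt).
- by nc tt.
- by ncz (gW, (gsW, tt)) (fW, (fsW, tt)) (ff, tt).
- by ncz (gW, tt) (fW, tt) tt.
- by ncz (gsW, tt) (fW, tt) tt.
Qed.
Let qW := F_ff_center.
Let qsW := subalgS ZP qW.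

Lemma F_g_le1 : cnorm g <= 1.
Proof.
rewrite -(@ler_pXn2r _ 2) ?nnegrE ?cnorm_ge0// expr1n.
apply: cnorm_normal_le => //; first exact: F_g efP.
rewrite rmorph1 scale1r (_ : 1 - _ = star f * f + f * star f); first exact: cpos_anticomm.
by rewrite ff (F_g efP); nc tt.
Qed.

Lemma FL_den_lt1 : cnorm (FL_den lam g) < 1.
Proof.
have g1 := F_g_le1; have g0 := cnorm_ge0 g.
have gg : cnorm (g * g) <= 1.
  by apply: le_trans (cnormM _ _) _; nra.
have gg0 := cnorm_ge0 (g * g).
have -> : FL_den lam g = ((lam * lam)%:C)%C *: ((g * g) * star (g * g)).
  by rewrite /FL_den alg_mul mulr_algl -scalerAl -rmorphM.
rewrite cnormZr gtr0_norm ?mulr_gt0//.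
have := cnormM (g * g) (star (g * g)); rewrite cnorm_starE.
have := cnorm_ge0 (g * g * star (g * g)).
set x := cnorm (g * g) in gg gg0 *; set y := cnorm _ => y0 yx.
have y1 : y <= 1 by nra.
by have := lam0; have := lam1; nra.
Qed.

Let D : A := 1 - FL_den lam g.
Let di : A := cinv D.
Let denW : relative_center W (FL_den lam g).
Proof.
by apply: (subalgM ZP); [|apply: (subalgS ZP)]; apply: (subalgM ZP) => //;
  apply: (subalgM ZP).
Qed.
Let diW : relative_center W di.
Proof. by apply: cinv1B_mem => //; apply: FL_den_lt1. Qed.
Let diD : di * D = 1. Proof. by have [] := cinv1BP FL_den_lt1. Qed.
Let Ddi : D * di = 1. Proof. by have [] := cinv1BP FL_den_lt1. Qed.
Let DE : D = 1 - l * l * (g * g) * (star g * star g).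
Proof. by rewrite /D /FL_den starM. Qed.
Let Ds : star D = D.
Proof.
by rewrite DE starB star1 !starM !starK ls; ncz (lW, (gW, (gsW, tt))) tt tt.
Qed.
Let dis : star di = di. Proof. exact: cinv_star. Qed.

Let v := FL_v lam g f.
Let vW : relative_center W v.
Proof.
apply: (subalgM ZP) => //; apply: (subalgM ZP) => //.
by apply: (subalgB ZP) => //; apply: (subalgM ZP); [apply: (subalgM ZP) => //;
  apply: (subalgM ZP)|].
Qed.

Let y : A := di * (f * f - l * (g * g) * star (f * f)).
Let y1 : cnorm (y + y) <= 1.
Proof. by apply: (F_bound lam01 sW fW gW diW qW ff dis _ erefl); rewrite -DE. Qed.
Let vy : v = (lam%:C)%C *: y.
Proof.
rewrite -mulr_algl /y /v /FL_v -/D -/di -/l.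
by move: (f * f - _) => N; ncz (diW, (lW, tt)) tt tt.
Qed.

(** [F_bound] says that twice [v / lam] has norm at most one; the factor [lam] makes the bound
    strict, as the half angle of [v] requires. *)
Lemma F_v_lt1 : cnorm (v + v) < 1.
Proof.
rewrite vy -scalerDr cnormZr gtr0_norm//.
apply: le_lt_trans lam1; rewrite -[leRHS]mulr1; apply: ler_wpM2l y1; exact: ltW.
Qed.
Let v1 := F_v_lt1.

Lemma F_vE : l * (f * f - star v * (g * g)) = v.
Proof.
have vE : v = di * (l * (f * f - l * (g * g) * star (f * f))) by [].
have vsE : star v = di * (l * (star (f * f) - l * (star g * star g) * (f * f))).
  rewrite vE; move: (f * f) qW qsW => q qW' qsW'.
  rewrite starM starM starB !starM starK ls dis.
  by ncz (diW, (lW, (gW, (gsW, (qW', (qsW', tt)))))) tt tt.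
rewrite vsE [RHS]vE; move: (f * f) qW qsW => q qW' qsW'.
transitivity (di * D * (l * q) - l * (di * (l * (star q - l * (star g * star g) * q)) * (g * g))).
  by rewrite diD; nc tt.
by rewrite DE; ncz (diW, (lW, (gW, (gsW, (qW', (qsW', tt)))))) tt tt.
Qed.

Let vn : star v * v = v * star v.
Proof. exact: relative_center_comm2 vW (subalgS ZP vW). Qed.
Let kW : relative_center W (half_cos v). Proof. exact: half_cos_mem. Qed.
Let bW : relative_center W (half_sin v). Proof. exact: half_sin_mem. Qed.
Let rW : relative_center W (full_sec v). Proof. exact: full_sec_mem. Qed.
Let ks : star (half_cos v) = half_cos v. Proof. exact: star_half_cos. Qed.
Let kb : half_cos v * half_sin v = v. Proof. by have [_ ->] := half_angleP vn v1. Qed.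
Let kk : half_cos v * half_cos v = 1 - star (half_sin v) * half_sin v.
Proof. by have [_ _ ->] := half_angleP vn v1. Qed.
Let rk : full_sec v * (half_cos v * half_cos v - star (half_sin v) * half_sin v) = 1.
Proof. by have [_ _ _ _] := half_angleP vn v1. Qed.

Let c := FL_c lam e g f.
Let d := FL_d lam e g f.

Let ccE : c * c = v.
Proof. by rewrite (FL_cc sW eW kW bW efP kk erefl). Qed.

Lemma F_L_relations : L_relations lam c d.
Proof.
apply: (FL_relations sW eW fW kW bW gW efP ks kk erefl erefl).
rewrite kb (FL_dd sW eW fW kW bW gW efP kk erefl) -[in LHS]F_vE -/l.
by congr (l * (_ - _ * _)); rewrite -[in LHS]kb starM ks.
Qed.

Lemma F_LF_e : LF_e c = e.
Proof. by rewrite /LF_e ccE; apply/esym/(FL_e sW eW kW bW ks erefl rW rk). Qed.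

Lemma F_LF_g : LF_g c d = g.
Proof.
by rewrite /LF_g ccE; apply/esym/(FL_g sW eW fW kW bW gW efP erefl erefl rW rk).
Qed.

Lemma F_LF_f : LF_f c d = f.
Proof. by rewrite /LF_f F_LF_e F_LF_g ccE; apply/esym/(FL_f erefl). Qed.

Lemma FL_mem (S : set A) : cstar_subalgebra S -> S e -> S g -> S f -> S c /\ S d.
Proof.
move=> SP Se Sg Sf.
have Sl : S l by apply: subalg_alg.
have SM := subalgM SP; have SS := subalgS SP; have SB := subalgB SP; have SD := subalgD SP.
have Sden : S (FL_den lam g) by rewrite /FL_den -/l; auto 10.
have Sdi : S di by apply: cinv1B_mem => //; apply: FL_den_lt1.
have Sv : S v by rewrite /v /FL_v -/D -/di -/l; auto 15.
have Sk : S (half_cos v) by apply: half_cos_mem.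
have Sb : S (half_sin v) by apply: half_sin_mem.
by split; rewrite /c /d /FL_c /FL_d -/v; auto 12.
Qed.
End FRelations.

Section LFL.
Variables (R : realType) (A : cstarAlgType R) (lam : R) (c d : A).
Hypothesis lam01 : 0 < lam < 1.
Hypothesis cdP : L_relations lam c d.
Let l : A := (lam%:C)%C%:A.

(** By [L_FfE], [c * c] solves the equation that defines [FL_v]; the solution is unique because
    [1 - FL_den] is invertible. *)
Lemma L_FL_v : FL_v lam (LF_g c d) (LF_f c d) = c * c.
Proof.
have FP := L_F_relations lam01 cdP.
have [d1 d2] := cinv1BP (FL_den_lt1 lam01 FP).
have ffE := L_FfE lam01 cdP.
have vW := L_v_center lam01 cdP.
have uW := L_dd_center lam01 cdP.
pose W := star_gens (bool_gen c d).
have ZP : cstar_subalgebra (relative_center W).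
  exact/relative_center_subalgebra/star_gens_closed.
have gW : relative_center W (LF_g c d).
  apply: (subalgM ZP); last exact: L_del_center cdP.
  by apply: full_sec_mem => //; apply: L_v_lt1 cdP.
have lW : relative_center W l by apply: subalg_alg.
have vE : c * c = l * (d * d) := L_sqr cdP.
have ls : star l = l by apply: star_algr.
rewrite /FL_v ffE.
move: (LF_g c d) gW (FP) d1 => g gW FP' d1.
have gsW := subalgS ZP gW.
set di := cinv _ in d1 *; transitivity (di * (1 - FL_den lam g) * (c * c)); last first.
  by rewrite d1 mul1r.
rewrite -[RHS]mulrA; congr (di * _).
rewrite /FL_den -/l; move: vE vW uW; set v := c * c; move: v (d * d) => v u vE vW uW.
have usW := subalgS ZP uW; have vsW := subalgS ZP vW.
have vsE : star v = l * star u by rewrite vE starM ls; apply: relative_center_comm2 lW usW.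
rewrite starD !starM starK vsE vE.
by ncz (lW, (gW, (gsW, (uW, (usW, tt))))) tt tt.
Qed.

Lemma L_FL_c : FL_c lam (LF_e c) (LF_g c d) (LF_f c d) = c.
Proof. by rewrite /FL_c L_FL_v -(L_FcE lam01 cdP). Qed.

Lemma L_FL_d : FL_d lam (LF_e c) (LF_g c d) (LF_f c d) = d.
Proof. by rewrite /FL_d L_FL_v; apply/esym/LF_d. Qed.

End LFL.

Section LFHom.
Variables (R : realType) (A B : cstarAlgType R) (h : {lrmorphism A -> B}) (c d : A).
Hypotheses (hs : star_hom h) (v1 : cnorm (c * c + c * c) < 1).

Let h1 := star_hom_full_sec hs v1.
Let h2 := star_hom_half_cos hs v1.
Let h3 := star_hom_half_sin hs v1.
Let h4 : h (c * c) = h c * h c := rmorphM h c c.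

Lemma star_hom_LF_e : h (LF_e c) = LF_e (h c).
Proof.
rewrite /LF_e -h4 -h1 -h2 -h3 -hs.
by move: (full_sec _) (half_cos _) (half_sin _) => r k b; rewrite rmorphM rmorphB !rmorphM.
Qed.

Lemma star_hom_LF_g : h (LF_g c d) = LF_g (h c) (h d).
Proof.
rewrite /LF_g -h4 -h1.
by move: (full_sec _) => r; rewrite rmorphM rmorphD !rmorphM.
Qed.

Lemma star_hom_LF_f : h (LF_f c d) = LF_f (h c) (h d).
Proof.
rewrite /LF_f -star_hom_LF_e -star_hom_LF_g -h4 -h2 -h3 -!hs.
move: (LF_e c) (LF_g c d) (half_cos _) (half_sin _) => e g k b.
by rewrite rmorphB rmorphD !rmorphM.
Qed.

End LFHom.

(** * Universal algebras in the range [0 < |y| < 1] *)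

Section Transfer.
Variable R : realType.

Definition L_rel (lam : R) : relations R bool :=
  fun B x => L_relations lam (x true) (x false).

Definition F_rel : relations R (option bool) :=
  fun B x => F_relations (x (Some true)) (x None) (x (Some false)).

Lemma universal_L_F (lam : R) (E : cstarAlgType R) : 0 < lam < 1 ->
  universal_for (L_rel lam) E -> universal_for F_rel E.
Proof.
move=> lam01.
apply: (@universal_transfer _ _ _ _ _
  (fun B x => F_gen (LF_e (x true)) (LF_g (x true) (x false)) (LF_f (x true) (x false)))
  (fun B x => bool_gen (FL_c lam (x (Some true)) (x None) (x (Some false)))
                       (FL_d lam (x (Some true)) (x None) (x (Some false))))).
- by move=> B x xP; apply: L_F_relations xP.
- by move=> B x xP; apply: F_L_relations xP.
- by move=> B x xP [] /=; [apply: L_FL_c|apply: L_FL_d].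
- by move=> B x xP [[]|] /=; [apply: F_LF_e|apply: F_LF_f|apply: F_LF_g].
- move=> A B h x hs xP; have v1 := L_v_lt1 lam01 xP.
  by case=> [[]|] /=; [apply: star_hom_LF_e|apply: star_hom_LF_f|apply: star_hom_LF_g].
- move=> B x S xP SP Sx;
  have [? ?] := FL_mem lam01 xP SP (Sx (Some true)) (Sx None) (Sx (Some false)).
  by case.
Qed.

(* [a = a1] and [b = (y / |y|) a2^*]; then [c], [d] are the normalized [a + b], [a - b]. *)
Record S_relations (r : R) (A : cstarAlgType R) (a b : A) : Prop := {
  S_a : star a * a = 1 - a * star a;
  S_b : star b * b = 1 - b * star b;
  S_ba : b * a = - (a * b);
  S_bsa : star b * a = (r%:C)%C%:A - a * star b }.

Definition S_rel (r : R) : relations R bool :=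
  fun B x => S_relations r (x true) (x false).

Lemma universal_E_S (y : R[i]) (E : cstarAlgType R) : 0 < normc y ->
  universal_for (E_rel y) E -> universal_for (S_rel (normc y)) E.
Proof.
move=> y0; pose r := normc y; pose u : R[i] := y / (r%:C)%C.
have r0 : (r%:C)%C != 0 :> R[i] by rewrite fmorph_eq0 gt_eqF.
have uu : u * u^* = 1.
  rewrite /u rmorphM mulrACA -normCK /= normrCE rmorphV /= ?unitfE// conjC_real.
  by rewrite expr2 -/r mulrACA divff ?mulr1 // .
have yu : y * u^* = (r%:C)%C.
  have -> : y = u * (r%:C)%C by rewrite /u divfK.
  by rewrite mulrAC uu mul1r.
have UU (A : cstarAlgType R) : u%:A * (u^*)%:A = 1 :> A by rewrite alg_mul uu scale1r.
have U'U (A : cstarAlgType R) : (u^*)%:A * u%:A = 1 :> A by rewrite alg_mul mulrC uu scale1r.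
have Us (A : cstarAlgType R) : star (u%:A : A) = (u^*)%:A by rewrite star_alg.
have ur : u * (r%:C)%C = y by rewrite /u divfK.
(* As [u] is unimodular, [b = u star a2] also reads [a2 = u star b]: a single formula serves in both
   directions. *)
have inv (A : cstarAlgType R) (x : A) : u%:A * star (u%:A * star x) = x.
  by rewrite starM starK Us alg_comm mulrA UU mul1r.
apply: (@universal_transfer _ _ _ _ _
  (fun B x => bool_gen (x true) (u%:A * star (x false)))
  (fun B x => bool_gen (x true) (u%:A * star (x false)))).
- move=> B x [r1 r2 r3 r4].
  set a1 := x true in r1 r3 r4; set a2 := x false in r2 r3 r4; set U : B := u%:A.
  have bs : star (U * star a2) = (u^*)%:A * a2 by rewrite starM starK Us alg_comm.
  have e1 := @UU B; have e2 := @U'U B; rewrite -/U in e1 e2; set U' : B := (u^*)%:A in e1 e2 bs.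
  have cU z : z * U = U * z by rewrite alg_comm.
  have cU' z : z * U' = U' * z by rewrite alg_comm.
  split; rewrite /= -/a1 -/a2 -/U ?bs.
  + by rewrite -r1 addrK.
  + have r2' : a2 * star a2 = 1 - star a2 * a2 by rewrite -r2 [X in X - _]addrC addrK.
    by nc (cU a2, (cU' a2, (cU (star a2), (cU' (star a2), (cU' U, (e1, (e2, r2'))))))).
  + have r3' : star a2 * a1 = - (a1 * star a2).
      by have := congr1 star r3; rewrite starM starK starN starM starK.
    by nc (cU a1, r3').
  + have r4' : a2 * a1 = y%:A - a1 * a2 by rewrite -r4 addrAC addrN add0r.
    have e3 : U' * y%:A = (r%:C)%C%:A by rewrite alg_mul mulrC yu.
    by nc (cU' a1, (e3, r4')).
- move=> B x [r1 r2 r3 r4].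
  set a := x true in r1 r3 r4; set b := x false in r2 r3 r4; set U : B := u%:A.
  have bs : star (U * star b) = (u^*)%:A * b by rewrite starM starK Us alg_comm.
  have e1 := @UU B; have e2 := @U'U B; rewrite -/U in e1 e2; set U' : B := (u^*)%:A in e1 e2 bs.
  have cU z : z * U = U * z by rewrite alg_comm.
  have cU' z : z * U' = U' * z by rewrite alg_comm.
  rewrite /E_rel /E_relations /= -/a -/b -/U bs; split.
  + by rewrite r1 subrK.
  + by nc (cU b, (cU' b, (cU (star b), (cU' (star b), (cU' U, (e1, (e2, r2))))))).
  + have r3' : star a * star b = - (star b * star a).
      by have := congr1 star r3; rewrite starM starN starM.
    by nc (cU (star a), r3').
  + have e3 : U * (r%:C)%C%:A = y%:A by rewrite alg_mul ur.
    by nc (cU a, (e3, r4)).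
- by move=> B x xP [] /=; rewrite ?inv.
- by move=> B x xP [] /=; rewrite ?inv.
- move=> A B h x hs xP [] //=.
  by rewrite rmorphM /= hs rmorph_alg.
- move=> B x S xP SP Sx [] //=.
  by apply: (subalgM SP); [apply: (subalg_alg SP)|apply: (subalgS SP)].
Qed.

Lemma universal_S_L (r : R) (E : cstarAlgType R) : 0 < r < 1 ->
  universal_for (S_rel r) E -> universal_for (L_rel ((1 - r) / (1 + r))) E.
Proof.
(* The anticommutators of [a + b] and [a - b] with their adjoints are [2 + 2 r = (2 p) ^ 2] and
   [2 - 2 r = (2 q) ^ 2], so [c = (a + b) / (2 p)] and [d = (a - b) / (2 q)]. Both [a + b] and
   [a - b] have square [a ^ 2 + b ^ 2], hence [lam = q ^ 2 / p ^ 2]. *)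
move=> /andP[r0 r1]; pose p := Num.sqrt ((1 + r) / 2); pose q := Num.sqrt ((1 - r) / 2).
have pp : p * p = (1 + r) / 2 by rewrite -expr2 sqr_sqrtr// divr_ge0//; lra.
have qq : q * q = (1 - r) / 2 by rewrite -expr2 sqr_sqrtr// divr_ge0//; lra.
have p0 : p != 0 by rewrite gt_eqF// sqrtr_gt0 divr_gt0//; lra.
have q0 : q != 0 by rewrite gt_eqF// sqrtr_gt0 divr_gt0//; lra.
pose s (A : cstarAlgType R) (t : R) : A := (t%:C)%C%:A.
have sM (A : cstarAlgType R) t t' : s A t * s A t' = s A (t * t').
  by rewrite /s alg_mul -rmorphM.
have sD (A : cstarAlgType R) t t' : s A t + s A t' = s A (t + t') by rewrite /s alg_realD.
have s1 (A : cstarAlgType R) : s A 1 = 1 by rewrite /s rmorph1 scale1r.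
have ss (A : cstarAlgType R) t : star (s A t) = s A t by apply: star_algr.
have cs (A : cstarAlgType R) t z : z * s A t = s A t * z by apply: alg_comm.
pose pi := (p + p)^-1; pose qi := (q + q)^-1.
have pip : pi * (p + p) = 1 by rewrite /pi mulVf// -mulr2n mulrn_eq0.
have qiq : qi * (q + q) = 1 by rewrite /qi mulVf// -mulr2n mulrn_eq0.
have pi2 : pi * (pi * (1 + 1 + r + r)) = 1.
  have -> : 1 + 1 + r + r = (p + p) * (p + p) by rewrite mulrDl mulrDr pp; lra.
  by rewrite [pi * ((p + p) * _)]mulrA pip mul1r pip.
have qi2 : qi * (qi * (1 + 1 - r - r)) = 1.
  have -> : 1 + 1 - r - r = (q + q) * (q + q) by rewrite mulrDl mulrDr qq; lra.
  by rewrite [qi * ((q + q) * _)]mulrA qiq mul1r qiq.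
pose lam := (1 - r) / (1 + r).
have r1n0 : 1 + r != 0 by rewrite gt_eqF//; lra.
have plam : p * p * lam = q * q by rewrite pp qq /lam; field.
have pqlam : pi * pi = lam * (qi * qi).
  transitivity (pi * pi * (qi * (qi * (1 + 1 - r - r)))); first by rewrite qi2 mulr1.
  have -> : 1 + 1 - r - r = lam * (1 + 1 + r + r) by rewrite /lam; field.
  transitivity (lam * (qi * qi) * (pi * (pi * (1 + 1 + r + r)))); first by ring.
  by rewrite pi2 mulr1.
have ph : p * pi = 2^-1 by move: pip; lra.
have qh : q * qi = 2^-1 by move: qiq; lra.
pose F (B : cstarAlgType R) (x : bool -> B) :=
  bool_gen (s B pi * (x true + x false)) (s B qi * (x true - x false)).
pose G (B : cstarAlgType R) (x : bool -> B) :=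
  bool_gen (s B p * x true + s B q * x false) (s B p * x true - s B q * x false).
apply: (@universal_transfer _ _ _ _ _ F G).
- move=> B x [r1' r2 r3 r4].
  set a := x true in r1' r3 r4; set b := x false in r2 r3 r4.
  have r4' : star a * b = s B r - b * star a.
    by have := congr1 star r4; rewrite starM starK starB starM starK -/(s B r) ss.
  have r3' : star b * star a = - (star a * star b).
    by have := congr1 star r3; rewrite starM starN starM => ->; rewrite opprK.
  rewrite -/(s B r) in r4.
  split; rewrite /F /= -/a -/b ?starM ?starD ?starN ?ss.
  + have e : s B pi * (s B pi * (1 + 1 + s B r + s B r)) = 1.
      by rewrite -(s1 B) !sD !sM pi2 s1.
    transitivity (s B pi * (s B pi * (1 + 1 + s B r + s B r)) -
       s B pi * (a + b) * ((star a + star b) * s B pi)); last by rewrite e.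
    by nc (cs B pi a, (cs B pi b, (cs B pi (star a), (cs B pi (star b), (cs B pi (s B r), (r1',
      (r2, (r4, r4')))))))).
  + have e : s B qi * (s B qi * (1 + 1 - s B r - s B r)) = 1.
      have sN t : - s B t = s B (- t) by rewrite /s rmorphN scaleNr.
      by rewrite -(s1 B) sN !sD !sM qi2 s1.
    transitivity (s B qi * (s B qi * (1 + 1 - s B r - s B r)) -
       s B qi * (a - b) * ((star a - star b) * s B qi)); last by rewrite e.
    by nc (cs B qi a, (cs B qi b, (cs B qi (star a), (cs B qi (star b), (cs B qi (s B r), (r1',
      (r2, (r4, r4')))))))).
  + by nc (cs B pi a, (cs B pi b, (cs B pi (star a), (cs B pi (star b), (cs B qi a, (cs B qi b,
       (cs B qi (star a), (cs B qi (star b), (cs B pi (s B qi), (r1', (r2, (r4, r4')))))))))))).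
  + have e : s B pi * s B pi = s B lam * (s B qi * s B qi) by rewrite !sM pqlam.
    rewrite -/lam -/(s B lam).
    by nc (cs B pi a, (cs B pi b, (cs B qi a, (cs B qi b, (e, r3))))).
- move=> B x [r1' r2 r3 r4]; set c := x true in r1' r3 r4; set d := x false in r2 r3 r4.
  have r3' : star d * c = - (c * star d).
    by have := congr1 star r3; rewrite starM starK starN starM starK => ->; rewrite opprK.
  rewrite -/lam -/(s B lam) in r4.
  have pq1 : s B p * s B p = 1 - s B q * s B q.
    rewrite -(s1 B) !sM pp qq /s -scalerBl -rmorphB; congr (_%:C%:A)%C; lra.
  have pql : s B p * s B p * s B lam = s B q * s B q by rewrite !sM plam.
  split; rewrite /G /= -/c -/d ?starD ?starN ?starM ?ss.
  + by nc (cs B p c, (cs B p d, (cs B p (star c), (cs B p (star d), (cs B q c, (cs B q d,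
       (cs B q (star c), (cs B q (star d), (cs B p (s B q), (r1', (r2, (r3, (r3',
         pq1))))))))))))).
  + by nc (cs B p c, (cs B p d, (cs B p (star c), (cs B p (star d), (cs B q c, (cs B q d,
       (cs B q (star c), (cs B q (star d), (cs B p (s B q), (r1', (r2, (r3, (r3',
         pq1))))))))))))).
  + by nc (cs B p c, (cs B p d, (cs B q c, (cs B q d, (cs B p (s B q), (cs B p (s B lam), (r4,
    pql))))))).
  + have -> : (r%:C)%C%:A = s B p * s B p - s B q * s B q.
      rewrite !sM pp qq /s -scalerBl -rmorphB; congr (_%:C%:A)%C; lra.
    by nc (cs B p c, (cs B p d, (cs B p (star c), (cs B p (star d), (cs B q c, (cs B q d,
       (cs B q (star c), (cs B q (star d), (cs B p (s B q), (r1', (r2, (r3, r3')))))))))))).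
- move=> B x _; set h := s B 2^-1.
  have hh z : h * z + h * z = z.
    by rewrite -mulrDl sD (_ : 2^-1 + 2^-1 = 1 :> R) ?s1 ?mul1r//; lra.
  have e1 : s B p * s B pi = h by rewrite sM ph.
  have e2 : s B q * s B qi = h by rewrite sM qh.
  by case; rewrite /G /F /= -[RHS]hh; nc (e1, e2).
- move=> B x _.
  have e1 z : s B pi * (s B p * z + s B p * z) = z by rewrite -mulrDl mulrA sD sM pip s1 mul1r.
  have e2 z : s B qi * (s B q * z + s B q * z) = z by rewrite -mulrDl mulrA sD sM qiq s1 mul1r.
  by case; rewrite /F /G /=; [rewrite -[RHS]e1|rewrite -[RHS]e2]; nc tt.
- move=> A B h x hs xP; have hS t : h (s A t) = s B t by rewrite /s rmorph_alg.
  case; rewrite /F /bool_gen rmorphM /= hS; first by rewrite rmorphD.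
  by rewrite rmorphB.
- move=> B x S xP SP Sx.
  by case; rewrite /G /=; [apply: (subalgD SP)|apply: (subalgB SP)];
    apply: (subalgM SP) => //; apply: (subalg_alg SP).
Qed.

Lemma universal_E_F (y : R[i]) (E : cstarAlgType R) : 0 < normc y < 1 ->
  universal_for (E_rel y) E -> universal_for F_rel E.
Proof.
move=> /[dup] y01 /andP[y0 y1] /(universal_E_S y0) /(universal_S_L y01).
by apply: universal_L_F; rewrite divr_gt0 ?subr_gt0 ?addr_gt0//= ltr_pdivrMr ?addr_gt0// mul1r;
  lra.
Qed.

End Transfer.

(** * The case [|y| = 1] *)

Section UnitModulus.
Variable R : realType.

Record U_relations (A : cstarAlgType R) (e : A) : Prop := {
  U_e : e * e = 0;
  U_eS : star e * e = 1 - e * star e }.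

Definition U_rel : relations R unit := fun B x => U_relations (x tt).

(** For [x = a2 - y star a1] the relations give [star x * x + x * star x = 1 - |y| ^ 2], which
    vanishes here. *)
Lemma E_unit_adjoint (y : R[i]) (A : cstarAlgType R) (a1 a2 : A) : normc y = 1 ->
  E_relations y a1 a2 -> a2 = y%:A * star a1.
Proof.
move=> y1 [r1 r2 r3 r4].
have yy : y * y^* = 1 by rewrite -normCK normrCE y1 rmorph1 expr1n.
set Y : A := y%:A; set Y' : A := (y^*)%:A.
have YY : Y * Y' = 1 by rewrite alg_mul yy scale1r.
have Ys : star Y = Y' by rewrite star_alg.
have cY z : z * Y = Y * z by rewrite alg_comm.
have cY' z : z * Y' = Y' * z by rewrite alg_comm.
have r1' : star a1 * a1 = 1 - a1 * star a1 by rewrite -r1 addrK.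
have r2' : star a2 * a2 = 1 - a2 * star a2 by rewrite -r2 addrK.
have r4' : a2 * a1 = Y - a1 * a2 by rewrite /Y -r4 addrAC addrN add0r.
have r5' : star a1 * star a2 = Y' - star a2 * star a1.
  by have := congr1 star r4'; rewrite starM starB starM Ys.
apply/eqP; rewrite -subr_eq0; apply/eqP/anticomm_eq0.
rewrite starB starM starK Ys.
nc (cY a1, (cY (star a1), (cY a2, (cY (star a2), (cY' a1, (cY' (star a1), (cY' a2,
   (cY' (star a2), (cY Y', (YY, (r1', (r2', (r4', r5'))))))))))))).
Qed.

Lemma universal_E_U (y : R[i]) (E : cstarAlgType R) : normc y = 1 ->
  universal_for (E_rel y) E -> universal_for U_rel E.
Proof.
move=> y1; have yy : y * y^* = 1 by rewrite -normCK normrCE y1 rmorph1 expr1n.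
apply: (@universal_transfer _ _ _ _ _ (fun B x => fun _ : unit => x true)
  (fun B x => bool_gen (x tt) (y%:A * star (x tt)))).
- move=> B x xP; have e := E_unit_adjoint y1 xP; have [r1 r2 r3 r4] := xP; split => /=.
    (* Since [a2] is a nonzero multiple of [star a1], the third relation makes [star a1] anticommute
       with itself. *)
    rewrite e in r3; set z := x true in r3 *.
    set Y : B := y%:A in r3; set Y' : B := (y^*)%:A.
    have YY : Y' * Y = 1 by rewrite alg_mul mulrC yy scale1r.
    have cY w : w * Y = Y * w by rewrite alg_comm.
    have h : Y * (star z * star z) = - (Y * (star z * star z)).
      transitivity (star z * (Y * star z)); first by nc (cY (star z), tt).
      by rewrite r3 mulrA.
    have : star z * star z + star z * star z = 0.
      transitivity (Y' * (Y * (star z * star z) + Y * (star z * star z))); first by nc YY.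
      by rewrite {1}h addNr mulr0.
    rewrite -starM => /(congr1 (fun w => ((2^-1 : R)%:C)%C *: w)).
    by rewrite scale_half_add scaler0 => /(congr1 star); rewrite starK star0.
  by rewrite -r1 addrK.
- move=> B x [r1 r2]; rewrite /E_rel /E_relations /=.
  set e := x tt in r1 r2 *; set Y : B := y%:A; set Y' : B := (y^*)%:A.
  have YY : Y * Y' = 1 by rewrite alg_mul yy scale1r.
  have Ys : star Y = Y' by rewrite star_alg.
  have cY z : z * Y = Y * z by rewrite alg_comm.
  have cY' z : z * Y' = Y' * z by rewrite alg_comm.
  have r1' : star e * star e = 0 by rewrite -starM r1 star0.
  rewrite starM starK Ys; split.
  + by rewrite r2 subrK.
  + by nc (cY e, (cY (star e), (cY' e, (cY' (star e), (cY Y', (YY, r2)))))).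
  + by nc (cY (star e), r1').
  + by nc (cY e, (cY (star e), r2)).
- by move=> B x xP [] //=; apply/esym/(E_unit_adjoint y1 xP).
- by move=> B x xP [].
- by [].
- move=> B x S xP SP Sx [] //=.
  by apply: (subalgM SP); [apply: (subalg_alg SP)|apply: (subalgS SP)].
Qed.

Lemma normr_normc (y : R[i]) (r : R) :
  [/\ (`|y| == (r%:C)%C) = (normc y == r), (`|y| < (r%:C)%C) = (normc y < r) &
      ((r%:C)%C < `|y|) = (r < normc y)].
Proof. by rewrite normrCE (inj_eq (@complexI _)) !ltcR. Qed.

Lemma E_isomorphic (y1 y2 : R[i]) :
     ((0 < `|y1| /\ `|y1| < 1) /\ (0 < `|y2| /\ `|y2| < 1)) \/
     (`|y1| = 1 /\ `|y2| = 1) ->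
   forall E1 E2 : cstarAlgType R,
     is_E y1 E1 -> is_E y2 E2 -> cstar_isomorphic E1 E2.
Proof.
have H (y : R[i]) : (0 < `|y| /\ `|y| < 1) -> 0 < normc y < 1.
  have [_ _ h0] := normr_normc y 0; have [_ h1 _] := normr_normc y 1.
  have -> : (0 < `|y|) = (0 < normc y) := h0.
  by have -> : (`|y| < 1) = (normc y < 1) := h1; move=> [-> ->].
have H1 (y : R[i]) : `|y| = 1 -> normc y = 1.
  by move=> yn; have [+ _ _] := normr_normc y 1; rewrite yn eqxx => /esym/eqP.
move=> [[/H h1 /H h2]|[/H1 h1 /H1 h2]] E1 E2 /is_E_universal e1 /is_E_universal e2.
  by apply: (universal_iso (universal_E_F h1 e1) (universal_E_F h2 e2)).
by apply: (universal_iso (universal_E_U h1 e1) (universal_E_U h2 e2)).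
Qed.

End UnitModulus.

(** * Matrix algebras *)

Section HilbertNorm.
Variable R : realType.
Local Notation C := R[i].

Lemma normc_ge0 (z : C) : 0 <= normc z.
Proof. by case: z => a b; apply: sqrtr_ge0. Qed.

Lemma normcD_le (z w : C) : normc (z + w) <= normc z + normc w.
Proof. exact: le_normcD. Qed.

Lemma normc_sqr (z : C) : normc z ^+ 2 = complex.Re z ^+ 2 + complex.Im z ^+ 2.
Proof. by case: z => a b; rewrite /= sqr_sqrtr// addr_ge0 ?sqr_ge0. Qed.

Lemma normc_le_parts (z : C) : normc z <= `|complex.Re z| + `|complex.Im z|.
Proof.
rewrite -(@ler_pXn2r _ 2) ?nnegrE ?normc_ge0 ?addr_ge0// normc_sqr.
by rewrite sqrrD !real_normK ?num_real// -addrA lerD2l lerDr mulrn_wge0// mulr_ge0.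
Qed.

Lemma normc_sum (I : Type) (s : seq I) (F : I -> C) :
  normc (\sum_(i <- s) F i) <= \sum_(i <- s) normc (F i).
Proof.
elim: s => [|i s IH]; first by rewrite !big_nil ComplexField.Normc.normc0.
by rewrite !big_cons; apply: le_trans (normcD_le _ _) _; rewrite lerD2l.
Qed.

Lemma sum_sqr_le (I : Type) (s : seq I) (F : I -> R) : (forall i, 0 <= F i) ->
  \sum_(i <- s) F i ^+ 2 <= (\sum_(i <- s) F i) ^+ 2.
Proof.
move=> F0; elim: s => [|i s IH]; first by rewrite !big_nil expr0n.
rewrite !big_cons sqrrD; have := F0 i; have : 0 <= \sum_(j <- s) F j by apply: sumr_ge0.
move: (\sum_(j <- s) F j) IH => x IH x0 y0; have := mulr_ge0 y0 x0; lra.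
Qed.

Definition cvnorm n (v : 'cV[C]_n) : R := Num.sqrt (\sum_i normc (v i 0) ^+ 2).

(** The real part of the inner product is enough: it determines the norm, and it moves a matrix to
    its adjoint, which is all that the C*-identity uses. *)
Definition cvdot n (u v : 'cV[C]_n) : R :=
  complex.Re (\sum_i (u i 0)^* * v i 0).

Section Vec.
Variable n : nat.
Implicit Types (u v w : 'cV[C]_n).

Lemma cvnorm_ge0 v : 0 <= cvnorm v. Proof. exact: sqrtr_ge0. Qed.

Lemma cvnorm_sqr v : cvnorm v ^+ 2 = \sum_i normc (v i 0) ^+ 2.
Proof. by rewrite sqr_sqrtr// sumr_ge0// => i _; rewrite sqr_ge0. Qed.

Lemma Re_sum (F : 'I_n -> C) : complex.Re (\sum_i F i) = \sum_i complex.Re (F i).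
Proof. by apply: (big_morph (@complex.Re R)) => // -[a b] [c d]. Qed.

Lemma cvdotE u v : cvdot u v =
  \sum_i (complex.Re (u i 0) * complex.Re (v i 0) + complex.Im (u i 0) * complex.Im (v i 0)).
Proof.
rewrite /cvdot Re_sum; apply: eq_bigr => i _.
by case: (u i 0) (v i 0) => [a b] [c d] /=; rewrite mulNr opprK.
Qed.

Lemma cvdotvv v : cvdot v v = cvnorm v ^+ 2.
Proof. by rewrite cvdotE cvnorm_sqr; apply: eq_bigr => i _; rewrite normc_sqr !expr2. Qed.

Lemma cvdot_le u v : cvdot u v <= cvnorm u * cvnorm v.
Proof.
have u0 := cvnorm_ge0 u; have v0 := cvnorm_ge0 v.
have H s : 0 < s -> 2 * cvdot u v <= s * cvnorm u ^+ 2 + s^-1 * cvnorm v ^+ 2.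
  move=> s0; rewrite cvdotE !cvnorm_sqr !mulr_sumr -big_split /=; apply: ler_sum => i _.
  rewrite !normc_sqr; case: (u i 0) (v i 0) => [a b] [c d] /=.
  have E x y : s * x ^+ 2 + s^-1 * y ^+ 2 - 2 * (x * y) = s^-1 * (s * x - y) ^+ 2.
    by field; rewrite gt_eqF.
  have F x y : 0 <= s * x ^+ 2 + s^-1 * y ^+ 2 - 2 * (x * y).
    by rewrite E mulr_ge0 ?sqr_ge0// invr_ge0 ltW.
  have := F a c; have := F b d; lra.
apply/ler_addgt0Pr => e e0.
(* The optimal weight would be [cvnorm v / cvnorm u]; shifting both norms by [t] covers zero vectors
   and costs [t * (cvnorm u + cvnorm v)], at most [e]. *)
pose t := e / (cvnorm u + cvnorm v + 1).
have t0 : 0 < t by rewrite divr_gt0//; lra.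
have te : t * (cvnorm u + cvnorm v) <= e.
  by rewrite /t mulrAC ler_pdivrMr; [rewrite ler_pM2l//; lra|lra].
have := H ((cvnorm v + t) / (cvnorm u + t)).
have ut : 0 < cvnorm u + t by lra.
have vt : 0 < cvnorm v + t by lra.
move=> /(_ (divr_gt0 vt ut)); rewrite invf_div.
have h1 : (cvnorm v + t) / (cvnorm u + t) * cvnorm u ^+ 2 <= (cvnorm v + t) * cvnorm u.
  by rewrite mulrAC ler_pdivrMr// -mulrA ler_pM2l// expr2 ler_wpM2l// lerDl ltW.
have h2 : (cvnorm u + t) / (cvnorm v + t) * cvnorm v ^+ 2 <= (cvnorm u + t) * cvnorm v.
  by rewrite mulrAC ler_pdivrMr// -mulrA ler_pM2l// expr2 ler_wpM2l// lerDl ltW.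
move=> h3; nra.
Qed.

Lemma cvnormD u v : cvnorm (u + v) <= cvnorm u + cvnorm v.
Proof.
have u0 := cvnorm_ge0 u; have v0 := cvnorm_ge0 v.
rewrite -(@ler_pXn2r _ 2) ?nnegrE ?cvnorm_ge0 ?addr_ge0//.
have -> : cvnorm (u + v) ^+ 2 = cvnorm u ^+ 2 + cvnorm v ^+ 2 + 2 * cvdot u v.
  rewrite -!cvdotvv !cvdotE mulr_sumr -!big_split /=; apply: eq_bigr => i _.
  by rewrite mxE; case: (u i 0) (v i 0) => [a b] [c d] /=; ring.
have := cvdot_le u v; nra.
Qed.

Lemma cvnormZ c v : cvnorm (c *: v) = normc c * cvnorm v.
Proof.
rewrite /cvnorm -[normc c]ger0_norm ?normc_ge0// -sqrtr_sqr -sqrtrM ?sqr_ge0//.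
congr Num.sqrt; rewrite mulr_sumr; apply: eq_bigr => i _.
by rewrite mxE ComplexField.Normc.normcM exprMn.
Qed.

Lemma cvnorm_entry v i : normc (v i 0) <= cvnorm v.
Proof.
rewrite -(@ler_pXn2r _ 2) ?nnegrE ?cvnorm_ge0 ?normc_ge0// cvnorm_sqr (bigD1 i)//=.
by rewrite lerDl sumr_ge0// => j _; rewrite sqr_ge0.
Qed.

Lemma cvnorm_le_sum v : cvnorm v <= \sum_i normc (v i 0).
Proof.
rewrite -(@ler_pXn2r _ 2) ?nnegrE ?cvnorm_ge0 ?sumr_ge0// => [|i _]; last exact: normc_ge0.
by rewrite cvnorm_sqr; apply: sum_sqr_le => i; apply: normc_ge0.
Qed.

Lemma cvnorm0_eq0 v : cvnorm v = 0 -> v = 0.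
Proof.
move=> v0; apply/colP => i; rewrite [RHS]mxE; apply: ComplexField.Normc.eq0_normc.
by apply/eqP; rewrite eq_le normc_ge0 andbT -v0 cvnorm_entry.
Qed.

Lemma cvnorm0 : cvnorm (0 : 'cV[C]_n) = 0.
Proof. by rewrite -(scale0r 0) cvnormZ ComplexField.Normc.normc0 mul0r. Qed.

End Vec.
End HilbertNorm.

(** * The C*-norm on matrices *)

Section OperatorNorm.
Variable R : realType.
Local Notation C := R[i].
Variable n : nat.
Implicit Types (A B : 'M[C]_n.+1) (v : 'cV[C]_n.+1).

Definition adjmx A : 'M[C]_n.+1 := map_mx Num.conj A^T.

Definition opnorm A : R := sup [set r | exists2 v, cvnorm v <= 1 & r = cvnorm (A *m v)].

Lemma mulmx_bound A v : cvnorm (A *m v) <= (\sum_i \sum_j normc (A i j)) * cvnorm v.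
Proof.
apply: le_trans (cvnorm_le_sum _) _; rewrite mulr_suml; apply: ler_sum => i _.
rewrite mxE; apply: le_trans (normc_sum _ _) _; rewrite mulr_suml; apply: ler_sum => j _.
by rewrite ComplexField.Normc.normcM ler_wpM2l ?normc_ge0// cvnorm_entry.
Qed.

Lemma opnorm_has_sup A :
  has_sup [set r | exists2 v, cvnorm v <= 1 & r = cvnorm (A *m v)].
Proof.
split; first by exists (cvnorm (A *m 0)); exists 0; rewrite // cvnorm0.
exists (\sum_i \sum_j normc (A i j)) => _ [v v1 ->].
apply: le_trans (mulmx_bound _ _) _; rewrite -[leRHS]mulr1 ler_wpM2l//.
by apply: sumr_ge0 => i _; apply: sumr_ge0 => j _; apply: normc_ge0.
Qed.

Lemma opnorm_ge0 A : 0 <= opnorm A.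
Proof.
apply: (@ub_le_sup _ [set r | exists2 v, cvnorm v <= 1 & r = cvnorm (A *m v)]).
  by case: (opnorm_has_sup A).
by exists 0; rewrite ?mulmx0 ?cvnorm0.
Qed.

Lemma opnormP A v : cvnorm (A *m v) <= opnorm A * cvnorm v.
Proof.
have [->|/eqP v0] := eqVneq v 0; first by rewrite mulmx0 cvnorm0 mulr0.
have N0 : 0 < cvnorm v.
  by rewrite lt_neqAle cvnorm_ge0 andbT eq_sym; apply/eqP => /cvnorm0_eq0.
rewrite -ler_pdivrMr//; apply: ub_le_sup; first by case: (opnorm_has_sup A).
exists ((((cvnorm v)^-1)%:C)%C *: v).
  by rewrite cvnormZ normc_real gtr0_norm ?invr_gt0// mulVf// gt_eqF.
by rewrite -scalemxAr cvnormZ normc_real gtr0_norm ?invr_gt0// mulrC.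
Qed.

Lemma opnorm_le A (M : R) : 0 <= M -> (forall v, cvnorm (A *m v) <= M * cvnorm v) ->
  opnorm A <= M.
Proof.
move=> M0 H; apply: ge_sup; first by case: (opnorm_has_sup A).
by move=> _ [v v1 ->]; apply: le_trans (H v) _; rewrite -[leRHS]mulr1 ler_wpM2l.
Qed.

Lemma opnorm_le_sum A : opnorm A <= \sum_i \sum_j normc (A i j).
Proof.
apply: opnorm_le (mulmx_bound A).
by apply: sumr_ge0 => i _; apply: sumr_ge0 => j _; apply: normc_ge0.
Qed.

Lemma opnorm_entry A i j : normc (A i j) <= opnorm A.
Proof.
have e1 : cvnorm (delta_mx j 0 : 'cV[C]_n.+1) = 1.
  rewrite /cvnorm (bigD1 j)//= big1 ?addr0 => [|k kj]; rewrite mxE.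
    by rewrite !eqxx ComplexField.Normc.normc1 expr1n sqrtr1.
  by rewrite (negPf kj) ComplexField.Normc.normc0 expr0n.
have := opnormP A (delta_mx j 0); rewrite e1 mulr1; apply: le_trans.
have -> : A i j = (A *m (delta_mx j 0 : 'cV_n.+1)) i 0 by rewrite -colE mxE.
exact: cvnorm_entry.
Qed.

Lemma adjmxK : involutive adjmx.
Proof. by move=> A; apply/matrixP => i j; rewrite !mxE conjCK. Qed.

Lemma adjmxD A B : adjmx (A + B) = adjmx A + adjmx B.
Proof. by apply/matrixP => i j; rewrite !mxE rmorphD. Qed.

Lemma adjmxZ c A : adjmx (c *: A) = c^* *: adjmx A.
Proof. by apply/matrixP => i j; rewrite !mxE rmorphM. Qed.

Lemma adjmxM A B : adjmx (A * B) = adjmx B * adjmx A.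
Proof.
apply/matrixP => i j; rewrite !mxE rmorph_sum; apply: eq_bigr => k _.
by rewrite !mxE rmorphM mulrC.
Qed.

Lemma cvdot_adj A u v : cvdot u (A *m v) = cvdot (adjmx A *m u) v.
Proof.
congr complex.Re.
under eq_bigr do rewrite mxE mulr_sumr.
under [RHS]eq_bigr do rewrite mxE rmorph_sum mulr_suml.
rewrite exchange_big; apply: eq_bigr => j _; apply: eq_bigr => i _.
by rewrite !mxE rmorphM /= conjCK mulrA [_^* * A i j]mulrC.
Qed.

Lemma opnorm_eq0 A : opnorm A = 0 -> A = 0.
Proof.
move=> A0; apply/matrixP => i j; rewrite [RHS]mxE; apply: ComplexField.Normc.eq0_normc.
by apply/eqP; rewrite eq_le normc_ge0 andbT -A0 opnorm_entry.
Qed.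

Lemma opnormD A B : opnorm (A + B) <= opnorm A + opnorm B.
Proof.
apply: opnorm_le => [|v]; first by rewrite addr_ge0 ?opnorm_ge0.
rewrite mulmxDl mulrDl; apply: le_trans (cvnormD _ _) _.
by apply: lerD; apply: opnormP.
Qed.

Lemma opnormZ_le c A : opnorm (c *: A) <= normc c * opnorm A.
Proof.
apply: opnorm_le => [|v]; first by rewrite mulr_ge0 ?opnorm_ge0 ?normc_ge0.
by rewrite -scalemxAl cvnormZ -mulrA ler_wpM2l ?normc_ge0 ?opnormP.
Qed.

Lemma opnormZ c A : opnorm (c *: A) = normc c * opnorm A.
Proof.
apply/eqP; rewrite eq_le opnormZ_le /=.
have [->|c0] := eqVneq c 0; first by rewrite ComplexField.Normc.normc0 mul0r opnorm_ge0.
have nc0 : 0 < normc c.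
  rewrite lt_neqAle normc_ge0 andbT eq_sym.
  by apply: contra_neq c0; apply: ComplexField.Normc.eq0_normc.
rewrite -ler_pdivlMl// -ComplexField.Normc.normcV.
by apply: le_trans (opnormZ_le _ _); rewrite scalerA mulVf// scale1r.
Qed.

Lemma opnormM A B : opnorm (A * B) <= opnorm A * opnorm B.
Proof.
apply: opnorm_le => [|v]; first by rewrite mulr_ge0 ?opnorm_ge0.
rewrite -[A * B]/(A *m B) -mulmxA -mulrA; apply: le_trans (opnormP _ _) _.
by rewrite ler_wpM2l ?opnorm_ge0 ?opnormP.
Qed.

Lemma opnorm_sqr_le A : opnorm A ^+ 2 <= opnorm (adjmx A * A).
Proof.
have s0 := opnorm_ge0 (adjmx A * A).
rewrite -[leRHS]sqr_sqrtr// ler_pXn2r ?nnegrE ?opnorm_ge0 ?sqrtr_ge0//.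
apply: opnorm_le => [|v]; first exact: sqrtr_ge0.
rewrite -(@ler_pXn2r _ 2) ?nnegrE ?cvnorm_ge0 ?mulr_ge0 ?sqrtr_ge0 ?cvnorm_ge0//.
rewrite exprMn (sqr_sqrtr s0) -cvdotvv cvdot_adj mulmxA expr2 mulrA.
apply: le_trans (cvdot_le _ _) _.
by rewrite ler_wpM2r ?cvnorm_ge0 ?opnormP.
Qed.

Lemma opnorm_adj A : opnorm (adjmx A) = opnorm A.
Proof.
have H B : opnorm B <= opnorm (adjmx B).
  have [->|B0] := eqVneq (opnorm B) 0; first exact: opnorm_ge0.
  have B1 : 0 < opnorm B by rewrite lt_neqAle opnorm_ge0 andbT eq_sym.
  by rewrite -(ler_pM2r B1) -expr2; apply: le_trans (opnorm_sqr_le _) (opnormM _ _).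
by apply/eqP; rewrite eq_le H andbT -{2}(adjmxK A) H.
Qed.

Lemma opnorm_star A : opnorm (adjmx A * A) = opnorm A ^+ 2.
Proof.
apply/eqP; rewrite eq_le opnorm_sqr_le andbT expr2.
by apply: le_trans (opnormM _ _) _; rewrite opnorm_adj.
Qed.

Lemma real_cauchy (u : nat -> R) :
  (forall e, 0 < e -> exists k, forall m p, (k <= m)%N -> (k <= p)%N -> `|u m - u p| < e) ->
  exists l, forall e, 0 < e -> exists k, forall m, (k <= m)%N -> `|u m - l| < e.
Proof.
move=> H; have uc : cvg (u @ \oo).
  apply/cauchy_cvgP/cauchy_exP => e e0; have [k kP] := H e e0.
  by exists (u k), k => // m /= km; apply: kP.
exists (lim (u @ \oo)) => e e0; move/cvgrPdist_lt : uc => /(_ e e0) [k _ kP].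
by exists k => m km; rewrite distrC; apply: kP.
Qed.

Lemma complex_cauchy (u : nat -> C) :
  (forall e : R, 0 < e -> exists k, forall m p,
    (k <= m)%N -> (k <= p)%N -> normc (u m - u p) < e) ->
  exists l, forall e : R, 0 < e -> exists k, forall m, (k <= m)%N -> normc (u m - l) < e.
Proof.
have ReN z : `|complex.Re z| <= normc z :> R.
  by case: z => a b /=; rewrite -[`|a|]sqrtr_sqr ler_wsqrtr// lerDl sqr_ge0.
have ImN z : `|complex.Im z| <= normc z :> R.
  by case: z => a b /=; rewrite -[`|b|]sqrtr_sqr ler_wsqrtr// lerDr sqr_ge0.
move=> H.
have [a aP] : exists l, forall e, 0 < e -> exists k, forall m,
  (k <= m)%N -> `|complex.Re (u m) - l| < e.
  apply: real_cauchy => e /H[k kP]; exists k => m p km kp.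
  by apply: le_lt_trans (kP _ _ km kp); apply: le_trans (ReN _); case: (u m) (u p) => ? ? [].
have [b bP] : exists l, forall e, 0 < e -> exists k, forall m,
  (k <= m)%N -> `|complex.Im (u m) - l| < e.
  apply: real_cauchy => e /H[k kP]; exists k => m p km kp.
  by apply: le_lt_trans (kP _ _ km kp); apply: le_trans (ImN _); case: (u m) (u p) => ? ? [].
exists (a +i* b)%C => e e0; have e2 : 0 < e / 2 by rewrite divr_gt0.
have [k1 h1] := aP _ e2; have [k2 h2] := bP _ e2; exists (maxn k1 k2) => m.
rewrite geq_max => /andP[/h1 {}h1 /h2 {}h2]; apply: le_lt_trans (normc_le_parts _) _.
by move: h1 h2; case: (u m) => x y /=; lra.
Qed.

Lemma opnorm_complete (u : nat -> 'M[C]_n.+1) :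
  norm_cauchy opnorm u -> exists l, norm_cvg opnorm u l.
Proof.
move=> H.
have /choice[l lP] : forall ij : 'I_n.+1 * 'I_n.+1, exists z : C, forall e : R, 0 < e ->
    exists k, forall m, (k <= m)%N -> normc (u m ij.1 ij.2 - z) < e.
  move=> [i j]; apply: complex_cauchy => e /H[k kP]; exists k => m p km kp.
  apply: le_lt_trans (kP _ _ km kp).
  by have := opnorm_entry (u m - u p) i j; rewrite !mxE.
exists (\matrix_(i, j) l (i, j)); apply/cvgrPdist_lt => e e0.
pose d := e / (n.+1%:R * n.+1%:R + 1).
have N0 : 0 < (n.+1%:R * n.+1%:R + 1 : R) by rewrite ltr_wpDl// mulr_ge0.
have d0 : 0 < d by rewrite divr_gt0.
have /choice[K KP] : forall ij, exists k, forall m,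
  (k <= m)%N -> normc (u m ij.1 ij.2 - l ij) < d.
  by move=> ij; apply: lP.
exists (\max_ij K ij)%N => // m /= mK; rewrite sub0r normrN ger0_norm ?opnorm_ge0//.
apply: le_lt_trans (opnorm_le_sum _) _.
apply: (@le_lt_trans _ _ (\sum_(i < n.+1) \sum_(j < n.+1) d)).
  apply: ler_sum => i _; apply: ler_sum => j _; rewrite !mxE ltW//; apply: (KP (i, j)).
  by apply: leq_trans mK; apply: leq_bigmax.
rewrite !sumr_const !card_ord -mulrnA -mulr_natl natrM /d mulrCA.
rewrite -[ltRHS]mulr1 ltr_pM2l// ltr_pdivrMr// mul1r ltrDl//.
Qed.

HB.instance Definition _ := isCStarAlgebra.Build R 'M[C]_n.+1
  adjmxK adjmxD adjmxZ adjmxM opnorm_eq0 opnormD opnormZ opnormM opnorm_star opnorm_complete.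

End OperatorNorm.

(** * Two-dimensional representations *)

Section TwoByTwo.
Variable F : fieldType.

(** Two such matrices commute iff their vectors [(X 0 1, X 1 0, X 0 0 - X 1 1)] are parallel. The
    vector of a nonscalar [A] is nonzero, so those of [B] and [D] are both multiples of it. This
    replaces general facts on irreducible representations. *)
Lemma mx2_centralizer (A B D : 'M[F]_2) : (forall c, A != c%:M) ->
  A * B = B * A -> A * D = D * A -> B * D = D * B.
Proof.
have mul2 (X Y : 'M[F]_2) i j : (X * Y) i j = X i 0 * Y 0 j + X i 1 * Y 1 j.
  rewrite -[X * Y]/(X *m Y) mxE !big_ord_recl big_ord0 addr0.
  by do 2?[congr (_ + _)]; congr (X _ _ * Y _ _); apply/val_inj.
have comm (X Y : 'M[F]_2) : X * Y = Y * X <-> [/\ X 0 1 * Y 1 0 = Y 0 1 * X 1 0,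
   (X 0 0 - X 1 1) * Y 0 1 = X 0 1 * (Y 0 0 - Y 1 1) &
   (X 0 0 - X 1 1) * Y 1 0 = X 1 0 * (Y 0 0 - Y 1 1)].
  split=> [e|[e1 e2 e3]].
    have e' i j := congr1 (fun Z : 'M[F]_2 => Z i j) e.
    have := e' 0 0; have := e' 0 1; have := e' 1 0; rewrite !mul2 => h1 h2 h3; split.
    - by apply: (addrI (X 0 0 * Y 0 0)); rewrite h3; ring.
    - apply/eqP; rewrite -subr_eq0; apply/eqP.
      transitivity ((X 0 0 * Y 0 1 + X 0 1 * Y 1 1) - (Y 0 0 * X 0 1 + Y 0 1 * X 1 1));
        first by ring.
      by rewrite h2 subrr.
    - apply/eqP; rewrite -subr_eq0; apply/eqP.
      transitivity ((Y 1 0 * X 0 0 + Y 1 1 * X 1 0) - (X 1 0 * Y 0 0 + X 1 1 * Y 1 0));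
        first by ring.
      by rewrite h1 subrr.
  apply/matrixP => i j; rewrite !mul2.
  have i01 (k : 'I_2) : k = 0 \/ k = 1 by case: k => [[|[|//]] k2]; [left|right]; apply/val_inj.
  case: (i01 i) (i01 j) => -> [] ->.
  - by rewrite e1; ring.
  - apply/eqP; rewrite -subr_eq0; apply/eqP.
    transitivity ((X 0 0 - X 1 1) * Y 0 1 - X 0 1 * (Y 0 0 - Y 1 1)); first by ring.
    by rewrite e2 subrr.
  - apply/eqP; rewrite -subr_eq0; apply/eqP.
    transitivity (X 1 0 * (Y 0 0 - Y 1 1) - (X 0 0 - X 1 1) * Y 1 0); first by ring.
    by rewrite e3 subrr.
  - transitivity (X 1 1 * Y 1 1 + Y 0 1 * X 1 0); first by ring.
    by rewrite -e1; ring.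
move=> Ac /comm[b1 b2 b3] /comm[d1 d2 d3]; apply/comm.
have : (A 0 1 != 0) || (A 1 0 != 0) || (A 0 0 - A 1 1 != 0).
  apply/negPn/negP; rewrite !negb_or !negbK => /andP[/andP[/eqP x0 /eqP y0] /eqP z0].
  have /negP := Ac (A 0 0); apply; apply/eqP/matrixP => i j; rewrite mxE.
  have i01 (k : 'I_2) : k = 0 \/ k = 1 by case: k => [[|[|//]] k2]; [left|right]; apply/val_inj.
  by case: (i01 i) (i01 j) => -> [] -> //=; move/eqP: z0; rewrite subr_eq0 => /eqP.
move: b1 b2 b3 d1 d2 d3.
move: (A 0 1) (A 1 0) (A 0 0 - A 1 1) (B 0 1) (B 1 0) (B 0 0 - B 1 1) (D 0 1) (D 1 0) (D 0 0 -
  D 1 1).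
move=> a b c x y z x' y' z' b1 b2 b3 d1 d2 d3 abc.
have par p q r : a * q = p * b -> c * p = a * r -> c * q = b * r ->
    exists k, [/\ p = k * a, q = k * b & r = k * c].
  move=> h1 h2 h3; move: abc => /orP[/orP[k0|k0]|k0].
  - exists (p / a); split; apply: (mulfI k0).
    + by field.
    + by rewrite h1; field.
    + by rewrite -h2; field.
  - exists (q / b); split; apply: (mulfI k0).
    + by rewrite mulrC -h1; field.
    + by field.
    + by rewrite -h3; field.
  - exists (r / c); split; apply: (mulfI k0).
    + by rewrite h2; field.
    + by rewrite h3; field.
    + by field.
have [k [-> -> ->]] := par x y z b1 b2 b3.
have [k' [-> -> ->]] := par x' y' z' d1 d2 d3.
by split; ring.
Qed.
End TwoByTwo.

Section CStarScalars.
Variables (R : realType) (A : cstarAlgType R).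

Lemma alg_inj : injective (fun c : R[i] => c%:A : A).
Proof.
move=> c c' /eqP; rewrite -subr_eq0 -scalerBl => /eqP h.
have := cnorm_alg A (c - c'); rewrite h cnorm0 => /esym/ComplexField.Normc.eq0_normc/eqP.
by rewrite subr_eq0 => /eqP.
Qed.

Lemma star_mul_eq0 (x : A) : star x * x = 0 -> x = 0.
Proof.
move=> x0; apply: cnorm_eq0; apply/eqP; rewrite -sqrf_eq0 -cnorm_star x0.
by rewrite cnorm0.
Qed.

Lemma alg_normc (c : R[i]) : c%:A * star (c%:A) = ((normc c ^+ 2)%:C)%C%:A :> A.
Proof. by rewrite star_alg alg_mul -normCK normrCE -rmorphXn. Qed.

Lemma normc1_sqr (c : R[i]) : normc c ^+ 2 = 1 -> normc c = 1.
Proof.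
move/eqP; rewrite sqrf_eq1 => /orP[/eqP //|/eqP c1].
by have := normc_ge0 c; rewrite c1 oppr_ge0 ler10.
Qed.

Lemma U_proj_neq0 (e : A) : U_relations e -> e * star e != 0.
Proof.
move=> [ee ees]; apply/eqP => e0.
have es0 : star e = 0 by apply: star_mul_eq0; rewrite starK.
by move: ees; rewrite es0 mul0r mulr0 subr0 => /esym/eqP; rewrite oner_eq0.
Qed.

(** The matrix diag(1, -1) in the matrix units of [e]. It anticommutes with [e] and [star e], so
    multiplying by it turns anticommutation with them into commutation. *)
Definition sigma_of (e : A) : A := e * star e - star e * e.

Lemma sigma_facts (e : A) : U_relations e ->
  [/\ sigma_of e * sigma_of e = 1, star (sigma_of e) = sigma_of e,
      sigma_of e * e = - (e * sigma_of e) &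
      sigma_of e * star e = - (star e * sigma_of e)].
Proof.
move=> [ee ees]; have eses : star e * star e = 0 by rewrite -starM ee star0.
split; rewrite /sigma_of.
- by nc (ee, (eses, ees)).
- by rewrite starB !starM !starK.
- by nc (ee, (eses, ees)).
- by nc (ee, (eses, ees)).
Qed.

Lemma F_U (e g f : A) : F_relations e g f -> U_relations e.
Proof. by move=> P; split; [apply: F_e P|apply: F_eS P]. Qed.

Lemma F_point (e : A) (g s : R[i]) : U_relations e ->
  normc g ^+ 2 + (normc s ^+ 2 + normc s ^+ 2) = 1 ->
  F_relations e g%:A (s%:A * sigma_of e).
Proof.
move=> eP gs; have [ww ws we wes] := sigma_facts eP.
have [ee ees] := eP; move: (sigma_of e) ww ws we wes => w ww ws we wes.
set G : A := g%:A; set S : A := s%:A.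
have cG z : z * G = G * z by apply: alg_comm.
have cGs z : z * star G = star G * z by rewrite star_alg alg_comm.
have cS z : z * S = S * z by apply: alg_comm.
have cSs z : z * star S = star S * z by rewrite star_alg alg_comm.
have GS : 1 - G * star G = S * star S + S * star S.
  rewrite !alg_normc -alg_realD.
  have -> : normc s ^+ 2 + normc s ^+ 2 = 1 - normc g ^+ 2 by lra.
  by rewrite rmorphB scalerBl rmorph1 scale1r.
split => //.
- by nc (cS e, we).
- by nc (cS (star e), wes).
- rewrite starM ws GS.
  by nc (cS w, (cSs w, (cSs S, ww))).
Qed.

Lemma E0_sqr_comm (a1 a2 : A) : E_relations 0 a1 a2 ->
  [/\ a1 * a1 * star a1 = star a1 * (a1 * a1), a1 * a1 * a2 = a2 * (a1 * a1),
      a2 * a2 * star a2 = star a2 * (a2 * a2) & a2 * a2 * a1 = a1 * (a2 * a2)].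
Proof.
move=> [r1 r2 r3 r4].
have r1' : star a1 * a1 = 1 - a1 * star a1 by rewrite -r1 addrK.
have r2' : star a2 * a2 = 1 - a2 * star a2 by rewrite -r2 addrK.
have r4' : a1 * a2 = - (a2 * a1) by apply/eqP; rewrite -addr_eq0 r4 scale0r.
by split; [nc r1'|nc r4'|nc r2'|nc r4'].
Qed.

End CStarScalars.

Section TwoDimReps.
Variable R : realType.
Local Notation M := 'M[R[i]]_2.
Implicit Types (e X T : M).

Lemma mx2_scalar (c : R[i]) : c%:M = c%:A :> M.
Proof. by rewrite -scalemx1. Qed.

(** If [X] were not scalar, [mx2_centralizer] would make [e] commute with its adjoint, and then [e =
    e * (star e * e) = star e * (e * e) = 0]. *)
Lemma U_schur e X : U_relations e -> X * e = e * X -> X * star e = star e * X ->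
  exists c : R[i], X = c%:A.
Proof.
move=> eP Xe Xes; have [[c ->]|nX] := pselect (exists c : R[i], X = c%:A); first by exists c.
exfalso; have [ee ees] := eP.
have e_es : e * star e = star e * e.
  apply: (@mx2_centralizer _ X) => // c; apply/eqP => Xc; apply: nX; exists c.
  by rewrite Xc mx2_scalar.
have e0 : e = 0.
  have : e * (star e * e) = 0 by rewrite -e_es mulrA ee mul0r.
  by rewrite ees mulrBr mulr1 mulrA ee mul0r subr0.
by have /eqP := U_proj_neq0 eP; apply; rewrite e0 mul0r.
Qed.

Lemma mx_prime (P Q : M) : P != 0 -> Q != 0 -> exists X : M, P * X * Q != 0.
Proof.
move=> /matrix0Pn[i [k Pik]] /matrix0Pn[l [j Qlj]]; exists (delta_mx k l).
apply/matrix0Pn; exists i, j.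
have -> : (P * delta_mx k l * Q) i j = P i k * Q l j; last by rewrite mulf_neq0.
rewrite -[_ * _ * _]/(P *m delta_mx k l *m Q) mxE (bigD1 l)//= big1 ?addr0.
  rewrite mxE (bigD1 k)//= big1 ?addr0 ?mxE ?eqxx ?mulr1// => m mk.
  by rewrite mxE (negPf mk) mulr0.
move=> m ml; rewrite mxE big1 ?mul0r// => m' _.
by rewrite mxE (negPf ml) andbF mulr0.
Qed.

(** [T] is the sum over [i] of [E i 1 * X * F 1 i], for the matrix units [E] of [e2] and [F] of
    [e1]; [X] is chosen so that the corner of [T] does not vanish. *)
Lemma U_intertwiner e1 e2 : U_relations e1 -> U_relations e2 ->
  exists T : M, [/\ T != 0, T * e1 = e2 * T & T * star e1 = star e2 * T].
Proof.
move=> P1 P2; have [X X0] := mx_prime (U_proj_neq0 P2) (U_proj_neq0 P1).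
have [ee1 ees1] := P1; have [ee2 ees2] := P2.
have eses1 : star e1 * star e1 = 0 by rewrite -starM ee1 star0.
have eses2 : star e2 * star e2 = 0 by rewrite -starM ee2 star0.
pose T := e2 * star e2 * X * e1 * star e1 + star e2 * X * e1.
exists T; split.
- apply: contra_neq X0 => T0.
  have : e2 * star e2 * T = 0 by rewrite T0 mulr0.
  by move=> <-; rewrite /T; nc (ee1, (ee2, (eses1, (eses2, (ees1, ees2))))).
- by rewrite /T; nc (ee1, (ee2, (eses1, (eses2, (ees1, ees2))))).
- by rewrite /T; nc (ee1, (ee2, (eses1, (eses2, (ees1, ees2))))).
Qed.

Lemma intertwine_scalar (T : M) (c c' : R[i]) : T != 0 -> T * c%:A = c'%:A * T -> c = c'.
Proof.
move=> T0 /eqP; rewrite alg_comm -subr_eq0 -mulrBl -scalerBl mulr_algl scaler_eq0 (negPf T0) orbF.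
by rewrite subr_eq0 => /eqP.
Qed.

(** [g] and [sigma_of e * f] commute with [e] and [star e], so [U_schur] makes them scalars. The
    relation of [f] then becomes the equation of the sphere. *)
Lemma F_M2 e (g f : M) : F_relations e g f -> exists g0 s : R[i],
  [/\ g = g0%:A, f = s%:A * sigma_of e &
      normc g0 ^+ 2 + (normc s ^+ 2 + normc s ^+ 2) = 1].
Proof.
move=> P; have eP := F_U P; have [ww ws we wes] := sigma_facts eP.
have [ee ees fe fes ff eg egs fg fgs gg] := P.
have gE : g * star e = star e * g.
  by have := congr1 star egs; rewrite !starM !starK.
have [g0 g0E] := U_schur eP (esym eg) gE.
have [s sE] : exists s : R[i], sigma_of e * f = s%:A.
  by apply: U_schur eP _ _; [nc (fe, we)|nc (fes, wes)].
have fE : f = s%:A * sigma_of e.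
  by rewrite -alg_comm -sE mulrA ww mul1r.
exists g0, s; split => //; move: ff; rewrite {1 2 3 4}fE g0E.
move: (sigma_of e) ww ws {we wes sE fE} => w ww ws.
set S : M := s%:A; set G : M := g0%:A => h.
have cS z : z * S = S * z by apply: alg_comm.
have cSs z : z * star S = star S * z by rewrite star_alg alg_comm.
have : 1 - G * star G = S * star S + S * star S.
  have : star S * S + S * star S = 1 - G * star G.
    move: h; rewrite starM ws => h.
    transitivity (w * star S * (S * w) + S * w * (w * star S)).
      by nc (cS w, (cSs w, ww)).
    by rewrite h subrK.
  by move=> <-; nc (cS (star S), tt).
rewrite !alg_normc -alg_realD (_ : 1 - _ = ((1 - normc g0 ^+ 2)%:C)%C%:A).
  by move=> /alg_inj/complexI; lra.
by rewrite rmorphB scalerBl rmorph1 scale1r.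
Qed.

(** The modulus of [z] measures how far [a] is from normal: at modulus one the selfadjoint
    commutator has square zero, hence vanishes. *)
Lemma E0_commutator_sqr (A : cstarAlgType R) (a : A) (z : R[i]) :
  star a * a + a * star a = 1 -> a * a + a * a = z%:A ->
  (star a * a - a * star a) * (star a * a - a * star a) = ((1 - normc z ^+ 2)%:C)%C%:A.
Proof.
move=> r1 az; have r1' : star a * a = 1 - a * star a by rewrite -r1 addrK.
have -> : ((1 - normc z ^+ 2)%:C)%C%:A = 1 - star (a * a + a * a) * (a * a + a * a) :> A.
  rewrite az star_alg -alg_comm -star_alg alg_normc rmorphB scalerBl rmorph1 scale1r.
  by [].
by rewrite starD starM; nc r1'.
Qed.

Lemma E0_sa_adjoint (A : cstarAlgType R) (a : A) (z : R[i]) :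
  star a * a + a * star a = 1 -> a * a + a * a = z%:A -> normc z = 1 ->
  star a = (z^*)%:A * a.
Proof.
move=> r1 az z1; have := E0_commutator_sqr r1 az; rewrite z1 expr1n subrr rmorph0 scale0r => k0.
have k1 : star a * a = a * star a.
  apply/eqP; rewrite -subr_eq0; apply/eqP/star_mul_eq0.
  by rewrite starB !starM starK.
have zz : (z^*)%:A * z%:A = 1 :> A by rewrite alg_mul mulrC -normCK normrCE z1 rmorph1 expr1n
  scale1r.
have e : star a * (a * a + a * a) = a.
  transitivity (star a * a * a + a * star a * a); last by rewrite -mulrDl r1 mul1r.
  by nc k1.
by rewrite -[in RHS]e az alg_comm mulrA zz mul1r.
Qed.

(* Both [a1] and [a2] are unimodular multiples of selfadjoint elements, which
   anticommute: a single system of matrix units carries them. *)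
Lemma E0_unit_clifford (A : cstarAlgType R) (z1 z2 : R[i]) : normc z1 = 1 -> normc z2 = 1 ->
  exists c1 c2 k1 k2 : R[i], forall a1 a2 : A, E_relations 0 a1 a2 ->
    a1 * a1 + a1 * a1 = z1%:A -> a2 * a2 + a2 * a2 = z2%:A ->
  let e := k1%:A * a1 + k2%:A * a2 in
  [/\ U_relations e, a1 = c1%:A * (e + star e) & a2 = c2%:A * (e - star e)].
Proof.
move=> z1n z2n; pose n1 := sqrtC z1; pose n2 := sqrtC z2.
have nn (z : R[i]) : normc z = 1 -> sqrtC z * (sqrtC z)^* = 1.
  move=> zn; rewrite -normCK; have : `|sqrtC z ^+ 2| = 1.
    by rewrite sqrtCK normrCE zn rmorph1.
  by rewrite normrX.
have nn1 : n1 * n1^* = 1 := nn _ z1n; have nn2 : n2 * n2^* = 1 := nn _ z2n.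
pose h : R := (Num.sqrt 2)^-1.
have hh : h * h + h * h = 1.
  have s2 : Num.sqrt 2 * Num.sqrt 2 = 2 :> R by rewrite -expr2 sqr_sqrtr.
  by rewrite -invfM s2; lra.
(* With [n1], [n2] square roots of [z1], [z2] and [h ^ 2 = 1 / 2], the elements [a1 / (n1 h)] and
   [a2 / (n2 h)] are anticommuting selfadjoint unitaries [p] and [q], and [e = (p + i q) / 2]. The
   constants depend on [z1] and [z2] only. *)
exists (n1 * (h%:C)%C), (- ('i%C * n2 * (h%:C)%C)), ((h%:C)%C * n1^*), ((h%:C)%C * ('i%C * n2^*)).
move=> a1 a2 [r1 r2 r3 r4] z1E z2E e.
have a1s := E0_sa_adjoint r1 z1E z1n; have a2s := E0_sa_adjoint r2 z2E z2n.
have r4' : a2 * a1 = - (a1 * a2) by apply/eqP; rewrite -addr_eq0 addrC r4 scale0r.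
pose H : A := (h%:C)%C%:A; pose N1 : A := n1%:A; pose N2 : A := n2%:A.
pose M1 : A := (n1^*)%:A; pose M2 : A := (n2^*)%:A; pose I : A := 'i%C%:A.
have HH : H * H + H * H = 1 by rewrite /H !alg_mul -rmorphM -alg_realD hh rmorph1 scale1r.
have II : I * I = -1 by rewrite alg_mul mul_ii scaleN1r.
have NM1 : N1 * M1 = 1 by rewrite alg_mul nn1 scale1r.
have NM2 : N2 * M2 = 1 by rewrite alg_mul nn2 scale1r.
have eE : e = H * (M1 * a1 + I * (M2 * a2)).
  by rewrite /e -!alg_mul mulrDr !mulrA.
have z1n1 : (z1^*)%:A = M1 * M1 :> A by rewrite alg_mul -rmorphM -expr2 sqrtCK.
have z2n2 : (z2^*)%:A = M2 * M2 :> A by rewrite alg_mul -rmorphM -expr2 sqrtCK.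
have z1N : z1%:A = N1 * N1 :> A by rewrite alg_mul -expr2 sqrtCK.
have z2N : z2%:A = N2 * N2 :> A by rewrite alg_mul -expr2 sqrtCK.
rewrite z1n1 in a1s; rewrite z2n2 in a2s; rewrite z1N in z1E; rewrite z2N in z2E.
have cH z : z * H = H * z by apply: alg_comm.
have cN1 z : z * N1 = N1 * z by apply: alg_comm.
have cN2 z : z * N2 = N2 * z by apply: alg_comm.
have cM1 z : z * M1 = M1 * z by apply: alg_comm.
have cM2 z : z * M2 = M2 * z by apply: alg_comm.
have cI z : z * I = I * z by apply: alg_comm.
have Hs : star H = H by apply: star_algr.
have Is : star I = - I by rewrite star_alg conjc_i scaleNr.
have M1s : star M1 = N1 by rewrite star_alg conjCK.
have M2s : star M2 = N2 by rewrite star_alg conjCK.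
have sq1 : a1 * a1 = H * H * (N1 * N1).
  transitivity ((H * H + H * H) * (a1 * a1)); first by rewrite HH mul1r.
  by rewrite -z1E; nc tt.
have sq2 : a2 * a2 = H * H * (N2 * N2).
  transitivity ((H * H + H * H) * (a2 * a2)); first by rewrite HH mul1r.
  by rewrite -z2E; nc tt.
have esE : star e = H * (M1 * a1 - I * (M2 * a2)).
  rewrite eE starM starD !starM Hs Is M1s M2s a1s a2s.
  by nc (cH I, (cH N1, (cH N2, (cH M1, (cH M2, (cH a1, (cH a2, (cI N1, (cI N2, (cI M1, (cI M2, (cI
     a1, (cI a2, (cN1 N2, (cN1 M1, (cN1 M2, (cN1 a1, (cN1 a2, (cN2 M1, (cN2 M2, (cN2 a1, (cN2
     a2, (cM1 M2, (cM1 a1, (cM1 a2, (cM2 a1, (cM2 a2, (NM1, NM2)))))))))))))))))))))))))))).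
split.
- split; rewrite ?esE eE.
    by nc (cH I, (cH N1, (cH N2, (cH M1, (cH M2, (cH a1, (cH a2, (cI N1, (cI N2, (cI M1,
      (cI M2, (cI
     a1, (cI a2, (cN1 N2, (cN1 M1, (cN1 M2, (cN1 a1, (cN1 a2, (cN2 M1, (cN2 M2, (cN2 a1, (cN2
     a2, (cM1 M2, (cM1 a1, (cM1 a2, (cM2 a1, (cM2 a2, (NM1, (NM2, (II, (r4', (sq1,
     sq2)))))))))))))))))))))))))))))))).
  transitivity ((H * H + H * H) * (H * H + H * H) - H * (M1 * a1 + I * (M2 * a2)) * (H * (M1 *
    a1 - I * (M2 * a2)))); last by rewrite HH mulr1.
  by nc (cH I, (cH N1, (cH N2, (cH M1, (cH M2, (cH a1, (cH a2, (cI N1, (cI N2, (cI M1, (cI M2, (cI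
     a1, (cI a2, (cN1 N2, (cN1 M1, (cN1 M2, (cN1 a1, (cN1 a2, (cN2 M1, (cN2 M2, (cN2 a1, (cN2
     a2, (cM1 M2, (cM1 a1, (cM1 a2, (cM2 a1, (cM2 a2, (NM1, (NM2, (II, (r4', (sq1,
     sq2)))))))))))))))))))))))))))))))).
- rewrite esE eE -alg_mul -/N1 -/H; transitivity ((H * H + H * H) * a1);
  first by rewrite HH mul1r.
  by nc (cH I, (cH N1, (cH N2, (cH M1, (cH M2, (cH a1, (cH a2, (cI N1, (cI N2, (cI M1, (cI M2, (cI
     a1, (cI a2, (cN1 N2, (cN1 M1, (cN1 M2, (cN1 a1, (cN1 a2, (cN2 M1, (cN2 M2, (cN2 a1, (cN2
     a2, (cM1 M2, (cM1 a1, (cM1 a2, (cM2 a1, (cM2 a2, (NM1, (NM2, (II, (r4', (sq1,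
     sq2)))))))))))))))))))))))))))))))).
- rewrite esE eE scaleNr -!alg_mul -/N2 -/H -/I; transitivity ((H * H + H * H) * a2);
  first by rewrite HH mul1r.
  by nc (cH I, (cH N1, (cH N2, (cH M1, (cH M2, (cH a1, (cH a2, (cI N1, (cI N2, (cI M1, (cI M2, (cI
     a1, (cI a2, (cN1 N2, (cN1 M1, (cN1 M2, (cN1 a1, (cN1 a2, (cN2 M1, (cN2 M2, (cN2 a1, (cN2
     a2, (cM1 M2, (cM1 a1, (cM1 a2, (cM2 a1, (cM2 a2, (NM1, (NM2, (II, (r4', (sq1,
     sq2)))))))))))))))))))))))))))))))).
Qed.

Lemma E0_M2_unique (a1 a2 b1 b2 : M) (z1 z2 : R[i]) : E_relations 0 a1 a2 ->
  E_relations 0 b1 b2 -> normc z1 = 1 -> normc z2 = 1 ->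
  a1 * a1 + a1 * a1 = z1%:A -> a2 * a2 + a2 * a2 = z2%:A ->
  b1 * b1 + b1 * b1 = z1%:A -> b2 * b2 + b2 * b2 = z2%:A ->
  exists T : M, [/\ T != 0, T * a1 = b1 * T, T * a2 = b2 * T,
    T * star a1 = star b1 * T & T * star a2 = star b2 * T].
Proof.
move=> ra rb z1n z2n a1z a2z b1z b2z.
have [c1 [c2 [k1 [k2 H]]]] := E0_unit_clifford M z1n z2n.
have [eU a1E a2E] := H _ _ ra a1z a2z; have [fU b1E b2E] := H _ _ rb b1z b2z.
have a1s := E0_sa_adjoint (let: And4 x _ _ _ := ra in x) a1z z1n.
have a2s := E0_sa_adjoint (let: And4 _ x _ _ := ra in x) a2z z2n.
have b1s := E0_sa_adjoint (let: And4 x _ _ _ := rb in x) b1z z1n.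
have b2s := E0_sa_adjoint (let: And4 _ x _ _ := rb in x) b2z z2n.
move: eU a1E a2E fU b1E b2E; set e := _ + _; set f := (k1%:A * b1 + k2%:A * b2).
move=> eU a1E a2E fU b1E b2E.
have [T [T0 Te Tes]] := U_intertwiner eU fU; exists T.
have T1 : T * a1 = b1 * T.
  by rewrite a1E b1E mulrA alg_comm -!mulrA mulrDr mulrDl Te Tes.
have T2 : T * a2 = b2 * T.
  by rewrite a2E b2E mulrA alg_comm -!mulrA mulrBr mulrBl Te Tes.
split => //.
- by rewrite a1s b1s mulrA alg_comm -!mulrA T1.
- by rewrite a2s b2s mulrA alg_comm -!mulrA T2.
Qed.

(** If [z1] does not have modulus one, the commutator [k1] of [star a1] and [a1] is not scalar: it
    anticommutes with [a1] and has nonzero square. As it commutes with [a2] and [star a2], these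
    commute with each other by [mx2_centralizer], and the previous identity for [a2] gives modulus
    one. *)
Lemma E0_M2_modulus (a1 a2 : M) (z1 z2 : R[i]) : E_relations 0 a1 a2 ->
  a1 * a1 + a1 * a1 = z1%:A -> a2 * a2 + a2 * a2 = z2%:A ->
  normc z1 = 1 \/ normc z2 = 1.
Proof.
move=> [r1 r2 r3 r4] z1E z2E.
have k1E := E0_commutator_sqr r1 z1E; have k2E := E0_commutator_sqr r2 z2E.
set k1 := star a1 * a1 - a1 * star a1 in k1E.
have r1' : star a1 * a1 = 1 - a1 * star a1 by rewrite -r1 addrK.
have r3' : star a2 * a1 = - (a1 * star a2).
  by have := congr1 star r3; rewrite starM starK starN starM starK.
have r4' : a2 * a1 = - (a1 * a2) by apply/eqP; rewrite -addr_eq0 addrC r4 scale0r.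
have r3'' : a2 * star a1 = - (star a1 * a2) by rewrite r3 opprK.
have r4'' : star a2 * star a1 = - (star a1 * star a2).
  by rewrite -!starM -starN r4' opprK.
have [h|nk1] := eqVneq (1 - normc z1 ^+ 2) 0.
  by left; apply: normc1_sqr; lra.
right; apply: normc1_sqr.
have k1a1 : k1 * a1 = - (a1 * k1) by rewrite /k1; nc r1'.
have k1a2 : k1 * a2 = a2 * k1 by rewrite /k1; nc (r4', r3'').
have k1a2s : k1 * star a2 = star a2 * k1 by rewrite /k1; nc (r3', r4'').
have nsc c : k1 != c%:M.
  apply/eqP => k1c; rewrite mx2_scalar in k1c.
  have : (c *: a1) + (c *: a1) = 0.
    have := k1a1; rewrite k1c alg_comm mulr_algl => h; rewrite {1}h addNr.
    by [].
  rewrite -scalerDl => /eqP; rewrite scaler_eq0 => /orP[|/eqP a10].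
    rewrite -mulr2n mulrn_eq0 /= => /eqP c0; move: k1E; rewrite k1c c0 scale0r mulr0.
    move=> /esym/eqP; rewrite scaler_eq0 oner_eq0 orbF fmorph_eq0 (negPf nk1); by [].
  by move: r1; rewrite a10 star0 !mulr0 addr0 => /esym/eqP; rewrite oner_eq0.
have a2n := mx2_centralizer nsc k1a2 k1a2s.
move: k2E; rewrite a2n subrr mulr0 => /esym/eqP.
by rewrite scaler_eq0 oner_eq0 orbF fmorph_eq0 subr_eq0 => /eqP/esym.
Qed.

End TwoDimReps.

(** * Central characters of opposite points *)

Section FamilyContinuity.
Variables (R : realType) (I : finType) (A B : cstarAlgType R) (a : I -> A).
Variables (pi : R -> {lrmorphism A -> B}) (t0 : R).
Hypotheses (ga : generated_by a) (pis : forall t, star_hom (pi t)).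

Let cts (x : A) := forall e : R, 0 < e -> exists2 d : R, 0 < d &
  forall t, `|t - t0| < d -> cnorm (pi t x - pi t0 x) < e.

(** The elements at which the family is continuous form a C*-subalgebra; it is closed because all
    the homomorphisms are contractions, uniformly in [t]. *)
Lemma star_hom_family_continuous : (forall i, cts (a i)) -> forall x, cts x.
Proof.
move=> H x; have ST : cstar_subalgebra cts.
  split.
  - apply: norm_closedP => l Hl e e0.
    have e4 : 0 < e / 4 by rewrite divr_gt0.
    have [z /(_ _ e4)[d d0 dP] zl] := Hl _ e4; exists d => // t /dP td.
    apply: le_lt_trans (cdist_triangle _ (pi t z) _) _.
    have := cdist_triangle (pi t z) (pi t0 z) (pi t0 l).
    have := star_hom_contract (pis t) (l - z); have := star_hom_contract (pis t0) (z - l).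
    by rewrite !rmorphB /= (cdistC l); lra.
  - by move=> e e0; exists 1 => // t _; rewrite !rmorph1 subrr cnorm0.
  - move=> c y z Hy Hz e e0; have c0 := normc_ge0 c.
    have e1 : 0 < e / 2 by rewrite divr_gt0.
    have e2 : 0 < e / 2 / (normc c + 1) by rewrite divr_gt0//; lra.
    have [d1 d10 h1] := Hy _ e2; have [d2 d20 h2] := Hz _ e1.
    exists (Num.min d1 d2); first by rewrite lt_min d10.
    move=> t; rewrite lt_min => /andP[/h1 {}h1 /h2 {}h2].
    have -> : pi t (c *: y + z) - pi t0 (c *: y + z) =
      c *: (pi t y - pi t0 y) + (pi t z - pi t0 z).
      by rewrite !rmorphD /= !linearZ /= scalerBr opprD addrACA.
    apply: le_lt_trans (cnormD _ _) _; rewrite cnormZ.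
    have : normc c * cnorm (pi t y - pi t0 y) <= (normc c + 1) * (e / 2 / (normc c + 1)).
      apply: ler_pM => //; [exact: cnorm_ge0|lra|exact: ltW].
    rewrite [(normc c + 1) * _]mulrC divfK; last by rewrite gt_eqF//; lra.
    lra.
  - move=> y z Hy Hz e e0; have y0 := cnorm_ge0 y; have z0 := cnorm_ge0 z.
    have e1 : 0 < e / 2 / (cnorm y + cnorm z + 1) by rewrite divr_gt0 ?divr_gt0//; lra.
    have [d1 d10 h1] := Hy _ e1; have [d2 d20 h2] := Hz _ e1.
    exists (Num.min d1 d2); first by rewrite lt_min d10.
    move=> t; rewrite lt_min => /andP[/h1 {}h1 /h2 {}h2].
    have -> : pi t (y * z) - pi t0 (y * z) =
      (pi t y - pi t0 y) * pi t z + pi t0 y * (pi t z - pi t0 z).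
      by rewrite !rmorphM mulrBl mulrBr addrA subrK.
    apply: le_lt_trans (cnormD _ _) _.
    have := cnormM (pi t y - pi t0 y) (pi t z); have := cnormM (pi t0 y) (pi t z - pi t0 z).
    have := star_hom_contract (pis t) z; have := star_hom_contract (pis t0) y.
    move: h1 h2; set k := e / 2 / _.
    have kE : k * (cnorm y + cnorm z + 1) = e / 2 by rewrite /k divfK// gt_eqF//; lra.
    move=> h1 h2 h3 h4 h5 h6; have k0 : 0 < k by [].
    have := ler_pM (cnorm_ge0 _) (cnorm_ge0 _) (ltW h1) h4.
    have := ler_pM (cnorm_ge0 _) (cnorm_ge0 _) h3 (ltW h2).
    lra.
  - move=> y Hy e e0; have [d d0 h] := Hy _ e0; exists d => // t /h.
    by rewrite !pis -starB cnorm_starE.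
have := ga ST H; move=> ctsT.
by have : [set: A] x by []; rewrite -ctsT.
Qed.

End FamilyContinuity.

(** * Deformation of direct sums in dimension four *)

Section FourDim.
Variable R : realType.
Local Notation C := R[i].
Local Notation M2 := 'M[C]_2.
Local Notation M4 := 'M[C]_4.

(** With explicit dimensions, [2 + 2] computes to [4], so that block matrices live in the C*-algebra
    of 4 by 4 matrices. *)
Definition blk (a b c d : M2) : M4 := @block_mx C 2 2 2 2 a b c d.

Lemma blkM a b c d a' b' c' d' : blk a b c d * blk a' b' c' d' =
  blk (a * a' + b * c') (a * b' + b * d') (c * a' + d * c') (c * b' + d * d').
Proof. exact: (@mulmx_block C 2 2 2 2 2 2). Qed.

Lemma blkD a b c d a' b' c' d' : blk a b c d + blk a' b' c' d' =
  blk (a + a') (b + b') (c + c') (d + d').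
Proof. exact: (@add_block_mx C 2 2 2 2). Qed.

Lemma blkN a b c d : - blk a b c d = blk (- a) (- b) (- c) (- d).
Proof. exact: (@opp_block_mx C 2 2 2 2). Qed.

Lemma blkZ k a b c d : k *: blk a b c d = blk (k *: a) (k *: b) (k *: c) (k *: d).
Proof. exact: (@scale_block_mx C 2 2 2 2). Qed.

Lemma blk0 : blk 0 0 0 0 = 0.
Proof. exact: (@block_mx0 C 2 2 2 2). Qed.

Lemma blk1 : blk 1 0 0 1 = 1.
Proof. by apply/esym/(@scalar_mx_block C 2 2 1). Qed.

Lemma blk_star a b c d : star (blk a b c d) = blk (star a) (star c) (star b) (star d).
Proof.
rewrite /star /= /adjmx /blk (@tr_block_mx C 2 2 2 2).
exact: (@map_block_mx _ _ Num.conj 2 2 2 2).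
Qed.

Lemma blk_inj a b c d a' b' c' d' : blk a b c d = blk a' b' c' d' ->
  [/\ a = a', b = b', c = c' & d = d'].
Proof. exact: (@eq_block_mx C 2 2 2 2). Qed.

Lemma blk_eta (X : M4) : exists a b c d, X = blk a b c d.
Proof.
by do 4!eexists; apply/esym/(@submxK C 2 2 2 2 X).
Qed.

End FourDim.

Section DirectSum.
Variables (R : realType) (A : cstarAlgType R) (p m : {lrmorphism A -> 'M[R[i]]_2}).

Lemma direct_sum_hom : star_hom p -> star_hom m ->
  exists h : {lrmorphism A -> 'M[R[i]]_4}, star_hom h /\ forall x, h x = blk (p x) 0 0 (m x).
Proof.
move=> ps ms; pose g x := blk (p x) 0 0 (m x).
have gD : semilinear g.
  split=> [c x|x y]; rewrite /g; first by rewrite !linearZ /= blkZ !scaler0.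
  by rewrite !rmorphD /= blkD !addr0.
have gM : monoid_morphism g.
  split=> [|x y]; rewrite /g; first by rewrite !rmorph1 blk1.
  by rewrite !rmorphM /= blkM !mulr0 !mul0r !addr0 !add0r.
pose m1 := GRing.isSemilinear.Build R[i] A 'M[R[i]]_4 _ g gD.
pose m2 := GRing.isMonoidMorphism.Build A 'M[R[i]]_4 g gM.
pose h : {lrmorphism A -> 'M[R[i]]_4} := HB.pack g m1 m2.
exists h; split => // x.
by rewrite [LHS]/(g (star x)) [h x]/(g x) /g blk_star ps ms !star0.
Qed.

End DirectSum.

Section RationalCircle.
Variable R : realType.
Implicit Types t : R.

(** Rational parametrization of the unit circle, starting at the point with coordinates 1 and 0. *)
Definition circle_x t := (1 - t ^+ 2) / (1 + t ^+ 2).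
Definition circle_y t := (t + t) / (1 + t ^+ 2).

Lemma circle_den_gt0 t : 0 < 1 + t ^+ 2.
Proof. by rewrite ltr_pwDl// sqr_ge0. Qed.

Lemma circle_xy t : circle_x t * circle_x t + circle_y t * circle_y t = 1.
Proof. by rewrite /circle_x /circle_y; field; rewrite gt_eqF// circle_den_gt0. Qed.

Lemma circle_x0 : circle_x 0 = 1.
Proof. by rewrite /circle_x expr0n /= subr0 addr0 divr1. Qed.

Lemma circle_y0 : circle_y 0 = 0.
Proof. by rewrite /circle_y addr0 mul0r. Qed.

Lemma circle_x_gt0 t : 0 < t < 1 -> 0 < circle_x t.
Proof.
move=> /andP[t0 t1]; rewrite divr_gt0 ?circle_den_gt0// subr_gt0 expr2; nra.
Qed.

Lemma circle_y_gt0 t : 0 < t -> 0 < circle_y t.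
Proof. by move=> t0; rewrite divr_gt0 ?circle_den_gt0// addr_gt0. Qed.

Lemma circle_x_dist t : `|circle_x t - 1| <= 2 * `|t|.
Proof.
have D := circle_den_gt0 t; have T0 : 0 <= `|t| by [].
have t2 : t ^+ 2 = `|t| ^+ 2 by rewrite real_normK ?num_real.
have -> : circle_x t - 1 = - (2 * t ^+ 2 / (1 + t ^+ 2)).
  by rewrite /circle_x; field; rewrite gt_eqF.
rewrite normrN ger0_norm; last first.
  by apply: divr_ge0; [apply: mulr_ge0 => //; exact: sqr_ge0|exact: ltW].
rewrite ler_pdivrMr// t2 -mulrA ler_pM2l// expr2.
have := sqr_ge0 (`|t| - 1); nra.
Qed.

Lemma circle_y_dist t : `|circle_y t| <= 2 * `|t|.
Proof.
have D := circle_den_gt0 t; have T0 : 0 <= `|t| by [].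
rewrite /circle_y (_ : t + t = 2 * t); last by ring.
rewrite !normrM normfV (gtr0_norm D) ger0_norm//.
rewrite ler_pdivrMr// -[leLHS]mulr1 ler_wpM2l ?mulr_ge0// lerDl sqr_ge0//.
Qed.

End RationalCircle.

Lemma circle_family_cts (R : realType) (A : cstarAlgType R) (Z X : A) (s : R[i]) (eps : R) :
  0 < eps -> exists2 d : R, 0 < d & forall t, `|t| < d ->
  cnorm (s%:A * (((circle_x t)%:C)%C%:A * Z + ('i%C)%:A * (((circle_y t)%:C)%C%:A * X)) -
    s%:A * (((circle_x 0)%:C)%C%:A * Z + ('i%C)%:A * (((circle_y 0)%:C)%C%:A * X))) < eps.
Proof.
move=> eps0; have s1 := normc_ge0 s; have Z0 := cnorm_ge0 Z; have X0 := cnorm_ge0 X.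
set nZ := cnorm Z in Z0; set nX := cnorm X in X0.
pose K := normc s * (nZ + nX) + 1.
have K0 : 0 < K by apply: ltr_wpDl => //; apply: mulr_ge0 => //; apply: addr_ge0.
exists (eps / (2 * K)); first by rewrite divr_gt0// mulr_gt0.
move=> t tK.
have T0 : 0 <= `|t| by [].
have dx : `|circle_x t - circle_x 0| <= 2 * `|t| by rewrite circle_x0 circle_x_dist.
have dy : `|circle_y t - circle_y 0| <= 2 * `|t| by rewrite circle_y0 subr0 circle_y_dist.
have -> : s%:A * (((circle_x t)%:C)%C%:A * Z + ('i%C)%:A * (((circle_y t)%:C)%C%:A * X)) -
    s%:A * (((circle_x 0)%:C)%C%:A * Z + ('i%C)%:A * (((circle_y 0)%:C)%C%:A * X)) =
    s *: (((circle_x t - circle_x 0)%:C)%C *: Z + 'i%C *: (((circle_y t - circle_y 0)%:C)%C *: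
      X)).
  rewrite !mulr_algl -scalerBr; congr (_ *: _).
  by rewrite opprD addrACA -scalerBr -!scalerBl !rmorphB.
rewrite cnormZ.
have h : cnorm (((circle_x t - circle_x 0)%:C)%C *: Z + 'i%C *: (((circle_y t - circle_y
  0)%:C)%C *: X)) <=
    2 * `|t| * (nZ + nX).
  apply: le_trans (cnormD _ _) _; rewrite !cnormZ normc_i mul1r !normc_real mulrDr.
  by apply: lerD; apply: ler_wpM2r.
have : normc s * cnorm (((circle_x t - circle_x 0)%:C)%C *: Z + 'i%C *: (((circle_y t -
  circle_y 0)%:C)%C *: X)) <=
    2 * `|t| * (K - 1).
  by rewrite /K addrK mulrCA ler_wpM2l.
move=> h1; apply: le_lt_trans h1 _; move: tK; rewrite ltr_pdivlMr ?mulr_gt0// mulrCA mulrA.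
by apply: le_lt_trans; rewrite ler_wpM2l ?mulr_ge0// gerBl.
Qed.

Section CircleFamily.
Variables (R : realType) (A : cstarAlgType R) (e Z X : A) (g s : R[i]).

(** For the block matrices [Z] and [X] below, [t = 0] gives the direct sum of the points with [s]
    and [- s]. The factor [i] makes the last generator and its adjoint independent for [0 < t < 1],
    so that together they yield both [Z] and [X]; their anticommutator stays scalar because [Z] and
    [X] anticommute. *)
Definition circle_gens (t : R) : option bool -> A :=
  F_gen e g%:A (s%:A * (((circle_x t)%:C)%C%:A * Z + ('i%C)%:A * (((circle_y t)%:C)%C%:A * X))).

Lemma circle_gens_cts (i : option bool) (eps : R) : 0 < eps -> exists2 d : R, 0 < d &
  forall t, `|t - 0| < d -> cnorm (circle_gens t i - circle_gens 0 i) < eps.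
Proof.
move=> eps0; have [d d0 dP] := circle_family_cts Z X s eps0.
exists d => // t; rewrite subr0 => /dP.
by case: i => [[]|] // _; rewrite subrr cnorm0.
Qed.

Hypothesis s0 : s != 0.
Hypotheses (Zs : star Z = Z) (Xs : star X = X).

Lemma circle_gens_comm (t : R) (P : A) : 0 < t < 1 ->
  (forall i, P * circle_gens t i = circle_gens t i * P) ->
  (forall i, P * star (circle_gens t i) = star (circle_gens t i) * P) ->
  [/\ P * e = e * P, P * star e = star e * P, P * Z = Z * P & P * X = X * P].
Proof.
move=> /andP[t0 t1] Pg Pgs.
pose S : A := s%:A; pose I : A := 'i%C%:A.
pose x' : A := ((circle_x t)%:C)%C%:A; pose y' : A := ((circle_y t)%:C)%C%:A.
have inv (k : R[i]) (Y : A) : k != 0 -> P * (k%:A * Y) = k%:A * Y * P -> P * Y = Y * P.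
  move=> k0 hY; have kk : (k^-1)%:A * k%:A = 1 :> A.
    by rewrite alg_mul mulVf// scale1r.
  have e1 : P * (k%:A * Y) = k%:A * (P * Y) by rewrite !mulrA alg_comm.
  move: hY; rewrite e1 -[RHS]mulrA => hY.
  transitivity ((k^-1)%:A * (k%:A * (P * Y))); first by rewrite mulrA kk mul1r.
  by rewrite hY [LHS]mulrA kk mul1r.
have h2 := Pg (Some false); have h2s := Pgs (Some false).
have x0 : circle_x t != 0 by rewrite gt_eqF// circle_x_gt0// t0.
have y0 : circle_y t != 0 by rewrite gt_eqF// circle_y_gt0.
have rx0 : ((circle_x t)%:C)%C != 0 :> R[i] by rewrite fmorph_eq0.
have ry0 : ((circle_y t)%:C)%C != 0 :> R[i] by rewrite fmorph_eq0.
have i0 : 'i%C != 0 :> R[i] by rewrite eq_complex /= oner_eq0 andbF.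
have f1 : P * (x' * Z + I * (y' * X)) = (x' * Z + I * (y' * X)) * P.
  exact: (inv s).
have f2 : P * (x' * Z - I * (y' * X)) = (x' * Z - I * (y' * X)) * P.
  apply: (inv s^*); first by rewrite conjC_eq0.
  move: h2s; rewrite /circle_gens /= starM starD !starM !star_algr !star_alg conjc_i Zs Xs
    !alg_comm.
  by rewrite scaleNr mulNr.
split.
- exact: (Pg (Some true)).
- exact: (Pgs (Some true)).
- apply: (inv ((circle_x t)%:C)%C) => //; rewrite -/x'.
  have e2 : P * (x' * Z) + P * (x' * Z) = x' * Z * P + x' * Z * P.
    transitivity (P * (x' * Z + I * (y' * X)) + P * (x' * Z - I * (y' * X))); first by nc tt.
    by rewrite f1 f2; nc tt.
  by rewrite -[LHS]scale_half_add e2 scale_half_add.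
- apply: (inv ((circle_y t)%:C)%C) => //; apply: (inv 'i%C) => //; rewrite -/y' -/I.
  have e2 : P * (I * (y' * X)) + P * (I * (y' * X)) = I * (y' * X) * P + I * (y' * X) * P.
    transitivity (P * (x' * Z + I * (y' * X)) - P * (x' * Z - I * (y' * X))); first by nc tt.
    by rewrite f1 f2; nc tt.
  by rewrite -[LHS]scale_half_add e2 scale_half_add.
Qed.

End CircleFamily.

Section InteriorPoints.
Variables (R : realType).

Lemma F_interior_point (A : cstarAlgType R) (e Z X : A) (g s : R[i]) (x y : R) :
  U_relations e -> star Z = Z -> star X = X -> Z * Z = 1 -> X * X = 1 ->
  X * Z = - (Z * X) -> Z * e = - (e * Z) -> X * e = - (e * X) ->
  Z * star e = - (star e * Z) -> X * star e = - (star e * X) -> x * x + y * y = 1 ->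
  normc g ^+ 2 + (normc s ^+ 2 + normc s ^+ 2) = 1 ->
  F_relations e g%:A (s%:A * ((x%:C)%C%:A * Z + ('i%C)%:A * ((y%:C)%C%:A * X))).
Proof.
move=> [ee ees] Zs Xs ZZ XX XZ Ze Xe Zes Xes xy gs.
set G : A := g%:A; set S : A := s%:A; set x' : A := (x%:C)%C%:A; set y' : A := (y%:C)%C%:A.
set I : A := 'i%C%:A.
have cG z : z * G = G * z by apply: alg_comm.
have cGs z : z * star G = star G * z by rewrite star_alg alg_comm.
have cS z : z * S = S * z by apply: alg_comm.
have cSs z : z * star S = star S * z by rewrite star_alg alg_comm.
have cI z : z * I = I * z by apply: alg_comm.
have cx z : z * x' = x' * z by apply: alg_comm.
have cy z : z * y' = y' * z by apply: alg_comm.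
have xs : star x' = x' by apply: star_algr.
have ys : star y' = y' by apply: star_algr.
have Is : star I = - I by rewrite star_alg conjc_i scaleNr.
have II : I * I = -1 by rewrite alg_mul mul_ii scaleN1r.
have xy' : x' * x' = 1 - y' * y'.
  rewrite !alg_mul -!rmorphM (_ : x * x = 1 - y * y); last by lra.
  by rewrite rmorphB scalerBl rmorph1 scale1r.
have GS : 1 - G * star G = S * star S + S * star S.
  rewrite !alg_normc -alg_realD.
  have -> : normc s ^+ 2 + normc s ^+ 2 = 1 - normc g ^+ 2 by lra.
  by rewrite rmorphB scalerBl rmorph1 scale1r.
split => //.
- by nc (cS e, (cI e, (cx e, (cy e, (Ze, Xe))))).
- by nc (cS (star e), (cI (star e), (cx (star e), (cy (star e), (Zes, Xes))))).
- rewrite starM starD !starM xs ys Is Zs Xs GS.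
  by nc (cS Z, (cS X, (cS I, (cS x', (cS y', (cS (star S), (cSs Z, (cSs X, (cSs I, (cSs x',
    (cSs y',
    (cI Z, (cI X, (cI x', (cI y', (cx Z, (cx X, (cx y', (cy Z, (cy X, (II, (ZZ, (XX, (XZ,
      xy')))))))))))))))))))))))).
Qed.

Variables (e : 'M[R[i]]_2).
Hypothesis eP : U_relations e.
Let w := sigma_of e.
Let e4 : 'M[R[i]]_4 := blk e 0 0 e.
Let Z : 'M[R[i]]_4 := blk w 0 0 (- w).
Let X : 'M[R[i]]_4 := blk 0 w w 0.
Let ww : w * w = 1. Proof. by have [] := sigma_facts eP. Qed.
Let ws : star w = w. Proof. by have [] := sigma_facts eP. Qed.
Let we : w * e = - (e * w). Proof. by have [] := sigma_facts eP. Qed.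
Let wes : w * star e = - (star e * w). Proof. by have [] := sigma_facts eP. Qed.
Let simpl4 := (blkM, blk_star, @mulr0, @mul0r, @add0r, @addr0, @oppr0, @star0, @mulNr, @mulrN,
  @opprK).

Let e4P : U_relations e4.
Proof.
have [ee ees] := eP; split; rewrite /e4 !simpl4 ?ee ?blk0//.
by rewrite -[1 in RHS]blk1 blkN blkD !simpl4 ees.
Qed.
Let ZZ : Z * Z = 1. Proof. by rewrite /Z !simpl4 ww blk1. Qed.
Let XX : X * X = 1. Proof. by rewrite /X !simpl4 ww blk1. Qed.
Let XZ : X * Z = - (Z * X). Proof. by rewrite /Z /X !simpl4 blkN !simpl4. Qed.
Let Ze : Z * e4 = - (e4 * Z). Proof. by rewrite /Z /e4 !simpl4 blkN !simpl4 we ?opprK. Qed.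
Let Xe : X * e4 = - (e4 * X). Proof. by rewrite /X /e4 !simpl4 blkN !simpl4 we ?opprK. Qed.
Let Zes : Z * star e4 = - (star e4 * Z).
Proof. by rewrite /Z /e4 !simpl4 blkN !simpl4 wes ?opprK. Qed.
Let Xes : X * star e4 = - (star e4 * X).
Proof. by rewrite /X /e4 !simpl4 blkN !simpl4 wes ?opprK. Qed.
Let Zs : star Z = Z. Proof. by rewrite /Z blk_star starN ws star0. Qed.
Let Xs : star X = X. Proof. by rewrite /X blk_star ws star0. Qed.

(** Commutation with [e4] makes all four blocks scalar, [Z] kills the off-diagonal ones, and [X]
    identifies the diagonal ones. *)
Lemma blk_irreducible (P : 'M[R[i]]_4) : P * e4 = e4 * P -> P * star e4 = star e4 * P ->
  P * Z = Z * P -> P * X = X * P -> exists a : 'M[R[i]]_2, P = blk a 0 0 a.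
Proof.
have [a [b [c [d ->]]]] := blk_eta P.
rewrite /e4 /Z /X !simpl4 => /blk_inj[ae be ce de] /blk_inj[aes bes ces des].
move=> /blk_inj[_ bw cw _] /blk_inj[_ aw _ _].
have [a0 aE] := U_schur eP ae aes; have [b0 bE] := U_schur eP be bes.
have [c0 cE] := U_schur eP ce ces; have [d0 dE] := U_schur eP de des.
have z0 (k : R[i]) : - (k%:A * w) = w * k%:A -> k%:A = 0 :> 'M[R[i]]_2.
  rewrite alg_comm => h.
  have h2 : k%:A * w + k%:A * w = 0 by rewrite -{1}[k%:A * w]opprK h addNr.
  have : (k%:A + k%:A) * (w * w) = 0 :> 'M[R[i]]_2 by rewrite mulrA mulrDl h2 mul0r.
  rewrite ww mulr1 => /(congr1 (fun z => ((2^-1 : R)%:C)%C *: z)).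
  by rewrite scale_half_add scaler0.
have b1 : b = 0 by rewrite bE; apply: z0; rewrite -bE bw.
have c1 : c = 0 by rewrite cE; apply: z0; rewrite -cE cw opprK.
have ad : a = d.
  have : a * w * w = w * d * w by rewrite aw.
  by rewrite dE alg_comm -!mulrA ww !mulr1.
by exists a; rewrite b1 c1 -ad.
Qed.

Variables (E : cstarAlgType R) (a : option bool -> E).
Hypothesis ga : generated_by a.
Hypothesis ua : forall (B : cstarAlgType R) (b : option bool -> B), F_rel b ->
  exists f : {lrmorphism E -> B}, star_hom f /\ forall i, f (a i) = b i.
Variables (g s : R[i]).
Hypothesis gs : normc g ^+ 2 + (normc s ^+ 2 + normc s ^+ 2) = 1.
Hypothesis s0 : s != 0.

Let fam : R -> option bool -> 'M[R[i]]_4 := circle_gens e4 Z X g s.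

Let famP t : F_rel (fam t).
Proof. exact: F_interior_point e4P Zs Xs ZZ XX XZ Ze Xe Zes Xes (circle_xy t) gs. Qed.

Let fam_center t (h : {lrmorphism E -> 'M[R[i]]_4}) (x : E) : 0 < t < 1 -> star_hom h ->
  (forall i, h (a i) = fam t i) -> (forall z, z * x = x * z) ->
  exists b : 'M[R[i]]_2, h x = blk b 0 0 b.
Proof.
move=> t01 hs ha xc.
have hc z : h x * h z = h z * h x by rewrite -!rmorphM xc.
have c1 i : h x * fam t i = fam t i * h x by rewrite -ha hc.
have c2 i : h x * star (fam t i) = star (fam t i) * h x by rewrite -ha -hs hc.
have [he hes hZ hX] := circle_gens_comm s0 Zs Xs t01 c1 c2.
exact: blk_irreducible he hes hZ hX.
Qed.

(* The direct sum of the two representations is a limit of four-dimensional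
   irreducible ones, in which central elements are scalars. *)
Lemma pair_center (p m : {lrmorphism E -> 'M[R[i]]_2}) (x : E) : star_hom p -> star_hom m ->
  (forall i, p (a i) = F_gen e g%:A (s%:A * w) i) ->
  (forall i, m (a i) = F_gen e g%:A ((- s)%:A * w) i) ->
  (forall z, z * x = x * z) -> p x = m x.
Proof.
move=> ps ms pa ma xc.
have /choice[h hP] : forall t, exists h : {lrmorphism E -> 'M[R[i]]_4},
    star_hom h /\ forall i, h (a i) = fam t i.
  by move=> t; apply: ua (famP t).
have hs t : star_hom (h t) by have [] := hP t.
have ha t i : h t (a i) = fam t i by have [_] := hP t.
have [q [qs qE]] := direct_sum_hom ps ms.
have h0q z : h 0 z = q z.
  apply: (star_hom_ext ga (hs 0) qs) => i; rewrite ha qE pa ma.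
  have sc (k : R[i]) : k%:A = blk k%:A 0 0 k%:A :> 'M[R[i]]_4.
    by rewrite -blk1 blkZ !scaler0.
  case: i => [[]|] //=.
  rewrite /fam /circle_gens /= circle_x0 circle_y0 rmorph0 rmorph1 scale0r mul0r mulr0.
  by rewrite addr0 scale1r mul1r sc /Z !simpl4 scaleNr mulNr.
have cts := star_hom_family_continuous ga hs (t0 := 0) _.
have {}cts : forall eps : R, 0 < eps -> exists2 d : R, 0 < d &
    forall t, `|t - 0| < d -> cnorm (h t x - h 0 x) < eps.
  apply: cts => i eps eps0; have [d d0 dP] := circle_gens_cts e4 Z X g s i eps0.
  by exists d; [exact: d0|move=> t td; rewrite !ha; exact: dP].
apply/matrixP => i j; apply/eqP; rewrite -subr_eq0; apply/eqP.
apply: ComplexField.Normc.eq0_normc; apply/eqP; rewrite eq_le normc_ge0 andbT.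
apply/ler_addgt0Pr => eps eps0; rewrite add0r.
have [d d0 dP] := cts (eps / 2) (divr_gt0 eps0 (ltr0Sn _ 1)).
(* At a small positive [t], the image of [x] has two equal diagonal blocks [b], and it is close to
   the image at [0], with blocks [p x] and [m x]; so both are close to [b]. *)
pose t := Num.min (d / 2) (1 / 2).
have t01 : 0 < t < 1.
  rewrite lt_min divr_gt0//= divr_gt0//=; rewrite gt_min; apply/orP; right; lra.
have td : `|t - 0| < d.
  rewrite subr0 gtr0_norm; last by case/andP: t01.
  by rewrite gt_min; apply/orP; left; lra.
have [b bE] := fam_center t01 (hs t) (ha t) xc.
have := dP t td; rewrite h0q qE bE blkN blkD => lt.
have e1 := opnorm_entry (blk (b - p x) (0 - 0) (0 - 0) (b - m x)) (lshift 2 i : 'I_(2 + 2))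
  (lshift 2 j : 'I_(2 + 2)).
have e2 := opnorm_entry (blk (b - p x) (0 - 0) (0 - 0) (b - m x)) (rshift 2 i : 'I_(2 + 2))
  (rshift 2 j : 'I_(2 + 2)).
rewrite /blk (@block_mxEul _ 2 2 2 2) in e1; rewrite /blk (@block_mxEdr _ 2 2 2 2) in e2.
have -> : p x i j - m x i j = (b - m x) i j - (b - p x) i j by rewrite !mxE; ring.
apply: le_trans (normcD_le _ _) _; rewrite normcN.
move: lt e1 e2; rewrite /cnorm /=; lra.
Qed.

End InteriorPoints.

(** * The path argument *)

Section SpherePath.
Variable R : realType.
Local Notation C := R[i].

Lemma complex_path_continuous (f g : R -> R) : continuous f -> continuous g ->
  forall t0 eps : R, 0 < eps -> exists2 d : R, 0 < d &
    forall t, `|t - t0| < d -> normc ((f t +i* g t) - (f t0 +i* g t0))%C < eps.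
Proof.
move=> fc gc t0 eps eps0; have e2 : 0 < eps / 2 by rewrite divr_gt0.
have /cvgrPdist_lt/(_ _ e2)/nbhs_ballP[d1 /= d10 h1] := fc t0.
have /cvgrPdist_lt/(_ _ e2)/nbhs_ballP[d2 /= d20 h2] := gc t0.
exists (Num.min d1 d2); first by rewrite lt_min d10.
move=> t; rewrite lt_min distrC => /andP[/h1 {}h1 /h2 {}h2].
have := normc_le_parts ((f t +i* g t) - (f t0 +i* g t0))%C; move=> /=.
by move: h1 h2 => /=; rewrite (distrC (f t0)) (distrC (g t0)); lra.
Qed.

(* The path may only meet [s = 0] at its endpoints. *)
Lemma sphere_path (G0 s0 G1 s1 : C) :
  normc G0 ^+ 2 + (normc s0 ^+ 2 + normc s0 ^+ 2) = 1 ->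
  normc G1 ^+ 2 + (normc s1 ^+ 2 + normc s1 ^+ 2) = 1 ->
  0 <= complex.Re s0 -> 0 <= complex.Re s1 ->
  exists G s : R -> C,
  [/\ forall t, normc (G t) ^+ 2 + (normc (s t) ^+ 2 + normc (s t) ^+ 2) = 1,
      [/\ G 0 = G0, s 0 = s0, G 1 = G1 & s 1 = s1],
      forall t, t != 0 -> t != 1 -> s t != 0,
      forall t0 eps : R, 0 < eps -> exists2 d : R, 0 < d &
        forall t, `|t - t0| < d -> normc (G t - G t0) < eps &
      forall t0 eps : R, 0 < eps -> exists2 d : R, 0 < d &
        forall t, `|t - t0| < d -> normc (s t - s t0) < eps].
Proof.
case: G0 s0 G1 s1 => [a0 b0] [c0 d0] [a1 b1] [c1 d1].
rewrite !normc_sqr /= => h0 h1 c00 c10.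
(* The weights are squares, hence nonnegative on the whole line. Adding [t ^ 2 (1 - t) ^ 2] to the
   real part of [s] keeps it positive except possibly at [0] and [1]; dividing by the norm [N] then
   returns to the sphere. *)
pose mix (p q : R) (t : R) : R := (1 - t) * (1 - t) * p + t * t * q.
have mixc p q : continuous (mix p q).
  move=> t; apply: cvgD; (apply: cvgM; last exact: cvg_cst); apply: cvgM;
    by [apply: cvgB; [apply: cvg_cst|apply: cvg_id]|apply: cvg_id].
pose bump (t : R) : R := mix c0 c1 t + t * t * ((1 - t) * (1 - t)).
have bumpc : continuous bump.
  move=> t; apply: cvgD; first exact: mixc.
  by apply: cvgM; apply: cvgM; try exact: cvg_id;
    apply: cvgB; [apply: cvg_cst|apply: cvg_id|apply: cvg_cst|apply: cvg_id].
pose M t := mix a0 a1 t ^+ 2 + mix b0 b1 t ^+ 2 +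
  ((bump t ^+ 2 + mix d0 d1 t ^+ 2) + (bump t ^+ 2 + mix d0 d1 t ^+ 2)).
have bump_gt0 t : t != 0 -> t != 1 -> 0 < bump t.
  move=> t0 t1; have t20 : 0 < t * t by rewrite -expr2 exprn_even_gt0.
  have t21 : 0 < (1 - t) * (1 - t) by rewrite -expr2 exprn_even_gt0//= subr_eq0 eq_sym.
  have := mulr_ge0 (ltW t21) c00; have := mulr_ge0 (ltW t20) c10.
  have := mulr_gt0 t20 t21; rewrite /bump /mix.
  lra.
have M0 : M 0 = 1 by rewrite /M /bump /mix !(subr0, mul0r, mulr0, mul1r, mulr1, addr0).
have M1 : M 1 = 1 by rewrite /M /bump /mix !(subrr, mul0r, mulr0, mul1r, mulr1, addr0, add0r).
have M_gt0 t : 0 < M t.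
  have [->|t0] := eqVneq t 0; first by rewrite M0.
  have [->|t1] := eqVneq t 1; first by rewrite M1.
  have := exprn_gt0 2 (bump_gt0 t t0 t1); rewrite /M.
  have := sqr_ge0 (mix a0 a1 t); have := sqr_ge0 (mix b0 b1 t); have := sqr_ge0 (mix d0 d1 t).
  by move: (_ ^+ 2) (_ ^+ 2) (_ ^+ 2) (_ ^+ 2) => p q r s; lra.
pose N t := Num.sqrt (M t).
have N_gt0 t : 0 < N t by rewrite sqrtr_gt0.
have NN t : N t ^+ 2 = M t by rewrite sqr_sqrtr// ltW.
have Mc : continuous M.
  move=> t; have sqc (f : R -> R) : continuous f -> continuous (fun t => f t ^+ 2).
    by move=> fc u; apply: (@cvgM _ _ _ _ f f); apply: fc.
  apply: cvgD; first by apply: cvgD; apply: sqc; apply: mixc.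
  by apply: cvgD; apply: cvgD; apply: sqc; [apply: bumpc|apply: mixc|apply: bumpc|apply: mixc].
have Nc : continuous N.
  move=> t; apply: (@continuous_comp _ _ _ M Num.sqrt); first exact: Mc.
  exact: sqrt_continuous.
have divc (f : R -> R) : continuous f -> continuous (fun t => f t / N t).
  move=> fc t; apply: cvgM; first exact: fc.
  by apply: cvgV; [rewrite gt_eqF|exact: Nc].
exists (fun t => (mix a0 a1 t / N t) +i* (mix b0 b1 t / N t))%C,
       (fun t => (bump t / N t) +i* (mix d0 d1 t / N t))%C; split.
- move=> t; rewrite !normc_sqr /= !expr_div_n !NN -!mulrDl -/(M t).
  by rewrite divff// gt_eqF.
- have N0 : N 0 = 1 by rewrite /N M0 sqrtr1.
  have N1 : N 1 = 1 by rewrite /N M1 sqrtr1.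
  rewrite N0 N1 !divr1 /bump /mix.
  by split; congr (_ +i* _)%C; rewrite ?(subrr, subr0, mul0r, mulr0, mul1r, mulr1, addr0, add0r).
- move=> t t0 t1; rewrite eq_complex /= negb_and; apply/orP; left.
  by rewrite gt_eqF// divr_gt0// bump_gt0.
- exact: complex_path_continuous (divc _ (mixc _ _)) (divc _ (mixc _ _)).
- exact: complex_path_continuous (divc _ bumpc) (divc _ (mixc _ _)).
Qed.
End SpherePath.

(** * Separation of E(-1, 0) from the other algebras *)

Section Distinguish.
Variable R : realType.
Local Notation C := R[i].
Local Notation M2 := 'M[C]_2.

Lemma U_matrix_unit : exists e : M2, U_relations e.
Proof.
have es : star (delta_mx 0 1 : M2) = delta_mx 1 0.
  apply/matrixP => i j; rewrite !mxE andbC.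
  by case: (_ && _); rewrite /= ?rmorph1 ?rmorph0.
have mulE (X Y : M2) : X * Y = X *m Y by [].
exists (delta_mx 0 1); split; rewrite ?es !mulE.
  by rewrite mul_delta_mx_0.
rewrite !mul_delta_mx; apply/matrixP => i j; rewrite !mxE.
have i01 (k : 'I_2) : k = 0 \/ k = 1.
  by case: k => [[|[|//]] k2]; [left|right]; apply/val_inj.
by case: (i01 i) (i01 j) => -> [] -> /=; rewrite ?subr0 ?subrr.
Qed.

(** [u] is [sigma_of e] divided by the root of two. Exchanging [u] and [e] produces both
    representations with moduli 1 and 0, the two ends of the path. *)
Lemma E0_point (A : cstarAlgType R) (e : A) : U_relations e -> exists u : A,
  [/\ E_relations 0 u e, E_relations 0 e u, u * u + u * u = 1 & e * e + e * e = 0].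
Proof.
move=> eP; have [ww ws we wes] := sigma_facts eP; have [ee ees] := eP.
pose h : R := (Num.sqrt 2)^-1.
have hh : h * h + h * h = 1.
  have s2 : Num.sqrt 2 * Num.sqrt 2 = 2 :> R by rewrite -expr2 sqr_sqrtr.
  by rewrite -invfM s2; lra.
pose H : A := (h%:C)%C%:A; have Hs : star H = H by apply: star_algr.
have cH z : z * H = H * z by apply: alg_comm.
have HH : H * H + H * H = 1 by rewrite /H !alg_mul -rmorphM -alg_realD hh rmorph1 scale1r.
exists (H * sigma_of e); move: (sigma_of e) ww ws we wes => w ww ws we wes.
have us : star (H * w) = H * w by rewrite starM ws Hs cH.
have uu : (H * w) * (H * w) = H * H by nc (cH w, ww).
have ue : star e * e + e * star e = 1 by rewrite ees subrK.
split.
- split; rewrite ?us ?uu ?scale0r//; first by nc (cH e, we).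
  by nc (cH e, we).
- split; rewrite ?us ?uu ?scale0r//; first by nc (cH (star e), wes).
  by nc (cH e, we).
- by rewrite uu.
- by rewrite ee addr0.
Qed.

Lemma central_of_gens (I : Type) (A : cstarAlgType R) (a : I -> A) (x : A) :
  generated_by a -> (forall i, a i * x = x * a i) -> (forall i,
    star (a i) * x = x * star (a i)) ->
  forall z, z * x = x * z.
Proof.
move=> ga h1 h2 z.
have SP : cstar_subalgebra (commutant [set y | y = x \/ y = star x]).
  by apply: cstar_subalgebra_commutant => y [->|->]; [right|left; rewrite starK].
have ST := ga _ SP; have : [set: A] z by [].
rewrite -ST; first by move=> /(_ x (or_introl erefl)).
move=> i y [->|->]; first exact: h1.
by have := congr1 star (h2 i); rewrite !starM starK => ->.
Qed.

Lemma E0_squares_central (A : cstarAlgType R) (a : bool -> A) : generated_by a ->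
  E_rel 0 a -> forall z i, z * (a i * a i + a i * a i) = (a i * a i + a i * a i) * z.
Proof.
move=> ga aP z i; have [h1 h2 h3 h4] := E0_sqr_comm aP.
have [r1 r2 r3 r4] := aP.
have r3' : a false * star (a true) = - (star (a true) * a false) by rewrite r3 opprK.
have r3s : star (a false) * a true = - (a true * star (a false)).
  by have := congr1 star r3; rewrite starM starK starN starM starK.
have sq j : a i * a i * a j = a j * (a i * a i) /\ a i * a i * star (a j) = star (a j) * (a i *
  a i).
  by case: i j => [] []; split; rewrite ?h1 ?h2 ?h3 ?h4 ?mulrA//;
     [nc r3s|rewrite -mulrA; nc r3'].
apply: (central_of_gens ga) => j; have [e1 e2] := sq j.
  by rewrite mulrDr mulrDl e1.
by rewrite mulrDr mulrDl e2.
Qed.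

Lemma E_rel_morph (y : C) (A B : cstarAlgType R) (h : {lrmorphism A -> B}) (a : bool -> A) :
  star_hom h -> E_rel y a -> E_rel y (fun i => h (a i)).
Proof.
move=> hs [r1 r2 r3 r4]; split; rewrite -?hs -?rmorphM -?rmorphD.
- by rewrite r1 rmorph1.
- by rewrite r2 rmorph1.
- by rewrite r3 rmorphN.
- by rewrite r4 /= rmorph_alg.
Qed.

Lemma F_rel_morph (A B : cstarAlgType R) (h : {lrmorphism A -> B}) (a : option bool -> A) :
  star_hom h -> F_rel a -> F_rel (fun i => h (a i)).
Proof.
move=> hs [h1 h2 h3 h4 h5 h6 h7 h8 h9 h10]; split; rewrite -?hs.
- by rewrite -rmorphM h1 rmorph0.
- by rewrite -!rmorphM h2 rmorphB rmorph1.
- by rewrite -!rmorphM h3 rmorphN.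
- by rewrite -!rmorphM h4 rmorphN.
- by rewrite -!rmorphM h5 !rmorphB rmorph1.
- by rewrite -!rmorphM h6.
- by rewrite -!rmorphM h7.
- by rewrite -!rmorphM h8.
- by rewrite -!rmorphM h9.
- by rewrite -!rmorphM h10.
Qed.

Lemma star_hom_comp (A B D : cstarAlgType R) (h : {lrmorphism A -> B}) (k : {lrmorphism B -> D}) :
  star_hom h -> star_hom k -> star_hom (k \o h : {lrmorphism A -> D}).
Proof. by move=> hs ks x /=; rewrite hs ks. Qed.

Lemma cnorm_diff_lt (A : cstarAlgType R) (x y x0 y0 : A) (eps : R) :
  cnorm (x - x0) < eps / 2 -> cnorm (y - y0) < eps / 2 ->
  `|cnorm x0 - cnorm y0 - (cnorm x - cnorm y)| < eps.
Proof.
have := cnormD (x - x0) x0; have := cnormD (x0 - x) x; rewrite !subrK (cdistC x0).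
have := cnormD (y - y0) y0; have := cnormD (y0 - y) y; rewrite !subrK (cdistC y0).
by rewrite ltr_norml; lra.
Qed.

Section Data.
Variables (E0 E : cstarAlgType R) (b : bool -> E0).
Hypotheses (gb : generated_by b) (bP : E_rel 0 b).
Hypothesis ub : forall (B : cstarAlgType R) (c : bool -> B), E_rel 0 c ->
  exists f : {lrmorphism E0 -> B}, star_hom f /\ forall i, f (b i) = c i.
Variables (phi : {lrmorphism E0 -> E}) (psi : {lrmorphism E -> E0}).
Hypotheses (phis : star_hom phi) (psis : star_hom psi).
Hypotheses (phiK : cancel phi psi) (psiK : cancel psi phi).

Let X (i : bool) : E := phi (b i * b i + b i * b i).

Lemma image_squares_central z i : z * X i = X i * z.
Proof. by rewrite -(psiK z) -!rmorphM (E0_squares_central gb bP). Qed.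

Lemma two_reps : exists t1 t2 : {lrmorphism E -> M2}, [/\ star_hom t1, star_hom t2,
  t1 (X true) = 1 /\ t1 (X false) = 0 & t2 (X true) = 0 /\ t2 (X false) = 1].
Proof.
have [e eP] := U_matrix_unit; have [u [r1 r2 uu ee]] := E0_point eP.
have [f1 [f1s f1E]] := ub (c := bool_gen u e) r1.
have [f2 [f2s f2E]] := ub (c := bool_gen e u) r2.
exists (f1 \o psi : {lrmorphism E -> M2}), (f2 \o psi : {lrmorphism E -> M2}).
by split; [exact: star_hom_comp|exact: star_hom_comp|split|split];
  rewrite /X /= phiK rmorphD !rmorphM /= ?f1E ?f2E /= ?uu ?ee.
Qed.

(** Any two homomorphisms to 2 by 2 matrices are intertwined by some [T != 0], but [X true] is sent
    to 1 by one of them and to 0 by the other. *)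
Lemma not_universal_U : universal_for (@U_rel R) E -> False.
Proof.
move=> [a [aP ga _]]; have [t1 [t2 [t1s t2s [x1 _] [y1 _]]]] := two_reps.
have U1 (t : {lrmorphism E -> M2}) : star_hom t -> U_relations (t (a tt)).
  move=> ts; have [h1 h2] := aP; split; first by rewrite -rmorphM h1 rmorph0.
  by rewrite -ts -!rmorphM h2 rmorphB rmorph1.
have [T [T0 T1 T2]] := U_intertwiner (U1 _ t1s) (U1 _ t2s).
have TE : forall x, T * t1 x = t2 x * T.
  by apply: (intertwine_generated ga t1s t2s) => -[].
by have := TE (X true); rewrite x1 y1 mulr1 mul0r => T00; move: T0; rewrite T00 eqxx.
Qed.

Section NotF.
Variable a : option bool -> E.
Hypotheses (ga : generated_by a) (aP : F_rel a).
Hypothesis ua : forall (B : cstarAlgType R) (c : option bool -> B), F_rel c ->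
  exists f : {lrmorphism E -> B}, star_hom f /\ forall i, f (a i) = c i.
Variable e : M2.
Hypothesis eP : U_relations e.

Definition at_point (g s : C) (p : {lrmorphism E -> M2}) : Prop :=
  star_hom p /\ forall i, p (a i) = F_gen e g%:A (s%:A * sigma_of e) i.

Lemma point_scalar g s p : at_point g s p -> forall i, exists z : C, p (X i) = z%:A.
Proof.
move=> [ps pa] i; apply: (U_schur eP).
  by have := image_squares_central (a (Some true)) i => /(congr1 p); rewrite !rmorphM /= pa.
by have := image_squares_central (star (a (Some true))) i => /(congr1 p);
  rewrite !rmorphM /= ps pa.
Qed.

(** By [F_M2] and [U_intertwiner], [t] is intertwined with a point written in the fixed matrix units
    [e]; scalar values of central elements agree across a nonzero intertwiner. *)
Lemma rep_to_point (t : {lrmorphism E -> M2}) : star_hom t -> exists g s : C,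
  normc g ^+ 2 + (normc s ^+ 2 + normc s ^+ 2) = 1 /\
  forall p, at_point g s p -> forall i (z : C), t (X i) = z%:A -> p (X i) = z%:A.
Proof.
move=> ts; have FP : F_relations _ _ _ := F_rel_morph ts aP.
have [g [s [gE fE gs]]] := F_M2 FP; exists g, s; split => // p [ps pa] i z tz.
have [T [T0 T1 T2]] := U_intertwiner eP (F_U FP).
have Tw : T * sigma_of e = sigma_of (t (a (Some true))) * T.
  by rewrite /sigma_of mulrBr mulrBl !mulrA T1 T2 -!mulrA T1 T2.
have TE : forall x, T * p x = t x * T.
  apply: (intertwine_generated ga ps ts) => -[[]|]; rewrite pa //=.
  - by rewrite fE mulrA alg_comm -!mulrA Tw.
  - by rewrite gE alg_comm.
  - have [_ ws _ _] := sigma_facts eP; have [_ ws' _ _] := sigma_facts (F_U FP).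
    by rewrite fE !starM ws ws' !star_alg mulrA Tw -!mulrA alg_comm.
  - by rewrite gE star_alg alg_comm.
have [z' z'E] := point_scalar (conj ps pa) i; rewrite z'E; congr (_ *: _).
by apply: (intertwine_scalar T0); rewrite -z'E -tz TE.
Qed.

(** [pair_center] gives [p] and [m] the same values on the squares, so at modulus one [E0_M2_unique]
    yields an intertwiner [T != 0]. It commutes with [e] and [star e], hence is a scalar [k], and
    the images of the generator [f] give [k s = - s k]. *)
Lemma opposite_points_disjoint g s p m : at_point g s p -> at_point g (- s) m -> s != 0 ->
  (forall i (z : C), p (X i) = z%:A -> normc z = 1) -> False.
Proof.
move=> pP mP s0 unit; have [[ps pa] [ms ma]] := (pP, mP).
have gs : normc g ^+ 2 + (normc s ^+ 2 + normc s ^+ 2) = 1.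
  have FP : F_relations _ _ _ := F_rel_morph ps aP.
  have [g' [s' [g'E s'E gs']]] := F_M2 FP.
  have [ww _ _ _] := sigma_facts eP.
  move: g'E s'E; rewrite !pa /= => /alg_inj -> /(congr1 (fun z => z * sigma_of e)).
  by rewrite -!mulrA ww !mulr1 => /alg_inj ->.
have pm i : p (X i) = m (X i).
  by apply: (pair_center eP ga ua gs s0 ps ms pa ma) => z; apply: image_squares_central.
have [z1 z1E] := point_scalar pP true; have [z2 z2E] := point_scalar pP false.
pose q := (p \o phi : {lrmorphism E0 -> M2}); pose r := (m \o phi : {lrmorphism E0 -> M2}).
have qs : star_hom q by apply: star_hom_comp.
have rs : star_hom r by apply: star_hom_comp.
have sqE (k : {lrmorphism E -> M2}) i : (k \o phi) (b i) * (k \o phi) (b i) + (k \o phi) (b i)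
  * (k \o phi) (b i) = k (X i).
  by rewrite /X !rmorphD /= !rmorphM.
have [T [T0 T1 T2 T3 T4]] := E0_M2_unique (E_rel_morph qs bP) (E_rel_morph rs bP)
  (unit true z1 z1E) (unit false z2 z2E) (etrans (sqE p true) z1E) (etrans (sqE p false) z2E)
  (etrans (sqE m true) (etrans (esym (pm true)) z1E))
  (etrans (sqE m false) (etrans (esym (pm false)) z2E)).
have TE x : T * p x = m x * T.
  rewrite -(psiK x).
  by apply: (intertwine_generated (T := T) gb qs rs) => -[].
have Te := TE (a (Some true)); rewrite pa ma /= in Te.
have Tes := TE (star (a (Some true))); rewrite ps ms pa ma /= in Tes.
have [k kE] := U_schur eP Te Tes.
have := TE (a (Some false)); rewrite pa ma kE /= => h.
have [ww _ _ _] := sigma_facts eP.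
have : (k * s)%:A = (- s * k)%:A :> M2.
  have := congr1 (fun z => z * sigma_of e) h.
  by rewrite -!mulrA [sigma_of e * (k%:A * _)]mulrA alg_comm -!mulrA ww !mulr1 !alg_mul.
move=> /alg_inj /eqP;
  rewrite mulNr [s * k]mulrC -subr_eq0 opprK -mulr2n mulrn_eq0 /= mulf_eq0 (negPf s0) orbF.
by move=> /eqP k0; move: T0; rewrite kE k0 scale0r eqxx.
Qed.

Lemma exists_point g s : normc g ^+ 2 + (normc s ^+ 2 + normc s ^+ 2) = 1 ->
  exists p, at_point g s p.
Proof.
move=> gs; have [p [ps pa]] := ua (c := F_gen e g%:A (s%:A * sigma_of e)) (F_point eP gs).
by exists p.
Qed.

(** By [pair_center], [s] may be replaced by [- s] without changing central values. Endpoints with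
    nonnegative real part are what lets [sphere_path] avoid [s = 0]. *)
Lemma rep_to_right_point (t : {lrmorphism E -> M2}) : star_hom t -> exists g s : C,
  [/\ normc g ^+ 2 + (normc s ^+ 2 + normc s ^+ 2) = 1, 0 <= complex.Re s &
  forall p, at_point g s p -> forall i (z : C), t (X i) = z%:A -> p (X i) = z%:A].
Proof.
move=> /rep_to_point[g [s [gs H]]].
have [s_ge0|s_lt0] := leP 0 (complex.Re s); first by exists g, s.
have s0 : s != 0 by apply: contraTneq s_lt0 => ->; rewrite ltxx.
have gs' : normc g ^+ 2 + (normc (- s) ^+ 2 + normc (- s) ^+ 2) = 1 by rewrite normcN.
exists g, (- s); split => //.
  by case: (s) s_lt0 => x y /= /ltW; rewrite oppr_ge0.
move=> p [ps pa] i z tz; have [m [ms ma]] := exists_point gs.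
rewrite -(H m (conj ms ma) i z tz); apply/esym.
by apply: (pair_center eP ga ua gs s0 ms ps ma pa) => y; apply: image_squares_central.
Qed.

Lemma not_universal_F : False.
Proof.
have [t1 [t2 [t1s t2s [x1 x0] [y1 y0]]]] := two_reps.
have [G0 [s0 [gs0 r0 H0]]] := rep_to_right_point t1s.
have [G1 [s1 [gs1 r1 H1]]] := rep_to_right_point t2s.
have [G [S [gs [G0E S0E G1E S1E] Sn0 Gc Sc]]] := sphere_path gs0 gs1 r0 r1.
have /choice[p pP] : forall t, exists p, at_point (G t) (S t) p.
  by move=> t; apply: exists_point.
have ps t : star_hom (p t) by have [] := pP t.
have pa t i : p t (a i) = F_gen e (G t)%:A ((S t)%:A * sigma_of e) i by have [_] := pP t.
have cts (t0 : R) (x : E) (eps : R) : 0 < eps -> exists2 d : R, 0 < d &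
    forall t, `|t - t0| < d -> cnorm (p t x - p t0 x) < eps.
  apply: (star_hom_family_continuous ga ps) => i {}eps eps0.
  case: i => [[]|].
  - by exists 1 => // t _; rewrite !pa subrr cnorm0.
  - have w0 := cnorm_ge0 (sigma_of e).
    have w1 : 0 < cnorm (sigma_of e) + 1 by apply: ltr_wpDl.
    have [d d0 dP] := Sc t0 _ (divr_gt0 eps0 w1); exists d => // t /dP.
    rewrite !pa /= -mulrBl -scalerBl mulr_algl cnormZ ltr_pdivlMr//.
    by apply: le_lt_trans; rewrite ler_wpM2l ?normc_ge0// lerDl.
  - have [d d0 dP] := Gc t0 _ eps0; exists d => // t /dP.
    by rewrite !pa /= -scalerBl cnorm_alg.
(* The images of [X true] and [X false] are scalars, so [f] is a difference of moduli; it runs from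
   [1] to [-1]. *)
pose f t := cnorm (p t (X true)) - cnorm (p t (X false)).
have fc : continuous f.
  move=> t0; apply/cvgrPdist_lt => eps eps0; have e2 : 0 < eps / 2 by rewrite divr_gt0.
  have [d1 d10 h1] := cts t0 (X true) _ e2; have [d2 d20 h2] := cts t0 (X false) _ e2.
  apply/nbhs_ballP; exists (Num.min d1 d2) => /=; first by rewrite lt_min d10.
  move=> t; rewrite /ball /= distrC lt_min => /andP[/h1 {}h1 /h2 {}h2].
  exact: (cnorm_diff_lt h1 h2).
have at0 := pP 0; rewrite G0E S0E in at0; have at1 := pP 1; rewrite G1E S1E in at1.
have one : (1 : M2) = 1%:A by rewrite scale1r.
have zero : (0 : M2) = 0%:A by rewrite scale0r.
have f0 : f 0 = 1.
  rewrite /f (H0 _ at0 true 1) ?x1// (H0 _ at0 false 0) ?x0//.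
  by rewrite !cnorm_alg ComplexField.Normc.normc1 ComplexField.Normc.normc0 subr0.
have f1 : f 1 = -1.
  rewrite /f (H1 _ at1 true 0) ?y1// (H1 _ at1 false 1) ?y0//.
  by rewrite !cnorm_alg ComplexField.Normc.normc1 ComplexField.Normc.normc0 sub0r.
have [|||c c01 fc0] := @IVT R f 0 1 0.
- exact: ler01.
- exact: continuous_subspaceT.
- by rewrite f0 f1 ge_min le_max ler01 lerN10 orbT.
have c0 : c != 0 by apply/eqP => cE; move: fc0; rewrite cE f0 => /eqP; rewrite oner_eq0.
have c1 : c != 1.
  by apply/eqP => cE; move: fc0; rewrite cE f1 => /eqP; rewrite oppr_eq0 oner_eq0.
have [z1 z1E] := point_scalar (pP c) true; have [z2 z2E] := point_scalar (pP c) false.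
have zz : normc z1 = normc z2.
  by move: fc0; rewrite /f z1E z2E !cnorm_alg => /eqP; rewrite subr_eq0 => /eqP.
have qs : star_hom (p c \o phi : {lrmorphism E0 -> M2}) by apply: star_hom_comp.
have sqE i : (p c \o phi) (b i) * (p c \o phi) (b i) + (p c \o phi) (b i) * (p c \o phi) (b i)
  = p c (X i).
  by rewrite /X !rmorphD /= !rmorphM.
(* The moduli agree at the zero [c] of [f], and [E0_M2_modulus] makes one of them equal to one. *)
have z11 : normc z1 = 1.
  have [//|] := E0_M2_modulus (E_rel_morph qs bP) (etrans (sqE true) z1E) (etrans (sqE false)
    z2E).
  by rewrite zz.
have gs' : normc (G c) ^+ 2 + (normc (- S c) ^+ 2 + normc (- S c) ^+ 2) = 1 by rewrite normcN.
have [m mP] := exists_point gs'.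
apply: (opposite_points_disjoint (pP c) mP (Sn0 c c0 c1)) => -[] z.
  by rewrite z1E => /alg_inj <-.
by rewrite z2E => /alg_inj <-; rewrite -zz.
Qed.

End NotF.
End Data.

Lemma E_zero_not_isomorphic (y : C) : y <> 0 -> `|y| <= 1 ->
  forall E0 E : cstarAlgType R, is_E 0 E0 -> is_E y E -> ~ cstar_isomorphic E0 E.
Proof.
move=> /eqP y0 y1 E0 E /is_E_universal[b [bP gb ub]] /is_E_universal uE [phi [phis phib]].
have [psi [psis phiK psiK]] := star_hom_inverse phis phib.
have ny0 : 0 < normc y.
  rewrite lt_neqAle normc_ge0 andbT eq_sym; apply: contra_neq y0.
  exact: ComplexField.Normc.eq0_normc.
have : normc y <= 1.
  have h : (`|y| <= 1) = (normc y <= 1) by rewrite normrCE -(lecR (normc y) 1).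
  by rewrite -h.
rewrite le_eqVlt => /predU1P[yn|yn].
  exact: (not_universal_U ub psis phiK (universal_E_U yn uE)).
have yn' : 0 < normc y < 1 by rewrite ny0.
have [a [aP ga ua]] := universal_E_F yn' uE.
have [e eP] := U_matrix_unit.
exact: (not_universal_F gb bP ub phis psis phiK psiK ga aP ua eP).
Qed.

End Distinguish.

Theorem proposition3p4 (R : realType) :
  (forall y1 y2 : R[i],
     ((0 < `|y1| /\ `|y1| < 1) /\ (0 < `|y2| /\ `|y2| < 1)) \/
     (`|y1| = 1 /\ `|y2| = 1) ->
   forall E1 E2 : cstarAlgType R,
     is_E y1 E1 -> is_E y2 E2 -> cstar_isomorphic E1 E2) /\
  (forall y : R[i], y <> 0 -> `|y| <= 1 ->
   forall E0 E : cstarAlgType R,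
     is_E 0 E0 -> is_E y E -> ~ cstar_isomorphic E0 E).
Proof. by split; [apply: E_isomorphic|apply: E_zero_not_isomorphic]. Qed.
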